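(* Let $d\ge 2$, $1\le p<\infty$, and let $w$ be a doubling weight on $\mathbb{B}^d$. Then there is a constant $c>0$, independent of $n$, such that for all positive integers $n$ $$M_n^{\rm wor}(L_{p,w}):=\sup_{0\neq P\in\Pi_n^d}\frac{\|\,|\nabla P|\,\|_{p,w}}{\|P\|_{p,w}}\le c\,n^2 .$$ In particular, for the Jacobi weight $w_\mu(x)=(1-|x|^2)^{\mu-1/2}$ with $\mu\ge 0$ the exponent $2$ is sharp: there are constants $c_1,c_2>0$, independent of $n$, such that for all positive integers $n$ $$c_1 n^2\le M_n^{\rm wor}(L_{p,w_\mu}):=\sup_{0\neq P\in\Pi_n^d}\frac{\|\,|\nabla P|\,\|_{p,w_\mu}}{\|P\|_{p,w_\mu}}\le c_2 n^2 .$$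
   Context: $\mathbb{B}^d=\{x\in\mathbb{R}^d: |x|\le 1\}$ is the closed Euclidean unit ball, $|\cdot|$ the Euclidean norm. For a weight $w$ on $\mathbb{B}^d$ and $1\le p<\infty$, $\|f\|_{p,w}=\big(\int_{\mathbb{B}^d}|f(x)|^p w(x)\,dx\big)^{1/p}$, and $w(E)=\int_E w(x)\,dx$ for measurable $E\subset\mathbb{B}^d$. A weight is a nonnegative integrable function on $\mathbb{B}^d$ that is not a.e. zero. The distance on $\mathbb{B}^d$ is $d(x,y)=\arccos\big(x\cdot y+\sqrt{1-|x|^2}\sqrt{1-|y|^2}\big)$, and $\mathbf{B}(x,r)=\{y\in\mathbb{B}^d: d(x,y)\le r\}$. A weight $w$ is a doubling weight if there is a constant $L>0$ with $w(\mathbf{B}(x,2r))\le L\,w(\mathbf{B}(x,r))$ for all $x\in\mathbb{B}^d$ and $r>0$. $\Pi_n^d$ is the space of real polynomials in $d$ variables of total degree at most $n$; $\nabla P=(\partial_1P,\dots,\partial_dP)$ is the gradient and $|\nabla P|$ its Euclidean length. *)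

(* Defs.v *)
From HB Require Import structures.
From mathcomp Require Import all_boot all_order all_algebra.
From mathcomp Require Import all_classical all_reals all_analysis.
From mathcomp Require mpoly.

(* The notations of mpoly clash with those of the analysis library. *)
Import (canonicals, coercions) mpoly.

Set Implicit Arguments.
Unset Strict Implicit.
Unset Printing Implicit Defensive.

Import Order.TTheory GRing.Theory Num.Theory.
Import numFieldNormedType.Exports.

Local Open Scope classical_set_scope.
Local Open Scope ring_scope.

Section lebesgue_tuple_cons.
Context (R : realType) (n : nat).
Variable m : {sigma_finite_measure set (n.-tuple (measurableTypeR R)) -> \bar R}.

Definition tuple_cons (z : measurableTypeR R * n.-tuple (measurableTypeR R)) :
  n.+1.-tuple (measurableTypeR R) := [tuple of z.1 :: z.2].

Lemma measurable_tuple_cons : measurable_fun [set: _] tuple_cons.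
Proof. exact: (measurable_cons (f := fst) (g := snd)). Qed.

Definition lebesgue_tuple_cons :
    set (n.+1.-tuple (measurableTypeR R)) -> \bar R :=
  pushforward (lebesgue_measure \x m)%E tuple_cons.

HB.instance Definition _ := Measure.copy lebesgue_tuple_cons
  (measure_function_pushforward__canonical__measure_function_Measure
     (lebesgue_measure \x m)%E measurable_tuple_cons).

Lemma lebesgue_tuple_consE (A : set (measurableTypeR R))
    (B : set (n.-tuple (measurableTypeR R))) :
  measurable A -> measurable B ->
  lebesgue_tuple_cons [set t | A (thead t) /\ B [tuple of behead t]] =
  (lebesgue_measure A * m B)%E.
Proof.
move=> mA mB; rewrite -product_measure1E// /lebesgue_tuple_cons /pushforward.
congr (product_measure1 _ _ _); apply/seteqP.
have E z : [tuple of behead (tuple_cons z)] = z.2 by exact/val_inj.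
by split=> -[a t]; rewrite /= theadE E.
Qed.

Let lebesgue_tuple_cons_sigma_finite : sigma_finite setT lebesgue_tuple_cons.
Proof.
have /sigma_finiteP[F [TF ndF Foo]] := sigma_finiteT (@lebesgue_measure R).
have /sigma_finiteP[G [TG ndG Goo]] := sigma_finiteT m.
exists (fun k => [set t | F k (thead t) /\ G k [tuple of behead t]]).
  apply/esym; rewrite -subTset => t _.
  have [i _ Fi] : (\bigcup_k F k) (thead t) by rewrite -TF.
  have [j _ Gj] : (\bigcup_k G k) [tuple of behead t] by rewrite -TG.
  exists (maxn i j) => //; split.
    by move: Fi; exact/subsetPset/ndF/leq_maxl.
  by move: Gj; exact/subsetPset/ndG/leq_maxr.
move=> k; have [mF Fk] := Foo k; have [mG Gk] := Goo k; split.
  apply: measurableI; rewrite -[X in measurable X]setTI.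
    exact: (measurable_tnth ord0).
  exact: (measurable_behead).
by rewrite lebesgue_tuple_consE// lte_mul_pinfty// ge0_fin_numE.
Qed.

HB.instance Definition _ := Measure_isSigmaFinite.Build _ _ _
  lebesgue_tuple_cons lebesgue_tuple_cons_sigma_finite.

End lebesgue_tuple_cons.

Fixpoint lebesgue_tuple (R : realType) (n : nat) :
    {sigma_finite_measure set (n.-tuple (measurableTypeR R)) -> \bar R} :=
  if n is n'.+1 then lebesgue_tuple_cons (lebesgue_tuple R n')
  else \d_[tuple].

Lemma lebesgue_tuple_box (R : realType) (n : nat)
    (A : nat -> set (measurableTypeR R)) :
  (forall i, measurable (A i)) ->
  lebesgue_tuple R n [set t | forall i : 'I_n, A i (tnth t i)] =
  (\prod_(i < n) lebesgue_measure (A i))%E.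
Proof.
elim: n A => [|n IHn] A mA.
  by rewrite big_ord0 /= diracE mem_set// => -[].
rewrite big_ord_recl -(IHn (fun i => A i.+1))// -lebesgue_tuple_consE//; last first.
  rewrite (_ : [set _ | _] = \bigcap_(i in [set: 'I_n])
    ([set: n.-tuple _] `&` (fun t => tnth t i) @^-1` A i.+1)).
    by apply: fin_bigcap_measurable => // i _; exact: measurable_tnth.
  by apply/seteqP; split=> t /= h i; [split=> //; exact: h|case: (h i)].
congr (lebesgue_tuple R n.+1 _); apply/seteqP; split=> t /=.
  move=> At; split=> [|i]; first exact: (At ord0).
  by have := At (lift ord0 i); rewrite (tuple_eta t) tnthS; congr (A _ (tnth _ i));
    exact/val_inj.
case=> A0 At i; have [j ->|->] := unliftP ord0 i; last exact: A0.
by have := At j; rewrite [in X in _ -> X](tuple_eta t) tnthS.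
Qed.

(* The carrier is that of d.-tuple R, but the measurable sets are the Lebesgue
   measurable ones (Caratheodory), not only the Borel ones. *)
Definition euclidean (R : realType) (d : nat) : measurableType _ :=
  caratheodory_type ((lebesgue_tuple R d)^*)%mu.

Definition lebesgue (R : realType) (d : nat) : set (euclidean R d) -> \bar R :=
  @completed_measure_extension _ _ R (lebesgue_tuple R d).
HB.instance Definition _ (R : realType) (d : nat) :=
  Measure.on (@lebesgue R d).

Section weighted_ball.
Context (R : realType) (d : nat).
Implicit Types (x y : euclidean R d) (w f : euclidean R d -> R).
Implicit Types (p mu r : R) (n : nat) (P : mpoly.mpoly d R).

Definition dot x y : R := \sum_(i < d) tnth x i * tnth y i.

Definition enorm x : R := Num.sqrt (dot x x).

Definition unit_ball : set (euclidean R d) := [set x | enorm x <= 1].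

Definition ball_dist x y : R :=
  acos (dot x y +
        Num.sqrt (1 - enorm x ^+ 2) * Num.sqrt (1 - enorm y ^+ 2)).

Definition ball_cap x r : set (euclidean R d) :=
  [set y | unit_ball y /\ ball_dist x y <= r].

Definition is_weight w : Prop :=
  [/\ forall x, unit_ball x -> 0 <= w x,
      (@lebesgue R d).-integrable unit_ball (EFin \o w) &
      ~ {ae @lebesgue R d, forall x, unit_ball x -> w x = 0}].

Definition wmeasure w (A : set (euclidean R d)) : \bar R :=
  (\int[@lebesgue R d]_(x in A) (w x)%:E)%E.

Definition doubling_weight w : Prop :=
  is_weight w /\
  exists2 L : R, 0 < L & forall x r, unit_ball x -> 0 < r ->
    (wmeasure w (ball_cap x (2 * r)) <= L%:E * wmeasure w (ball_cap x r))%E.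

Definition wnorm p w f : \bar R :=
  ((\int[@lebesgue R d]_(x in unit_ball) (`|f x| `^ p * w x)%:E) `^ p^-1)%E.

(* Polynomials of total degree at most n: every monomial that occurs has
   degree at most n. *)
Definition Pi_poly n : set (mpoly.mpoly d R) :=
  [set P | forall m, m \in mpoly.msupp P -> (mpoly.mdeg m <= n)%N].

Definition peval P x : R := mpoly.meval (tnth x) P.

Definition grad_length P x : R :=
  Num.sqrt (\sum_(i < d) peval (mpoly.mderiv i P) x ^+ 2).

(* For a weight w the two norms are finite and the denominator is nonzero, so
   the conventions on the extended quotient play no role. *)
Definition Mwor p w n : \bar R :=
  ereal_sup [set (wnorm p w (grad_length P) / wnorm p w (peval P))%E
            | P in [set P | P != 0 /\ Pi_poly n P]].

(* On the sphere |x| = 1, a null set, the value is the one that powR gives. *)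
Definition jacobi_weight mu x : R := (1 - enorm x ^+ 2) `^ (mu - 2^-1).

End weighted_ball.

(* Main.v *)
Require Import Defs.
From mathcomp Require Import all_boot all_order all_algebra.
From mathcomp Require Import all_classical all_reals all_analysis.
From mathcomp Require Import measurable_realfun.
From mathcomp Require mpoly.
From mathcomp Require Import ring lra.

Import (canonicals, coercions) mpoly.

(* On the unit ball, lifted to the upper hemisphere of the unit sphere of one
   dimension more, the distance is geodesic, and a polynomial of degree n is a
   trigonometric polynomial of degree n along great circles.  Bernstein's
   inequality (by M. Riesz' interpolation formula), applied to the product with
   a power of the Dirichlet kernel, bounds P' and P'' along a curve by a supremum
   of |P| damped like (1 + n dist)^-K.  On segments x + sin^2(t/2)(y - x) the
   second derivative at t = 0 gives |grad P(x)| <= C n^2 A, whenever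
   |P(y)| <= A (1 + n dist(x, y))^K on the ball; on great circles the first
   derivative gives a bound for the oscillation of P at scale 1/n.

   For a doubling weight take a maximal 1/n-separated net x_k with caps B_k, and
   let A_k be the largest value over j of
   sup_{B_j} |P| / (1 + n dist(x_k, x_j))^K.  If K is large, doubling gives
   sum w(B_k) A_k^p <= C sum w(B_j) sup_{B_j} |P|^p.  As P oscillates by at most
   C delta A_j on a cap of radius delta / n, the right-hand side is at most
   C(delta) |P|_p^p + C (C delta)^p sum w(B_j) A_j^p, and the last term is absorbed
   for small delta.

   For the lower bound, P is a power of the Dirichlet kernel in the variable x_1,
   which is the cosine of the distance to the boundary point e_1.

   The Jacobi weight is doubling: homotheties show that Lebesgue measure is
   doubling, disjoint dilates of a thin shell at the boundary that its volume is
   quadratic in the height sqrt(1 - |x|^2), and so the weight of the cap B(x, r)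
   is comparable with (sqrt(1 - |x|^2) + r)^(2 mu - 1) times its volume. *)

Set Implicit Arguments.
Unset Strict Implicit.
Unset Printing Implicit Defensive.

Import Order.TTheory GRing.Theory Num.Theory.
Import numFieldNormedType.Exports.

Local Open Scope classical_set_scope.
Local Open Scope ring_scope.

(** * Trigonometric polynomials and Bernstein's inequality *)

(** A doubling weight has no pointwise regularity; only masses of caps can be compared, at the price
    of powers of the doubling constant L. Hence the passage through the numbers A_k, which convert
    pointwise bounds for P into sums over caps. The exponent K is chosen with 2 L <= 2^K, so that
    the damping beats the growth L^l of the mass of caps of radius 2^l / n, while the auxiliary
    factor of degree K n changes the degree only by a constant factor. The constants are fixed in
    the order L, K, delta, none depending on n. The rate n^2 comes from the metric: near the
    boundary the distance behaves like the square root of the Euclidean one, and running through a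
    segment as sin^2(t/2) keeps the distance from its start below 4 |t|. The speed then vanishes at
    t = 0, so the gradient appears only in the second derivative, and Bernstein's inequality is used
    twice; on great circles once is enough. The lower bound is proved for every doubling weight, so
    that sharpness for the Jacobi weight reduces to its doubling property. *)

Section TrigonometricPolynomials.
Context {R : realType}.
Implicit Types (f g : R -> R) (m n k : nat) (a t A : R).

(** Generated by shifted cosines instead of Fourier coefficients: the phase makes sines and
    translates immediate, and statements linear in the function follow by induction. *)
Inductive trig n : (R -> R) -> Prop :=
| trig_cos k a of (k <= n)%N : trig n (fun t => cos (k%:R * t + a))
| trig_add f g of trig n f & trig n g : trig n (fun t => f t + g t)
| trig_scale a f of trig n f : trig n (fun t => a * f t).

Lemma trig_ext n f g : f =1 g -> trig n f -> trig n g.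
Proof. by move=> /funext ->. Qed.

Lemma trig_widen m n f : (m <= n)%N -> trig m f -> trig n f.
Proof.
move=> mn; elim=> [k a km|g h _ IHg _ IHh|a g _ IHg].
- exact/trig_cos/(leq_trans km).
- exact: trig_add.
- exact: trig_scale.
Qed.

Lemma trig_cst n a : trig n (fun=> a).
Proof.
apply: (@trig_ext _ (fun t => a * cos (0%:R * t + 0))) => [t|].
  by rewrite mul0r addr0 cos0 mulr1.
exact/trig_scale/trig_cos.
Qed.

Lemma trig_cosk n k : (k <= n)%N -> trig n (fun t => cos (k%:R * t)).
Proof.
by move=> kn; apply: (trig_ext _ (trig_cos 0 kn)) => t; rewrite addr0.
Qed.

Lemma trig_cos1 : trig 1 cos.
Proof. by apply: (trig_ext _ (@trig_cosk 1 1 _)) => // t; rewrite mul1r. Qed.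

Lemma trig_sin1 : trig 1 sin.
Proof.
apply: (trig_ext _ (@trig_cos 1 1 (- (pi / 2)) _)) => // t.
by rewrite mul1r cosBpihalf.
Qed.

Lemma trig_sum n (I : Type) (r : seq I) (P : pred I) (F : I -> R -> R) :
  (forall i, P i -> trig n (F i)) -> trig n (fun t => \sum_(i <- r | P i) F i t).
Proof.
move=> tF; elim: r => [|i r IHr].
  by apply: (trig_ext _ (trig_cst n 0)) => t; rewrite big_nil.
case: (boolP (P i)) => Pi.
  apply: (trig_ext _ (trig_add (tF i Pi) IHr)) => t.
  by rewrite big_cons Pi.
by apply: (trig_ext _ IHr) => t; rewrite big_cons (negbTE Pi).
Qed.

Lemma trig_cosM m n a b : trig (m + n)
  (fun t => cos (m%:R * t + a) * cos (n%:R * t + b)).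
Proof.
wlog mn : m n a b / (n <= m)%N => [hw|].
  have [nm|/ltnW mn] := leqP n m; first exact: hw.
  by rewrite addnC; apply: (trig_ext _ (hw n m b a mn)) => t; rewrite mulrC.
apply: (@trig_ext _ (fun t => 2^-1 *
    (cos ((m + n)%:R * t + (a + b)) + cos ((m - n)%:R * t + (a - b))))).
  move=> t; rewrite natrD natrB//.
  rewrite (_ : (_ + _) * t + _ = (m%:R * t + a) + (n%:R * t + b)); last by ring.
  rewrite (_ : (_ - _) * t + _ = (m%:R * t + a) - (n%:R * t + b)); last by ring.
  by rewrite cosD cosB; field.
apply/trig_scale/trig_add; apply: trig_cos => //.
by rewrite (leq_trans (leq_subr _ _))// leq_addr.
Qed.

Lemma trig_mul m n f g : trig m f -> trig n g ->
  trig (m + n) (fun t => f t * g t).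
Proof.
move=> tf tg; elim: tf => [k a km|f1 f2 _ IH1 _ IH2|a f1 _ IH1].
- elim: tg => [l b ln|g1 g2 _ IH1 _ IH2|b g1 _ IH1].
  + exact: trig_widen (leq_add km ln) (trig_cosM k l a b).
  + by apply: (trig_ext _ (trig_add IH1 IH2)) => t; rewrite mulrDr.
  + by apply: (trig_ext _ (trig_scale b IH1)) => t; rewrite mulrCA.
- by apply: (trig_ext _ (trig_add IH1 IH2)) => t; rewrite mulrDl.
- by apply: (trig_ext _ (trig_scale a IH1)) => t; rewrite mulrA.
Qed.

Lemma trig_exp n k f : trig n f -> trig (k * n) (fun t => f t ^+ k).
Proof.
move=> tf; elim: k => [|k IH]; first exact: trig_cst.
rewrite mulSn; apply: (trig_ext _ (trig_mul tf IH)) => t.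
by rewrite exprS.
Qed.

Lemma trig_shift n f a : trig n f -> trig n (fun t => f (a + t)).
Proof.
elim=> [k b kn|f1 f2 _ IH1 _ IH2|b f1 _ IH1].
- apply: (trig_ext _ (@trig_cos n k (k%:R * a + b) kn)) => t.
  by congr cos; ring.
- exact: trig_add.
- exact: trig_scale.
Qed.

Lemma cosDnat2pi a k : cos (a + k%:R * (pi *+ 2)) = cos a :> R.
Proof. by rewrite mulr_natl (periodicn (@cosD2pi R)). Qed.

Lemma trig_periodic n f t : trig n f -> f (t + pi *+ 2) = f t.
Proof.
elim=> [k b kn|f1 f2 _ IH1 _ IH2|b f1 _ IH1].
- by rewrite -[RHS](cosDnat2pi _ k); congr cos; ring.
- by rewrite IH1 IH2.
- by rewrite IH1.
Qed.

Lemma trig_reduce n f t : trig n f -> exists2 s, `|s| <= pi & f s = f t.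
Proof.
move=> tf; pose z := Num.floor ((t + pi) / (pi *+ 2)).
have pi2 : 0 < (pi : R) *+ 2 by rewrite mulrn_wgt0// pi_gt0.
have /andP[z1 z2] : z%:~R <= (t + pi) / (pi *+ 2) < (z + 1)%:~R.
  by rewrite floor_itv.
rewrite ler_pdivlMr// in z1; rewrite ltr_pdivrMr// in z2.
exists (t - z%:~R * (pi *+ 2)).
  rewrite ler_norml; apply/andP; split.
    by rewrite lerBrDl -lerBrDr opprK.
  by move: z2; rewrite intrD mulrDl mul1r mulr2n; lra.
have perk k s : f (s + k%:R * (pi *+ 2)) = f s.
  elim: k s => [|k IH] s; first by rewrite mul0r addr0.
  by rewrite -natr1 mulrDl mul1r addrA (trig_periodic _ tf).
case: (z) => k.
  by rewrite -(perk k (t - _)) -pmulrn subrK.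
by rewrite NegzE -[RHS](perk k.+1) mulNr opprK.
Qed.

Lemma alternating_telescope N (u : nat -> R) :
  \sum_(j < N) (-1) ^+ j * (u j.+1 + u j) = u 0%N - (-1) ^+ N * u N.
Proof.
elim: N => [|N IH]; first by rewrite big_ord0 expr0 mul1r subrr.
by rewrite big_ord_recr/= IH exprS; ring.
Qed.

(** * M. Riesz' interpolation formula for the derivative *)

Section Riesz.
Variable n : nat.
Hypothesis n_gt0 : (0 < n)%N.

Let n0 : n%:R != 0 :> R. Proof. by rewrite pnatr_eq0 -lt0n. Qed.

Definition riesz_node (j : nat) : R := (2 * j%:R + 1) * pi / (2 * n%:R).

(** The usual coefficient (-1)^j / (4 n sin^2 (t_j / 2)), since 1 - cos t = 2 sin^2 (t / 2); the
    nodes t_j are the zeros of cos (n t) in (0, 2 pi). *)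
Definition riesz_weight (j : nat) : R :=
  (-1) ^+ j / (2 * n%:R * (1 - cos (riesz_node j))).

Lemma mul_riesz_node j : n%:R * riesz_node j = j%:R * pi + pi / 2.
Proof. by rewrite /riesz_node; field. Qed.

Lemma sinDnpi a j : sin (j%:R * pi + a) = (-1) ^+ j * sin a :> R.
Proof. by rewrite mulr_natl addrC (alternatingn (@sinDpi R)). Qed.

Lemma cosDnpi a j : cos (j%:R * pi + a) = (-1) ^+ j * cos a :> R.
Proof. by rewrite mulr_natl addrC (alternatingn (@cosDpi R)). Qed.

Lemma sin_riesz_node j : sin (n%:R * riesz_node j) = (-1) ^+ j.
Proof. by rewrite mul_riesz_node sinDnpi sin_pihalf mulr1. Qed.

Lemma cos_riesz_node j : cos (n%:R * riesz_node j) = 0.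
Proof. by rewrite mul_riesz_node cosDnpi cos_pihalf mulr0. Qed.

Lemma riesz_node_cos_lt1 j : (j < 2 * n)%N -> 0 < 1 - cos (riesz_node j).
Proof.
move=> jn; have pi0 := pi_gt0 R.
have h : 0 < riesz_node j / 2 < pi.
  have n1 : 0 < n%:R :> R by rewrite ltr0n.
  apply/andP; split.
    by rewrite divr_gt0// divr_gt0// mulr_gt0// ?ltr_wpDl// mulr_gt0.
  rewrite /riesz_node ltr_pdivrMr// ltr_pdivrMr ?mulr_gt0//.
  rewrite [ltRHS](_ : _ = (4 * n%:R) * pi); last by ring.
  rewrite ltr_pM2r//.
  have : (j.+1%:R <= (2 * n)%:R :> R) by rewrite ler_nat.
  by rewrite natrM -natr1; lra.
have s0 := sin_gt0_pi h; have ss := sin2cos2 (riesz_node j / 2).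
have : 0 < sin (riesz_node j / 2) ^+ 2 by rewrite exprn_gt0.
have -> : cos (riesz_node j) = cos (riesz_node j / 2) ^+ 2 *+ 2 - 1.
  by rewrite -cos_mulr2n mulr2n -splitr.
by rewrite mulr2n; lra.
Qed.

(** A second difference in k multiplies sin (k t) and cos (k t) by 2 cos t - 2; this factor cancels
    the denominator of the weight and leaves an alternating sum. *)
Lemma riesz_weight_sum_sd (G : nat -> R) :
  \sum_(j < 2 * n) riesz_weight j * ((2 * cos (riesz_node j) - 2) * G j) =
  - n%:R^-1 * \sum_(j < 2 * n) (-1) ^+ j * G j.
Proof.
rewrite mulr_sumr; apply: eq_bigr => j _; rewrite /riesz_weight.
have h : 1 - cos (riesz_node j) != 0 by rewrite gt_eqF// riesz_node_cos_lt1.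
by field; rewrite n0 h.
Qed.

(** Multiplying by cos b, with b half the step of k t_j, turns each term into a sum of two
    neighbouring values, so that the alternating sum telescopes; its ends agree by periodicity. For
    k < n, cos b is nonzero. Sine and cosine both satisfy [h2]. *)
Lemma sum_alt_riesz k (h : R -> R) (hpi : forall s, h (s + pi *+ 2) = h s)
    (h2 : forall a b, h (a + b) + h (a - b) = 2 * (h a * cos b)) :
  (k < n)%N -> \sum_(j < 2 * n) (-1) ^+ j * h (k%:R * riesz_node j) = 0.
Proof.
move=> kn; pose b : R := k%:R * pi / (2 * n%:R).
have n1 : 0 < n%:R :> R by rewrite ltr0n.
have b0 : 0 < cos b.
  have p0 := pi_gt0 R; apply: cos_gt0_pihalf; apply/andP; split.
    rewrite (@lt_le_trans _ _ 0)//; first by rewrite oppr_lt0 divr_gt0.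
    by rewrite divr_ge0 ?mulr_ge0// ltW.
  rewrite /b ltr_pdivrMr ?mulr_gt0// [ltRHS](_ : _ = n%:R * pi); last by field.
  by rewrite ltr_pM2r// ltr_nat.
apply: (mulfI (lt0r_neq0 b0)); rewrite mulr0 mulr_sumr.
pose u j : R := h (k%:R * j%:R * pi / n%:R) / 2.
under eq_bigr => j _.
  have -> : cos b * ((-1) ^+ j * h (k%:R * riesz_node j)) =
    (-1) ^+ j * (u j.+1 + u j).
    rewrite mulrCA; congr (_ * _).
    rewrite /u -mulrDl [X in h X + _](_ : _ = k%:R * riesz_node j + b); last first.
      by rewrite /riesz_node /b -natr1; field.
    rewrite [X in _ + h X](_ : _ = k%:R * riesz_node j - b); last first.
      by rewrite /riesz_node /b; field.
    by rewrite h2; field.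
  over.
rewrite alternating_telescope exprM sqrrN expr1n expr1n mul1r.
rewrite /u mulr0 !mul0r natrM (_ : _ / n%:R = 0 + k%:R * (pi *+ 2)).
  have hk m s : h (s + m%:R * (pi *+ 2)) = h s.
    elim: m s => [|m IH] s; first by rewrite mul0r addr0.
    by rewrite -natr1 mulrDl mul1r addrA hpi.
  by rewrite hk subrr.
by rewrite add0r; field.
Qed.

(* The sums of weight times sin (k t_j), or cos (k t_j), satisfy a second-order
   recursion in k, whose inhomogeneous term vanishes for 0 < k < n. *)
Lemma riesz_sin k : (k <= n)%N ->
  \sum_(j < 2 * n) riesz_weight j * sin (k%:R * riesz_node j) = k%:R.
Proof.
pose S k := \sum_(j < 2 * n) riesz_weight j * sin (k%:R * riesz_node j).
have rec k' : S k'.+2 - 2 * S k'.+1 + S k' =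
    - n%:R^-1 * \sum_(j < 2 * n) (-1) ^+ j * sin (k'.+1%:R * riesz_node j).
  rewrite /S mulr_sumr -sumrB -big_split/=.
  rewrite -(riesz_weight_sum_sd (fun j => sin (k'.+1%:R * riesz_node j))).
  apply: eq_bigr => j _; set t := riesz_node j.
  rewrite (_ : k'.+2%:R * t = k'.+1%:R * t + t); last by rewrite -[k'.+2%:R]natr1; ring.
  rewrite [in RHS]mulrBl [X in _ + _ * sin X](_ : k'%:R * t = k'.+1%:R * t - t);
    last by rewrite -natr1; ring.
  by rewrite sinD sinB; ring.
have S0 : S 0%N = 0.
  by rewrite /S big1// => j _; rewrite mul0r sin0 mulr0.
have Slin k' : (k' <= n)%N -> S k' = k'%:R * S 1%N.
  elim/ltn_ind: k' => -[|[|k']] IH kn; first by rewrite S0 mul0r.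
    by rewrite mul1r.
  have := rec k'; rewrite sum_alt_riesz//; last 2 first.
    exact: sinD2pi.
    by move=> a b; rewrite sinD sinB; ring.
  rewrite mulr0 (IH k'.+1) ?(IH k')//; [|by rewrite ltnW// ltnW|by rewrite ltnW].
  by rewrite -[k'.+2%:R]natr1 -[k'.+1%:R]natr1; lra.
(* The recursion leaves S 1 free. As cos (n t_j) = 0, the sums for n - 1 and n + 1 agree, while the
   inhomogeneous term at n is -2; this forces S 1 = 1. *)
have Sn : S n.+1 = S n.-1.
  apply: eq_bigr => j _; congr (_ * _); set t := riesz_node j.
  rewrite -natr1 (_ : n.-1%:R = n%:R - 1); last by rewrite -[in RHS](prednK n_gt0) -natr1 addrK.
  rewrite mulrDl mulrBl mul1r sinD sinB cos_riesz_node; ring.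
have S1 : S 1%N = 1.
  have := rec n.-1; rewrite !prednK// Sn.
  under eq_bigr do rewrite sin_riesz_node -expr2 sqrr_sign.
  rewrite sumr_const card_ord (Slin n)// (Slin n.-1) ?leq_pred//.
  rewrite (_ : n.-1%:R = n%:R - 1); last by rewrite -[in RHS](prednK n_gt0) -natr1 addrK.
  rewrite natrM mulNr (_ : n%:R^-1 * (2 * n%:R) = 2); last by field.
  by lra.
by move=> kn; rewrite -/(S k) Slin// S1 mulr1.
Qed.

(** The same recursion; evenness of the cosine in k gives S 1 = S 0, so S is constant up to n, where
    it vanishes because every cos (n t_j) does. *)
Lemma riesz_cos k : (k <= n)%N ->
  \sum_(j < 2 * n) riesz_weight j * cos (k%:R * riesz_node j) = 0.
Proof.
pose S k := \sum_(j < 2 * n) riesz_weight j * cos (k%:R * riesz_node j).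
have sa k' : (k' < n)%N ->
    \sum_(j < 2 * n) (-1) ^+ j * cos (k'%:R * riesz_node j) = 0.
  apply: sum_alt_riesz; first exact: cosD2pi.
  by move=> a b; rewrite cosD cosB; ring.
have rec k' : S k'.+2 - 2 * S k'.+1 + S k' =
    - n%:R^-1 * \sum_(j < 2 * n) (-1) ^+ j * cos (k'.+1%:R * riesz_node j).
  rewrite /S mulr_sumr -sumrB -big_split/=.
  rewrite -(riesz_weight_sum_sd (fun j => cos (k'.+1%:R * riesz_node j))).
  apply: eq_bigr => j _; set t := riesz_node j.
  rewrite (_ : k'.+2%:R * t = k'.+1%:R * t + t); last by rewrite -[k'.+2%:R]natr1; ring.
  rewrite [in RHS]mulrBl [X in _ + _ * cos X](_ : k'%:R * t = k'.+1%:R * t - t);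
    last by rewrite -natr1; ring.
  by rewrite cosD cosB; ring.
have S1 : S 1%N = S 0%N.
  have : 2 * S 1%N - 2 * S 0%N =
      - n%:R^-1 * \sum_(j < 2 * n) (-1) ^+ j * cos (0%:R * riesz_node j).
    rewrite /S !mulr_sumr -sumrB -mulr_sumr -(riesz_weight_sum_sd (fun j => cos (0%:R * riesz_node j))).
    by apply: eq_bigr => j _; rewrite mul0r mul1r cos0; ring.
  by rewrite sa// mulr0; lra.
have Scst k' : (k' <= n)%N -> S k' = S 0%N.
  elim/ltn_ind: k' => -[|[|k']] IH kn //.
  have := rec k'; rewrite sa// mulr0 (IH k'.+1) ?(IH k')//;
    [|by rewrite ltnW// ltnW|by rewrite ltnW].
  by lra.
have Sn : S n = 0.
  by rewrite /S big1// => j _; rewrite cos_riesz_node mulr0.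
by move=> kn; rewrite -/(S k) Scst// -(Scst n).
Qed.

(** At the nodes sin (n t_j) is the sign of the weight, so this is the case k = n of [riesz_sin]. It
    supplies the constant n of Bernstein's inequality. *)
Lemma riesz_weight_norm : \sum_(j < 2 * n) `|riesz_weight j| = n%:R.
Proof.
rewrite -(riesz_sin (leqnn n)); apply: eq_bigr => j _.
rewrite sin_riesz_node /riesz_weight normrM normrX normrN1 expr1n mul1r.
rewrite ger0_norm; last first.
  by rewrite invr_ge0 mulr_ge0// ltW// riesz_node_cos_lt1.
by rewrite [RHS]mulrAC -expr2 sqrr_sign mul1r.
Qed.

Lemma riesz_derive f t : trig n f ->
  is_derive t 1 f (\sum_(j < 2 * n) riesz_weight j * f (t + riesz_node j)).
Proof.
elim=> [k a kn|g h _ IHg _ IHh|a g _ IHg].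
- have -> : \sum_(j < 2 * n) riesz_weight j * cos (k%:R * (t + riesz_node j) + a) =
      - sin (k%:R * t + a) * k%:R.
    transitivity (cos (k%:R * t + a) * \sum_(j < 2 * n) riesz_weight j * cos (k%:R * riesz_node j)
       - sin (k%:R * t + a) * \sum_(j < 2 * n) riesz_weight j * sin (k%:R * riesz_node j)).
      rewrite !mulr_sumr -sumrB; apply: eq_bigr => j _.
      rewrite (_ : k%:R * (t + _) + a = (k%:R * t + a) + k%:R * riesz_node j); last by ring.
      by rewrite cosD; ring.
    by rewrite riesz_cos// riesz_sin//; ring.
  apply: is_derive_eq.
  by rewrite !addr0 /GRing.scale/= mulr1.
- apply: is_derive_eq.
  by rewrite -big_split; apply: eq_bigr => j _; rewrite mulrDr.
- apply: is_derive_eq; rewrite /GRing.scale/= mulr_sumr.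
  by apply: eq_bigr => j _; rewrite mulrCA.
Qed.

End Riesz.

End TrigonometricPolynomials.

Section LocalBernstein.
Context {R : realType}.
Implicit Types (f g h : R -> R) (m n k K : nat) (a t x A : R).

(** The interpolation formula makes the derivative a combination of translates, hence again of
    degree n, and the lemma can be iterated. *)
Lemma trig_derivative n f : (0 < n)%N -> trig n f ->
  exists g, [/\ trig n g, forall t, is_derive t 1 f (g t) &
    forall A, (forall t, `|f t| <= A) -> forall t, `|g t| <= n%:R * A].
Proof.
move=> n0 tf; exists (fun t => \sum_(j < 2 * n) riesz_weight n j * f (t + riesz_node n j)).
split=> [|t|A fA t].
- apply: trig_sum => j _; apply: trig_scale.
  by apply: (trig_ext _ (trig_shift (riesz_node n j) tf)) => t; rewrite addrC.
- exact: riesz_derive.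
- rewrite -(riesz_weight_norm n0) mulr_suml (le_trans (ler_norm_sum _ _ _))//.
  by apply: ler_sum => j _; rewrite normrM ler_wpM2l.
Qed.

Lemma is_derive_uniq f t a b :
  is_derive t 1 f a -> is_derive t 1 f b -> a = b.
Proof. by move=> [_ <-] [_ <-]. Qed.

Lemma is_derive_mul f g t a b : is_derive t 1 f a -> is_derive t 1 g b ->
  is_derive t 1 (fun t => f t * g t) (a * g t + f t * b).
Proof.
by move=> df dg; apply: is_derive_eq; rewrite /GRing.scale/=; ring.
Qed.

Lemma sin_MVT x : 0 <= x <= pi -> exists2 y, 0 <= y <= x & sin x = x * cos y.
Proof.
move=> /andP[x0 xpi]; have [y] : exists2 y, y \in `[0, x]%R & sin x - sin 0 = cos y * (x - 0).
  apply: MVT_segment => //.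
  by apply: continuous_subspaceT => ?; exact: continuous_sin.
by rewrite in_itv/= sin0 !subr0 => yx ->; exists y => //; rewrite mulrC.
Qed.

Lemma sin_le_id x : 0 <= x <= pi -> sin x <= x.
Proof.
by move=> xpi; have [y _ ->] := sin_MVT xpi; case/andP: xpi => x0 _;
  rewrite ler_piMr// cos_le1.
Qed.

(** Write sin x = 2 sin (x / 2) cos (x / 2) = x cos y cos (x / 2) with y in [0, x / 2]; both cosines
    are at least cos (pi / 4), whose square is 1 / 2. *)
Lemma sin_ge_half x : 0 <= x <= pi / 2 -> x / 2 <= sin x.
Proof.
move=> /andP[x0 xpi]; have pi0 := @pi_ge0 R.
have x20 : 0 <= x / 2 by rewrite divr_ge0.
have x2pi : x / 2 <= pi by lra.
have [y /andP[y0 yx] sx] : exists2 y, 0 <= y <= x / 2 & sin (x / 2) = x / 2 * cos y.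
  by apply: sin_MVT; rewrite x20.
have c4 : cos (pi / 2 / 2) ^+ 2 = 2^-1 :> R.
  have := @cos_mulr2n R (pi / 2 / 2).
  by rewrite [(_ / _) *+ 2]mulr2n -splitr cos_pihalf mulr2n; lra.
have mono (u v : R) : 0 <= u -> u <= v -> v <= pi / 2 / 2 -> cos v <= cos u.
  move=> u0; rewrite le_eqVlt => /orP[/eqP->//|uv vp].
  rewrite ltW// ltr_cos// in_itv/= ?u0 ?(le_trans u0 (ltW uv))/=; lra.
have c40 : 0 <= cos (pi / 2 / 2) :> R.
  by apply: cos_ge0_pihalf; apply/andP; split; lra.
have cx : cos (pi / 2 / 2) <= cos (x / 2) by apply: mono => //; lra.
have cy : cos (pi / 2 / 2) <= cos y by apply: mono => //; lra.
rewrite [in leRHS](splitr x) -mulr2n sin_mulr2n sx.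
rewrite (_ : _ *+ 2 = x * (cos (x / 2) * cos y)); last by rewrite mulr2n; field.
by rewrite ler_wpM2l// -[leLHS]c4 expr2 ler_pM.
Qed.

Lemma one_sub_cos x : 1 - cos x = 2 * sin (x / 2) ^+ 2.
Proof.
by rewrite {1}[x]splitr -mulr2n cos_mulr2n cos2sin2 mulr2n; ring.
Qed.

Lemma one_sub_cos_ge x : 0 <= x <= pi -> x ^+ 2 / 8 <= 1 - cos x.
Proof.
move=> /andP[x0 xpi]; rewrite one_sub_cos.
have h : x / 2 / 2 <= sin (x / 2) by apply: sin_ge_half; apply/andP; split; lra.
have : (x / 2 / 2) ^+ 2 <= sin (x / 2) ^+ 2.
  by rewrite ler_sqr// nnegrE ?divr_ge0// (le_trans _ h)// !divr_ge0.
by lra.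
Qed.

Lemma one_sub_cos_le x : 0 <= x <= pi -> 1 - cos x <= x ^+ 2 / 2.
Proof.
move=> /andP[x0 xpi]; rewrite one_sub_cos.
have h : sin (x / 2) <= x / 2 by apply: sin_le_id; apply/andP; split; lra.
have s0 : 0 <= sin (x / 2) by apply: sin_ge0_pi; apply/andP; split; lra.
have : sin (x / 2) ^+ 2 <= (x / 2) ^+ 2.
  by rewrite ler_sqr// nnegrE ?divr_ge0.
by lra.
Qed.

(** The Dirichlet kernel divided by its value 2 n + 1 at 0, so that multiplying by it preserves
    values at 0. *)
Definition dirichlet n t : R :=
  (1 + 2 * \sum_(k < n) cos (k.+1%:R * t)) / (2 * n%:R + 1).

Let den_gt0 n : 0 < 2 * n%:R + 1 :> R.
Proof. by rewrite ltr_wpDl// mulr_ge0. Qed.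

Lemma trig_dirichlet n : trig n (dirichlet n).
Proof.
apply: (@trig_ext _ _ (fun t => (2 * n%:R + 1)^-1 *
    (1 + 2 * \sum_(k < n) cos (k.+1%:R * t)))) => [t|].
  by rewrite mulrC.
apply/trig_scale/trig_add; first exact: trig_cst.
by apply/trig_scale/trig_sum => k _; apply: trig_cosk; exact: ltn_ord.
Qed.

Lemma dirichlet0 n : dirichlet n 0 = 1.
Proof.
rewrite /dirichlet (eq_bigr (fun=> 1)) => [|k _]; last by rewrite mulr0 cos0.
rewrite sumr_const card_ord addrC divff// gt_eqF//.
Qed.

Lemma dirichlet_le1 n t : `|dirichlet n t| <= 1.
Proof.
rewrite /dirichlet normrM normfV (gtr0_norm (den_gt0 n)) ler_pdivrMr// mul1r.
rewrite addrC (le_trans (ler_normD _ _))// normr1 lerD2r normrM ger0_norm//.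
rewrite ler_pM2l// (le_trans (ler_norm_sum _ _ _))//.
rewrite (le_trans (ler_sum _ (fun i _ => cos_max _)))//.
by rewrite sumr_const card_ord.
Qed.

Lemma dirichlet_sin n t :
  (2 * n%:R + 1) * dirichlet n t * sin (t / 2) = sin ((n%:R + 2^-1) * t).
Proof.
rewrite mulrC /dirichlet [X in _ * X]mulrC divfK ?gt_eqF//.
elim: n => [|n IH].
  by rewrite big_ord0 mulr0 addr0 mulr1 add0r [2^-1 * t]mulrC.
rewrite big_ord_recr/= [2 * _]mulrDr addrA mulrDr IH.
rewrite (_ : (n.+1%:R + 2^-1) * t = n.+1%:R * t + t / 2); last by field.
rewrite (_ : (n%:R + 2^-1) * t = n.+1%:R * t - t / 2); last by rewrite -natr1; field.
by rewrite sinB sinD; ring.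
Qed.

Lemma dirichlet_decay n t : `|t| <= pi -> `|dirichlet n t| * (n%:R * `|t|) <= 2.
Proof.
move=> tpi.
have h : `|t| / 2 / 2 <= `|sin (t / 2)|.
  have s : `|sin (t / 2)| = sin (`|t| / 2).
    have [t0|t0] := leP 0 t.
      move: tpi; rewrite (ger0_norm t0) => tpi; rewrite ger0_norm//.
      by rewrite sin_ge0_pi//; apply/andP; split; lra.
    move: tpi; rewrite (ltr0_norm t0) => tpi.
    rewrite -normrN -sinN -mulNr ger0_norm// sin_ge0_pi//.
    by apply/andP; split; lra.
  rewrite s sin_ge_half// divr_ge0//= ler_pM2r//.
have := sin_max ((n%:R + 2^-1) * t); rewrite -dirichlet_sin.
move: (dirichlet n t) => u; rewrite !normrM (gtr0_norm (den_gt0 n)).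
have : 0 <= `|u| by [].
move: `|u| => D D0 hs.
suff : (2 * n%:R) * D * (`|t| / 2 / 2) <= (2 * n%:R + 1) * D * `|sin (t / 2)|.
  by lra.
apply: ler_pM => //; first by rewrite !mulr_ge0.
by rewrite ler_wpM2r// lerDl.
Qed.

(** The bounds |D| <= 1 and |D| n |t| <= 2 add up to the 3. *)
Lemma dirichlet_exp_decay n K t : `|t| <= pi ->
  `|dirichlet n t ^+ K| * (1 + n%:R * `|t|) ^+ K <= 3 ^+ K.
Proof.
move=> tpi; rewrite normrX -exprMn lerXn2r// ?nnegrE//.
rewrite mulrDr mulr1.
by have := dirichlet_le1 n t; have := dirichlet_decay n tpi; lra.
Qed.

Section Local.
Variables (n K : nat) (f : R -> R) (A : R).
Hypotheses (n0 : (0 < n)%N) (tf : trig n f) (A0 : 0 <= A).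
Hypothesis fA : forall t, `|t| <= pi -> `|f t| <= A * (1 + n%:R * `|t|) ^+ K.

Let N := (K.+1 * n)%N.

(* Multiplying by the K-th power of the kernel turns the local growth condition
   into a global bound without changing the value at 0. *)
Lemma local_bernstein2 f1 b : (forall t, is_derive t 1 f (f1 t)) ->
  is_derive (0 : R) 1 f1 b ->
  `|f1 0| <= 2 * N%:R * (3 ^+ K * A) /\ `|b| <= 6 * N%:R ^+ 2 * (3 ^+ K * A).
Proof.
move=> df df1; set A' := 3 ^+ K * A.
have N0 : (0 < N)%N by rewrite muln_gt0.
pose h t := dirichlet n t ^+ K.
have th : trig N h.
  by apply: (@trig_widen _ (K * n)); [rewrite leq_mul2r leqnSn orbT|exact/trig_exp/trig_dirichlet].
have h0 : h 0 = 1 by rewrite /h dirichlet0 expr1n.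
have h_le1 t : `|h t| <= 1.
  by rewrite /h normrX exprn_ile1// dirichlet_le1.
have tg : trig N (fun t => f t * h t).
  by rewrite /N mulSn; apply: trig_mul => //; exact/trig_exp/trig_dirichlet.
have gA t : `|f t * h t| <= A'.
  have [s spi <-] := trig_reduce t tg.
  rewrite normrM /A' (le_trans (ler_wpM2r _ (fA spi)))//.
  by rewrite -mulrA [in leRHS]mulrC ler_wpM2l// mulrC dirichlet_exp_decay.
have f0A : `|f 0| <= A'.
  by have := gA 0; rewrite h0 mulr1.
have [h1 [th1 dh /(_ 1 h_le1) bh]] := trig_derivative N0 th.
have [h2 [th2 dh1 /(_ _ bh) bh1]] := trig_derivative N0 th1.
have [g1 [tg1 dg /(_ A' gA) bg]] := trig_derivative N0 tg.
have [g2 [tg2 dg1 /(_ _ bg) bg1]] := trig_derivative N0 tg1.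
have g1E t : g1 t = f1 t * h t + f t * h1 t.
  exact: is_derive_uniq (dg t) (is_derive_mul (df t) (dh t)).
have g2E : g2 0 = b + 2 * (f1 0 * h1 0) + f 0 * h2 0.
  have g2' := is_deriveD (is_derive_mul df1 (dh 0)) (is_derive_mul (df 0) (dh1 0)).
  rewrite (_ : g1 = fun t => f1 t * h t + f t * h1 t) in dg1; last exact/funext.
  by rewrite (is_derive_uniq (dg1 0) g2') h0; ring.
have A'0 : 0 <= A' by rewrite mulr_ge0.
have N0' : 0 <= N%:R :> R by [].
have b1 : `|f1 0| <= 2 * N%:R * A'.
  have -> : f1 0 = g1 0 - f 0 * h1 0 by rewrite g1E h0 mulr1 addrK.
  rewrite (le_trans (ler_normB _ _))// normrM.
  have : `|f 0| * `|h1 0| <= A' * N%:R.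
    by rewrite ler_pM//; have := bh 0; rewrite mulr1.
  by have := bg 0; lra.
split=> //.
(* The second derivative of the product, solved for that of f. The three terms contribute 1, 4 and 1
   times N^2 A', the 4 through the bound just proved for [f1 0]. *)
have -> : b = g2 0 - (2 * (f1 0 * h1 0) + f 0 * h2 0) by rewrite g2E; ring.
rewrite (le_trans (ler_normB _ _))//.
have c1 : `|f1 0 * h1 0| <= 2 * N%:R * A' * N%:R.
  by rewrite normrM ler_pM//; have := bh 0; rewrite mulr1.
have c2 : `|f 0 * h2 0| <= A' * N%:R ^+ 2.
  by rewrite normrM ler_pM//; have := bh1 0; rewrite mulr1 expr2.
have c3 : `|g2 0| <= N%:R ^+ 2 * A'.
  by have := bg1 0; rewrite mulrA expr2.
have := ler_normD (2 * (f1 0 * h1 0)) (f 0 * h2 0).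
rewrite normrM [`|2|]ger0_norm// => c4.
by rewrite expr2 in c2 c3 *; lra.
Qed.

Lemma local_bernstein a : is_derive (0 : R) 1 f a -> `|a| <= 2 * N%:R * (3 ^+ K * A).
Proof.
move=> dfa; have [f1 [tf1 df _]] := trig_derivative n0 tf.
have [f2 [_ df1 _]] := trig_derivative n0 tf1.
by rewrite (is_derive_uniq dfa (df 0)); have [] := local_bernstein2 df (df1 0).
Qed.

End Local.

End LocalBernstein.

(** * Polynomials on the ball *)

Section PolynomialsAlongCurves.
Context {R : realType} {d : nat}.
Implicit Types (P Q : mpoly.mpoly d R) (i : 'I_d) (v : 'I_d -> R).

Definition mvar i : mpoly.mpoly d R := mpoly.mpolyX R (mpoly.mnm1 i).

(** Induction over ring operations instead of monomials: the chain rule then needs only the sum and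
    product rules. *)
Lemma mpoly_ring_ind (T : mpoly.mpoly d R -> Prop) :
  (forall c, T (mpoly.mpolyC d c)) -> (forall i, T (mvar i)) ->
  (forall P Q, T P -> T Q -> T (P + Q)) ->
  (forall P Q, T P -> T Q -> T (P * Q)) -> forall P, T P.
Proof.
move=> TC TX TD TM; elim/mpoly.mpolyind => [|c m P _ _ TP].
  by rewrite -(mpoly.mpolyC0 d); exact: TC.
apply: TD => //; rewrite -mpoly.mul_mpolyC; apply: (TM) => //.
rewrite mpoly.mpolyXE_id; apply: big_ind => // [|i _].
  by rewrite -(mpoly.mpolyC1 d); exact: TC.
elim: (mpoly.fun_of_multinom _ _) => [|k IH].
  by rewrite expr0 -(mpoly.mpolyC1 d); exact: TC.
by rewrite exprS; apply: TM => //; exact: TX.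
Qed.

Lemma mderiv_mvar i j : mpoly.mderiv i (mvar j) = (j == i)%:R.
Proof.
rewrite mpoly.mderivX mpoly.mnm1E.
have [<-|_] := eqVneq j i; last by rewrite scale0r.
by rewrite scale1r (_ : mpoly.mnm_sub _ _ = mpoly.mnm0) ?mpoly.mpolyX0//;
  apply/mpoly.mnmP => k; rewrite mpoly.mnmBE mpoly.mnm0E subnn.
Qed.

Lemma is_derive_meval (v : 'I_d -> R -> R) (v' : 'I_d -> R) (t : R) P :
  (forall i, is_derive t 1 (v i) (v' i)) ->
  is_derive t 1 (fun t => mpoly.meval (v^~ t) P)
    (\sum_(i < d) mpoly.meval (v^~ t) (mpoly.mderiv i P) * v' i).
Proof.
move=> dv; elim/mpoly_ring_ind: P => [c|i|P Q dP dQ|P Q dP dQ].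
- rewrite (_ : (fun t => _) = fun=> c); last first.
    by apply/funext => s; rewrite mpoly.mevalC.
  rewrite big1 => [|i _]; first exact: is_derive_cst.
  by rewrite mpoly.mderivC mpoly.meval0 mul0r.
- rewrite (_ : (fun t => _) = v i); last first.
    by apply/funext => s; rewrite mpoly.mevalXU.
  rewrite (bigD1 i)//= mderiv_mvar eqxx mpoly.meval1 mul1r big1 ?addr0//.
  by move=> j ji; rewrite mderiv_mvar eq_sym (negbTE ji) mpoly.meval0 mul0r.
- rewrite (_ : (fun t => _) = (fun t => mpoly.meval (v^~ t) P) +
                              (fun t => mpoly.meval (v^~ t) Q)); last first.
    by apply/funext => s; rewrite mpoly.mevalD.
  rewrite (eq_bigr _ (fun i _ => congr1 (fun u => mpoly.meval _ u * _) (mpoly.mderivD i P Q))).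
  rewrite (eq_bigr _ (fun i _ => congr1 (fun u => u * _) (mpoly.mevalD _ _ _))).
  rewrite (eq_bigr _ (fun i _ => mulrDl _ _ _)) big_split/=.
  exact: is_deriveD.
- rewrite (_ : (fun t => _) = (fun t => mpoly.meval (v^~ t) P * mpoly.meval (v^~ t) Q));
    last by apply/funext => s; rewrite mpoly.mevalM.
  rewrite (_ : \sum_(i < d) _ =
    (\sum_(i < d) mpoly.meval (v^~ t) (mpoly.mderiv i P) * v' i) * mpoly.meval (v^~ t) Q +
     mpoly.meval (v^~ t) P * \sum_(i < d) mpoly.meval (v^~ t) (mpoly.mderiv i Q) * v' i).
    exact: is_derive_mul.
  rewrite mulr_suml mulr_sumr -big_split; apply: eq_bigr => i _.
  by rewrite mpoly.mderivM mpoly.mevalD !mpoly.mevalM/=; ring.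
Qed.

Lemma trig_prod (I : Type) (r : seq I) (T : pred I) (e : I -> nat) (F : I -> R -> R) :
  (forall j, T j -> trig (e j) (F j)) ->
  trig (\sum_(j <- r | T j) e j) (fun t => \prod_(j <- r | T j) F j t).
Proof.
move=> tF; elim: r => [|i r IH].
  by apply: (trig_ext _ (trig_cst _ 1)) => t; rewrite big_nil.
rewrite big_cons; case: (boolP (T i)) => Ti.
  apply: (trig_ext _ (trig_mul (tF i Ti) IH)) => t.
  by rewrite big_cons Ti.
by apply: (trig_ext _ IH) => t; rewrite big_cons (negbTE Ti).
Qed.

Lemma trig_meval n (v : 'I_d -> R -> R) P :
  (forall i, trig 1 (v i)) -> Pi_poly n P ->
  trig n (fun t => mpoly.meval (v^~ t) P).
Proof.
move=> tv Pn; apply: (@trig_ext _ _ (fun t => \sum_(m <- mpoly.msupp P)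
   mpoly.mcoeff m P * \prod_(i < d) v i t ^+ mpoly.fun_of_multinom m i)).
  by move=> t; rewrite mpoly.mevalE.
rewrite (_ : (fun t => _) = fun t => \sum_(m <- mpoly.msupp P | m \in mpoly.msupp P)
   mpoly.mcoeff m P * \prod_(i < d) v i t ^+ mpoly.fun_of_multinom m i); last first.
  by apply/funext => t; rewrite big_seq.
apply: trig_sum => m /Pn mn; apply: trig_scale; apply: (trig_widen mn).
rewrite mpoly.mdegE; apply: trig_prod => i _.
by have := trig_exp (mpoly.fun_of_multinom m i) (tv i); rewrite muln1.
Qed.

End PolynomialsAlongCurves.

(** * The geodesic distance of the ball *)

(** Lagrange's identity: the double sum of squares is twice the difference of the two sides. *)
Lemma cauchy_schwarz_sum {R : realType} (n : nat) (F G : 'I_n -> R) :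
  (\sum_i F i * G i) ^+ 2 <= (\sum_i F i ^+ 2) * (\sum_i G i ^+ 2).
Proof.
have : 0 <= \sum_i \sum_j (F i * G j - F j * G i) ^+ 2.
  by apply: sumr_ge0 => i _; apply: sumr_ge0 => j _; exact: sqr_ge0.
rewrite (_ : \sum_i _ = 2 * ((\sum_i F i ^+ 2) * (\sum_i G i ^+ 2)) -
    2 * (\sum_i F i * G i) ^+ 2).
  by lra.
transitivity (\sum_i \sum_j (F i ^+ 2 * G j ^+ 2) +
    \sum_i \sum_j (F j ^+ 2 * G i ^+ 2) -
    2 * \sum_i \sum_j (F i * G i * (F j * G j))).
  rewrite mulr_sumr -big_split -sumrB; apply: eq_bigr => i _.
  rewrite mulr_sumr -big_split -sumrB; apply: eq_bigr => j _ /=; ring.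
have e1 : \sum_i \sum_j (F i ^+ 2 * G j ^+ 2) = (\sum_i F i ^+ 2) * (\sum_i G i ^+ 2).
  by rewrite mulr_suml; apply: eq_bigr => i _; rewrite mulr_sumr.
have e2 : \sum_i \sum_j (F i * G i * (F j * G j)) = (\sum_i F i * G i) ^+ 2.
  by rewrite expr2 mulr_suml; apply: eq_bigr => i _; rewrite mulr_sumr.
by rewrite [X in _ + X - _]exchange_big/= e1 e2; ring.
Qed.

Section BallGeometry.
Context {R : realType} {d : nat}.
Implicit Types (x y z : euclidean R d) (r s t : R).

Definition height x : R := Num.sqrt (1 - enorm x ^+ 2).

(* Lifting to the upper hemisphere turns [ball_dist] into the geodesic distance
   of the unit sphere. *)
Definition lft x (k : 'I_d.+1) : R :=
  if unlift ord0 k is Some i then tnth x i else height x.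

Definition proj (F : 'I_d.+1 -> R) : euclidean R d :=
  [tuple F (lift ord0 i) | i < d].

Definition hdot x y : R := \sum_k lft x k * lft y k.

Definition chord2 x y : R := \sum_k (lft x k - lft y k) ^+ 2.

Lemma lft0 x : lft x ord0 = height x.
Proof. by rewrite /lft unlift_none. Qed.

Lemma lftS x i : lft x (lift ord0 i) = tnth x i.
Proof. by rewrite /lft liftK. Qed.

Lemma hdotE x y : hdot x y = dot x y + height x * height y.
Proof.
rewrite /hdot big_ord_recl !lft0 addrC; congr (_ + _).
by apply: eq_bigr => i _; rewrite !lftS.
Qed.

Lemma chord2E x y :
  chord2 x y = \sum_i (tnth x i - tnth y i) ^+ 2 + (height x - height y) ^+ 2.
Proof.
rewrite /chord2 big_ord_recl !lft0 addrC; congr (_ + _).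
by apply: eq_bigr => i _; rewrite !lftS.
Qed.

Lemma ball_distE x y : ball_dist x y = acos (hdot x y).
Proof. by rewrite hdotE. Qed.

Lemma dot_ge0 x : 0 <= dot x x.
Proof. by apply: sumr_ge0 => i _; rewrite -expr2 sqr_ge0. Qed.

Lemma enorm_sqr x : enorm x ^+ 2 = dot x x.
Proof. by rewrite sqr_sqrtr// dot_ge0. Qed.

Lemma unit_ballE x : unit_ball x <-> dot x x <= 1.
Proof. by rewrite /unit_ball/= -enorm_sqr expr_le1// sqrtr_ge0. Qed.

Lemma height_ge0 x : 0 <= height x. Proof. exact: sqrtr_ge0. Qed.

Lemma height_sqr x : unit_ball x -> height x ^+ 2 = 1 - dot x x.
Proof. by move=> /unit_ballE bx; rewrite sqr_sqrtr enorm_sqr ?subr_ge0. Qed.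

Lemma hdotC x y : hdot x y = hdot y x.
Proof. by apply: eq_bigr => k _; rewrite mulrC. Qed.

Lemma hdot_self x : unit_ball x -> hdot x x = 1.
Proof. by move=> bx; rewrite hdotE -expr2 height_sqr// addrC subrK. Qed.

Lemma lft_unit x : unit_ball x -> \sum_k lft x k ^+ 2 = 1.
Proof. by move=> bx; rewrite -(hdot_self bx); apply: eq_bigr => k _; rewrite expr2. Qed.

Lemma unit_dot_bounds (F G : 'I_d.+1 -> R) : \sum_k F k ^+ 2 = 1 ->
  \sum_k G k ^+ 2 = 1 -> -1 <= \sum_k F k * G k <= 1.
Proof.
move=> F1 G1; rewrite -ler_norml -[leLHS]sqrtr_sqr -[leRHS]sqrtr1 ler_wsqrtr//.
by have := cauchy_schwarz_sum F G; rewrite F1 G1 mulr1.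
Qed.

Lemma hdot_bounds x y : unit_ball x -> unit_ball y -> -1 <= hdot x y <= 1.
Proof. by move=> /lft_unit bx /lft_unit; exact: unit_dot_bounds. Qed.

Lemma ball_dist_ge0 x y : unit_ball x -> unit_ball y -> 0 <= ball_dist x y.
Proof. by move=> bx b_y; rewrite ball_distE acos_ge0// hdot_bounds. Qed.

Lemma ball_dist_lepi x y : unit_ball x -> unit_ball y -> ball_dist x y <= pi.
Proof. by move=> bx b_y; rewrite ball_distE acos_lepi// hdot_bounds. Qed.

Lemma cos_ball_dist x y : unit_ball x -> unit_ball y ->
  cos (ball_dist x y) = hdot x y.
Proof. by move=> bx b_y; rewrite ball_distE acosK// in_itv/= hdot_bounds. Qed.

Lemma ball_distC x y : ball_dist x y = ball_dist y x.
Proof. by rewrite !ball_distE hdotC. Qed.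

Lemma ball_dist_self x : unit_ball x -> ball_dist x x = 0.
Proof. by move=> bx; rewrite ball_distE hdot_self// acos1. Qed.

Lemma ball_dist_le x y s : unit_ball x -> unit_ball y -> 0 <= s <= pi ->
  (ball_dist x y <= s) = (cos s <= hdot x y).
Proof.
move=> bx b_y s0pi; rewrite -cos_ball_dist// !leNgt ltr_cos//= in_itv//=.
by rewrite ball_dist_ge0// ball_dist_lepi.
Qed.

(** [F] and [G] are the components of the lifted x and z orthogonal to the lifted y. Their lengths
    are sin a and sin b, so by Cauchy-Schwarz the inner product of x and z is at least cos (a +
    b). *)
Lemma ball_dist_triangle x y z : unit_ball x -> unit_ball y -> unit_ball z ->
  ball_dist x z <= ball_dist x y + ball_dist y z.
Proof.
move=> bx b_y bz; set a := ball_dist x y; set b := ball_dist y z.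
have a0 : 0 <= a by exact: ball_dist_ge0.
have b0 : 0 <= b by exact: ball_dist_ge0.
have [ab|/ltW ab] := leP (a + b) pi; last first.
  by rewrite (le_trans _ ab)// ball_dist_lepi.
rewrite ball_dist_le ?addr_ge0// cosD.
pose F k := lft x k - cos a * lft y k.
pose G k := lft z k - cos b * lft y k.
have ux := lft_unit bx; have uy := lft_unit b_y; have uz := lft_unit bz.
have ca : \sum_k lft x k * lft y k = cos a by rewrite /a cos_ball_dist.
have cb : \sum_k lft y k * lft z k = cos b by rewrite /b cos_ball_dist.
have F2 : \sum_k F k ^+ 2 = sin a ^+ 2.
  rewrite sin2cos2; transitivity (\sum_k lft x k ^+ 2 - 2 * cos a * (\sum_k lft x k * lft y k)
      + cos a ^+ 2 * \sum_k lft y k ^+ 2).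
    rewrite !mulr_sumr -sumrB -big_split; apply: eq_bigr => k _ /=; rewrite /F; ring.
  by rewrite ux uy ca; ring.
have G2 : \sum_k G k ^+ 2 = sin b ^+ 2.
  rewrite sin2cos2; transitivity (\sum_k lft z k ^+ 2 - 2 * cos b * (\sum_k lft y k * lft z k)
      + cos b ^+ 2 * \sum_k lft y k ^+ 2).
    rewrite !mulr_sumr -sumrB -big_split; apply: eq_bigr => k _ /=; rewrite /G; ring.
  by rewrite uz uy cb; ring.
have FG : \sum_k F k * G k = hdot x z - cos a * cos b.
  transitivity (hdot x z - cos b * (\sum_k lft x k * lft y k)
      - cos a * (\sum_k lft y k * lft z k) + cos a * cos b * \sum_k lft y k ^+ 2).
    rewrite !mulr_sumr -!sumrB -big_split; apply: eq_bigr => k _ /=; rewrite /F /G; ring.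
  by rewrite uy ca cb; ring.
have sa : 0 <= sin a by apply: sin_ge0_pi; rewrite a0 ball_dist_lepi.
have sb : 0 <= sin b by apply: sin_ge0_pi; rewrite b0 ball_dist_lepi.
have : `|\sum_k F k * G k| <= sin a * sin b.
  rewrite -(ger0_norm (mulr_ge0 sa sb)) -!sqrtr_sqr ler_wsqrtr// exprMn -F2 -G2.
  exact: cauchy_schwarz_sum.
by rewrite FG ler_norml => /andP[+ _]; lra.
Qed.

Lemma chord2_hdot x y : unit_ball x -> unit_ball y ->
  chord2 x y = 2 * (1 - cos (ball_dist x y)).
Proof.
move=> bx b_y; rewrite cos_ball_dist//.
transitivity (\sum_k lft x k ^+ 2 + \sum_k lft y k ^+ 2 - 2 * hdot x y).
  rewrite mulr_sumr -big_split -sumrB; apply: eq_bigr => k _ /=; ring.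
by rewrite !lft_unit//; ring.
Qed.

Lemma ball_dist_le_chord x y : unit_ball x -> unit_ball y ->
  ball_dist x y ^+ 2 <= 4 * chord2 x y.
Proof.
move=> bx b_y; rewrite chord2_hdot//.
have : 0 <= ball_dist x y <= pi by rewrite ball_dist_ge0// ball_dist_lepi.
by move=> /one_sub_cos_ge; lra.
Qed.

Lemma chord_le_ball_dist x y : unit_ball x -> unit_ball y ->
  chord2 x y <= ball_dist x y ^+ 2.
Proof.
move=> bx b_y; rewrite chord2_hdot//.
have : 0 <= ball_dist x y <= pi by rewrite ball_dist_ge0// ball_dist_lepi.
by move=> /one_sub_cos_le; lra.
Qed.

Lemma height_dist x y : unit_ball x -> unit_ball y ->
  `|height x - height y| <= ball_dist x y.
Proof.
move=> bx b_y; rewrite -(ger0_norm (ball_dist_ge0 bx b_y)) -!sqrtr_sqr ler_wsqrtr//.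
rewrite (le_trans _ (chord_le_ball_dist bx b_y))// chord2E lerDr.
by apply: sumr_ge0 => i _; exact: sqr_ge0.
Qed.

Lemma dot_proj (F G : 'I_d.+1 -> R) :
  \sum_k F k * G k = dot (proj F) (proj G) + F ord0 * G ord0.
Proof.
rewrite big_ord_recl addrC; congr (_ + _); apply: eq_bigr => i _.
by rewrite !tnth_mktuple.
Qed.

Lemma unit_ball_proj (F : 'I_d.+1 -> R) : \sum_k F k ^+ 2 = 1 -> unit_ball (proj F).
Proof.
move=> F1; apply/unit_ballE; rewrite -F1 (eq_bigr (fun k => F k * F k)) => [|k _].
  by rewrite dot_proj lerDl -expr2 sqr_ge0.
by rewrite expr2.
Qed.

Lemma height_proj (F : 'I_d.+1 -> R) : \sum_k F k ^+ 2 = 1 ->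
  height (proj F) = `|F ord0|.
Proof.
move=> F1; rewrite /height enorm_sqr -sqrtr_sqr; congr Num.sqrt.
rewrite -F1 (eq_bigr (fun k => F k * F k)) => [|k _]; last by rewrite expr2.
by rewrite dot_proj [X in X - _]addrC addrK expr2.
Qed.

Lemma proj_lft x : proj (lft x) = x.
Proof. by apply: eq_from_tnth => i; rewrite tnth_mktuple lftS. Qed.

(** A great circle may pass below the equator. [proj] forgets the sign of the height, and this
    folding does not increase distances, because |F_0| |G_0| >= F_0 G_0. *)
Lemma proj_dist_le (F G : 'I_d.+1 -> R) t : \sum_k F k ^+ 2 = 1 ->
  \sum_k G k ^+ 2 = 1 -> `|t| <= pi -> cos t <= \sum_k F k * G k ->
  ball_dist (proj F) (proj G) <= `|t|.
Proof.
move=> F1 G1 tpi tFG; rewrite ball_dist_le//; [|exact: unit_ball_proj|exact: unit_ball_proj|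
  by rewrite normr_ge0].
rewrite cos_norm (le_trans tFG)// hdotE dot_proj lerD2l !height_proj//.
by rewrite -normrM ler_norm.
Qed.

Definition segpt x y s : euclidean R d :=
  [tuple tnth x i + s * (tnth y i - tnth x i) | i < d].

Lemma dot_segpt x y s : dot (segpt x y s) (segpt x y s) =
  (1 - s) * dot x x + s * dot y y - s * (1 - s) * \sum_i (tnth x i - tnth y i) ^+ 2.
Proof.
rewrite !mulr_sumr -big_split -sumrB; apply: eq_bigr => i _ /=.
by rewrite tnth_mktuple; ring.
Qed.

Lemma unit_ball_segpt x y s : unit_ball x -> unit_ball y -> 0 <= s <= 1 ->
  unit_ball (segpt x y s).
Proof.
move=> /unit_ballE bx /unit_ballE b_y /andP[s0 s1]; apply/unit_ballE; rewrite dot_segpt.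
have e0 : 0 <= \sum_i (tnth x i - tnth y i) ^+ 2.
  by apply: sumr_ge0 => i _; exact: sqr_ge0.
have : 0 <= s * (1 - s) * \sum_i (tnth x i - tnth y i) ^+ 2.
  by rewrite !mulr_ge0// subr_ge0.
have : (1 - s) * dot x x <= 1 - s by rewrite ler_piMr// subr_ge0.
have : s * dot y y <= s by rewrite ler_piMr.
by lra.
Qed.

Lemma sum_sqr_sub_le4 x y : unit_ball x -> unit_ball y ->
  \sum_i (tnth x i - tnth y i) ^+ 2 <= 4.
Proof.
move=> /unit_ballE bx /unit_ballE b_y.
rewrite (@le_trans _ _ (2 * dot x x + 2 * dot y y))//; last by lra.
rewrite !mulr_sumr -big_split; apply: ler_sum => i _ /=.
by have := sqr_ge0 (tnth x i + tnth y i); lra.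
Qed.

Lemma sum_sqr_sub_segpt x y s :
  \sum_i (tnth x i - tnth (segpt x y s) i) ^+ 2 =
  s ^+ 2 * \sum_i (tnth x i - tnth y i) ^+ 2.
Proof.
by rewrite mulr_sumr; apply: eq_bigr => i _; rewrite tnth_mktuple; ring.
Qed.

(** Heights may change like the square root of s: (a - b)^2 <= |a^2 - b^2| for a, b >= 0, and
    squared heights change by at most 5 s. With 4 s from the other coordinates the squared chord is
    at most 9 s. *)
Lemma segpt_dist x y s : unit_ball x -> unit_ball y -> 0 <= s <= 1 ->
  ball_dist x (segpt x y s) ^+ 2 <= 40 * s.
Proof.
move=> bx b_y s01; have bz := unit_ball_segpt bx b_y s01.
rewrite (le_trans (ball_dist_le_chord bx bz))// chord2E sum_sqr_sub_segpt.
have e4 := sum_sqr_sub_le4 bx b_y.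
have e0 : 0 <= \sum_i (tnth x i - tnth y i) ^+ 2.
  by apply: sumr_ge0 => i _; exact: sqr_ge0.
have := dot_segpt x y s; move: e0 e4; set e := \sum_i _ => e0 e4 dz.
case/andP: s01 => s0 s1.
have h : (height x - height (segpt x y s)) ^+ 2 <=
    `|height x ^+ 2 - height (segpt x y s) ^+ 2|.
  rewrite subr_sqr normrM -real_normK ?num_real// expr2 ler_wpM2l//.
  have ha := height_ge0 x; have hb := height_ge0 (segpt x y s).
  by rewrite [leRHS]ger0_norm ?addr_ge0// ler_norml; apply/andP; split; lra.
have hs := height_sqr bz; have hx := height_sqr bx.
have dx0 := dot_ge0 x; have dy0 := dot_ge0 y.
have se : 0 <= s * e <= 4 * s by apply/andP; split; [rewrite mulr_ge0|rewrite mulrC ler_wpM2r].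
have sse : 0 <= s * (s * e) <= s * e.
  by case/andP: se => ? ?; apply/andP; split; [rewrite mulr_ge0|rewrite ler_piMl].
move/unit_ballE: bx => bx; move/unit_ballE: b_y => b_y.
have sx : 0 <= s * dot x x <= s by apply/andP; split; [rewrite mulr_ge0|rewrite ler_piMr].
have sy : 0 <= s * dot y y <= s by apply/andP; split; [rewrite mulr_ge0|rewrite ler_piMr].
have h5 : `|height x ^+ 2 - height (segpt x y s) ^+ 2| <= 5 * s.
  by rewrite hs hx dz ler_norml; apply/andP; split; lra.
by rewrite expr2; lra.
Qed.

End BallGeometry.

(** * Local Markov and Bernstein inequalities *)

Lemma ler_scaled_exp {R : realDomainType} (A c u v : R) (K : nat) :
  0 <= A -> 0 <= u -> u <= c * v -> A * u ^+ K <= c ^+ K * A * v ^+ K.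
Proof.
move=> A0 u0 uv; rewrite mulrAC -exprMn mulrC ler_wpM2r// lerXn2r// nnegrE//.
exact: le_trans uv.
Qed.

Section LocalPolynomialBounds.
Context {R : realType} {d : nat}.
Implicit Types (x y z : euclidean R d) (P : mpoly.mpoly d R).
Variables (n K : nat) (P : mpoly.mpoly d R) (x : euclidean R d) (A : R).
Hypotheses (n0 : (0 < n)%N) (Pn : Pi_poly n P) (bx : unit_ball x) (A0 : 0 <= A).
Hypothesis PA : forall y, unit_ball y ->
  `|peval P y| <= A * (1 + n%:R * ball_dist x y) ^+ K.

(* Along x + sin^2(t/2) (y - x) the derivative of P at t = 0 vanishes, and its
   second derivative is half the derivative of P at x in the direction y - x. *)
Lemma local_markov_segment y : unit_ball y ->
  `|\sum_(i < d) peval (mpoly.mderiv i P) x * (tnth y i - tnth x i)| <=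
  12 * (K.+1 * n)%:R ^+ 2 * (12 ^+ K * A).
Proof.
(* [s] is sin^2 (t / 2), written as a trigonometric polynomial of degree 1. *)
move=> b_y; pose s (t : R) : R := (1 - cos t) / 2.
pose v i (t : R) : R := tnth x i + s t * (tnth y i - tnth x i).
pose G (t : R) : R := \sum_(i < d) mpoly.meval (v^~ t) (mpoly.mderiv i P) * (tnth y i - tnth x i).
have ds (t : R) : is_derive t 1 s (sin t / 2).
  by apply: is_derive_eq; rewrite /GRing.scale/=; field.
have dv i (t : R) : is_derive t 1 (v i) (sin t / 2 * (tnth y i - tnth x i)).
  have ? := ds t.
  by apply: is_derive_eq; rewrite /GRing.scale/=; ring.
have df (t : R) : is_derive t 1 (fun t => mpoly.meval (v^~ t) P) (sin t / 2 * G t).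
  apply: (is_derive_eq (is_derive_meval P (fun i => dv i t))).
  by rewrite /G mulr_sumr; apply: eq_bigr => i _; ring.
(* Only existence is kept: the product rule multiplies this derivative by sin 0 = 0. *)
have [dG0 dG] : exists a : R, is_derive (0 : R) 1 G a.
  have dGi i : is_derive (0 : R) 1 (fun t => mpoly.meval (v^~ t) (mpoly.mderiv i P) * (tnth y i - tnth x i))
     ((\sum_(j < d) mpoly.meval (v^~ 0) (mpoly.mderiv j (mpoly.mderiv i P)) *
          (sin 0 / 2 * (tnth y j - tnth x j)))
        * (tnth y i - tnth x i)).
    apply: (is_derive_eq (is_derive_mul (is_derive_meval (mpoly.mderiv i P) (fun i => dv i 0))
      (is_derive_cst (tnth y i - tnth x i) (0 : R) 1))).
    by rewrite mulr0 addr0.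
  eexists; rewrite (_ : G = \sum_(i < d) 
      (fun t => mpoly.meval (v^~ t) (mpoly.mderiv i P) * (tnth y i - tnth x i))).
    apply: is_derive_sum => i; exact: dGi.
  by apply/funext => t; rewrite fct_sumE.
have df1 : is_derive (0 : R) 1 (fun t => sin t / 2 * G t) (G 0 / 2).
  have dsin : is_derive (0 : R) 1 (fun t => sin t / 2) (cos 0 / 2).
    by apply: is_derive_eq; rewrite /GRing.scale/=; field.
  apply: (is_derive_eq (is_derive_mul dsin dG)).
  by rewrite cos0 sin0; field.
have s01 t : 0 <= s t <= 1.
  have := cos_le1 t; have := cos_geN1 t.
  by rewrite /s => ? ?; apply/andP; split; lra.
have vE t : mpoly.meval (v^~ t) P = peval P (segpt x y (s t)).
  by apply: mpoly.meval_eq => i; rewrite tnth_mktuple.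
(* The squared distance is at most 40 s = 20 (1 - cos t) <= 10 t^2. The rounded factor 4 and the 3
   of the kernel make the 12 of [12 ^+ K]. *)
have dist t : `|t| <= pi -> ball_dist x (segpt x y (s t)) <= 4 * `|t|.
  move=> tpi; rewrite -(@ler_pXn2r _ 2) ?nnegrE ?ball_dist_ge0//; last exact: unit_ball_segpt.
  rewrite (le_trans (segpt_dist bx b_y (s01 t)))// /s -cos_norm.
  have /one_sub_cos_le : 0 <= `|t| <= pi by rewrite normr_ge0.
  have := sqr_ge0 `|t|; rewrite exprMn; lra.
have fA t : `|t| <= pi -> `|mpoly.meval (v^~ t) P| <= (4 ^+ K * A) * (1 + n%:R * `|t|) ^+ K.
  move=> tpi; rewrite vE (le_trans (PA _))//; first exact: unit_ball_segpt.
  have bz := unit_ball_segpt bx b_y (s01 t).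
  apply: ler_scaled_exp => //; first by rewrite addr_ge0// mulr_ge0// ball_dist_ge0.
  by have := ler_wpM2l (ler0n R n) (dist t tpi); lra.
have tf : trig n (fun t => mpoly.meval (v^~ t) P).
  apply: trig_meval => // i.
  apply: (@trig_ext _ _ (fun t =>
      (tnth x i + (tnth y i - tnth x i) / 2) + (- ((tnth y i - tnth x i) / 2)) * cos t)).
    by move=> t; rewrite /v /s; field.
  by apply: trig_add; [exact: trig_cst|apply/trig_scale/trig_cos1].
have [_] := local_bernstein2 n0 tf (mulr_ge0 (exprn_ge0 _ (ler0n R 4)) A0) fA df df1.
rewrite [3 ^+ K * _]mulrA -exprMn (_ : 3 * 4 = 12); last by ring.
rewrite normrM (_ : G 0 = \sum_(i < d) peval (mpoly.mderiv i P) x * (tnth y i - tnth x i)).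
  by rewrite [`|2^-1|]ger0_norm//; lra.
apply: eq_bigr => i _; congr (_ * _); apply: mpoly.meval_eq => j.
by rewrite /v /s cos0 subrr mul0r mul0r addr0.
Qed.

(** From x only segments towards points of the ball are available. Those towards e_i and towards the
    origin have directions e_i - x and - x, and the difference of the two derivatives is the i-th
    partial derivative. *)
Lemma local_markov :
  grad_length P x <= d%:R * (24 * K.+1%:R ^+ 2 * 12 ^+ K) * n%:R ^+ 2 * A.
Proof.
set B := 12 * (K.+1 * n)%:R ^+ 2 * (12 ^+ K * A).
have B0 : 0 <= B by rewrite !mulr_ge0// exprn_ge0.
have db i : `|peval (mpoly.mderiv i P) x| <= 2 * B.
  pose e j : R := (j == i)%:R.
  pose y0 : euclidean R d := [tuple 0 | j < d].
  pose y1 : euclidean R d := [tuple e j | j < d].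
  have b0 : unit_ball y0.
    by apply/unit_ballE; rewrite /dot big1// => j _; rewrite tnth_mktuple mulr0.
  have b1 : unit_ball y1.
    apply/unit_ballE; rewrite /dot (bigD1 i)//= tnth_mktuple /e eqxx mulr1 big1 ?addr0//.
    by move=> j ji; rewrite tnth_mktuple /e (negbTE ji) mulr0.
  have := local_markov_segment b0; have := local_markov_segment b1; rewrite -/B.
  set S1 := \sum_(_ < d) _; set S0 := \sum_(_ < d) _ => h1 h0.
  have -> : peval (mpoly.mderiv i P) x = S1 - S0.
    rewrite -sumrB (bigD1 i)//= big1 => [|j ji].
      rewrite /y0 /y1 !tnth_mktuple /e eqxx/=; ring.
    by rewrite /y0 /y1 !tnth_mktuple /e (negbTE ji)/=; ring.
  by rewrite (le_trans (ler_normB _ _))//; lra.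
have -> : d%:R * (24 * K.+1%:R ^+ 2 * 12 ^+ K) * n%:R ^+ 2 * A = d%:R * (2 * B).
  by rewrite /B natrM exprMn; ring.
rewrite /grad_length -[leRHS]ger0_norm ?mulr_ge0// -sqrtr_sqr ler_wsqrtr// exprMn.
rewrite (@le_trans _ _ (d%:R * (2 * B) ^+ 2))//.
  rewrite mulr_natl -[X in _ *+ X]card_ord -sumr_const; apply: ler_sum => i _.
  by rewrite -[leLHS]real_normK ?num_real// lerXn2r// nnegrE mulr_ge0.
rewrite ler_wpM2r ?sqr_ge0// -natrX ler_nat.
by case: (d) => // k; rewrite leq_pmull.
Qed.

(** Mean value theorem on the great circle from x to z: the arc has length at most delta / n, and
    the derivative on it is at most 2 (K + 1) n 6^K A. *)
Lemma local_oscillation delta z : unit_ball z -> delta <= 1 ->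
  n%:R * ball_dist x z <= delta ->
  `|peval P x - peval P z| <= 2 * K.+1%:R * 6 ^+ K * delta * A.
Proof.
move=> bz d1; set th := ball_dist x z => thd.
have nR : 1 <= n%:R :> R by rewrite ler1n.
have th0 : 0 <= th by exact: ball_dist_ge0.
have th1 : th <= 1 by rewrite (le_trans _ d1)// (le_trans _ thd)// ler_peMl.
have pi2 := @pi_ge2 R.
have thpi : th <= pi by lra.
have cth : cos th = hdot x z by rewrite cos_ball_dist.
move: th0; rewrite le_eqVlt => /orP[/eqP th0|th0].
  suff -> : x = z.
    by rewrite subrr normr0 !mulr_ge0 ?exprn_ge0// (le_trans _ thd)// -th0 mulr0.
  have := chord2_hdot bx bz; rewrite -/th -th0 cos0 subrr mulr0 chord2E.
  have e0 : 0 <= \sum_i (tnth x i - tnth z i) ^+ 2.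
    by apply: sumr_ge0 => i _; exact: sqr_ge0.
  move=> e.
  have : \sum_i (tnth x i - tnth z i) ^+ 2 = 0.
    by apply/eqP; rewrite eq_le e0 andbT -[X in _ <= X]e lerDl sqr_ge0.
  move/eqP; rewrite psumr_eq0 => [/allP h|i _]; last exact: sqr_ge0.
  apply: eq_from_tnth => i; have := h i (mem_index_enum _).
  by rewrite sqrf_eq0 subr_eq0 => /eqP.
have sth : 0 < sin th by apply: sin_gt0_pi; rewrite th0/=; lra.
(* The unit tangent at the lifted x towards the lifted z; coinciding points were split off because
   of the division by sin th. *)
pose eta k := (lft z k - cos th * lft x k) / sin th.
pose X t k := cos t * lft x k + sin t * eta k.
have ux := lft_unit bx; have uz := lft_unit bz.
have eta1 : \sum_k eta k ^+ 2 = 1.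
  transitivity ((\sum_k lft z k ^+ 2 - 2 * cos th * hdot x z +
      cos th ^+ 2 * \sum_k lft x k ^+ 2) / sin th ^+ 2).
    rewrite !mulr_sumr -sumrB -big_split mulr_suml; apply: eq_bigr => k _ /=.
    by rewrite /eta; field; rewrite gt_eqF.
  rewrite ux uz -cth (_ : _ + _ = sin th ^+ 2); last by rewrite sin2cos2; ring.
  by rewrite divff// expf_eq0/= gt_eqF.
have xeta : \sum_k lft x k * eta k = 0.
  transitivity ((hdot x z - cos th * \sum_k lft x k ^+ 2) / sin th).
    rewrite !mulr_sumr -sumrB mulr_suml; apply: eq_bigr => k _ /=.
    by rewrite /eta; field; rewrite gt_eqF.
  by rewrite ux mulr1 cth subrr mul0r.
have XX s t : \sum_k X s k * X t k = cos (t - s).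
  transitivity (cos s * cos t * (\sum_k lft x k ^+ 2) + sin s * sin t * (\sum_k eta k ^+ 2) +
     (cos s * sin t + sin s * cos t) * \sum_k lft x k * eta k).
    rewrite !mulr_sumr -!big_split; apply: eq_bigr => k _ /=.
    by rewrite /X; ring.
  by rewrite ux eta1 xeta cosB; ring.
have X1 t : \sum_k X t k ^+ 2 = 1.
  transitivity (\sum_k X t k * X t k); first by apply: eq_bigr => k _; rewrite expr2.
  by rewrite XX subrr cos0.
pose y t := proj (X t).
have b_y t : unit_ball (y t) by exact: unit_ball_proj.
have y0 : y 0 = x.
  rewrite -[RHS]proj_lft; congr proj; apply/funext => k.
  by rewrite /X cos0 sin0 mul1r mul0r addr0.
have yth : y th = z.
  rewrite -[RHS]proj_lft; congr proj; apply/funext => k.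
  by rewrite /X /eta; field; rewrite gt_eqF.
have dist s t : `|t - s| <= pi -> ball_dist (y s) (y t) <= `|t - s|.
  by move=> ts; apply: proj_dist_le => //; rewrite XX.
pose f t := mpoly.meval ((fun i t => X t (lift ord0 i))^~ t) P.
have fE t : f t = peval P (y t).
  by apply: mpoly.meval_eq => i; rewrite tnth_mktuple.
have tf : trig n f.
  apply: trig_meval => // i.
  apply: (@trig_ext _ _ (fun t => lft x (lift ord0 i) * cos t + eta (lift ord0 i) * sin t)).
    by move=> t; rewrite /X; ring.
  by apply: trig_add; apply: trig_scale; [exact: trig_cos1|exact: trig_sin1].
have [f1 [_ df _]] := trig_derivative n0 tf.
(* Recentring the growth condition at a point of the arc costs 2^K: as n th <= 1, 1 + n (th + |s|)
   <= 2 (1 + n |s|). *)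
have f1b t : 0 <= t <= th -> `|f1 t| <= 2 * (K.+1 * n)%:R * (3 ^+ K * (2 ^+ K * A)).
  move=> /andP[t0 tth]; apply: (@local_bernstein _ _ _ (fun s => f (t + s))) => //.
  - exact: trig_shift.
  - by rewrite mulr_ge0// exprn_ge0.
  - move=> s spi; rewrite fE (le_trans (PA (b_y _)))//.
    apply: ler_scaled_exp => //; first by rewrite addr_ge0// mulr_ge0// ball_dist_ge0.
    have := ball_dist_triangle bx (b_y t) (b_y (t + s)).
    have := dist t (t + s); rewrite (_ : t + s - t = s) => [/(_ spi)|]; last by ring.
    have := dist 0 t; rewrite y0 subr0 ger0_norm// => /(_ (le_trans tth thpi)) h1 h2 h3.
    have h4 : ball_dist x (y (t + s)) <= th + `|s| by lra.
    have := ler_wpM2l (ler0n R n) h4.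
    have : n%:R * th <= 1 by rewrite (le_trans thd).
    have : 0 <= n%:R * `|s| by rewrite mulr_ge0.
    by lra.
  - have dft : is_derive (t + 0) 1 f (f1 t) by rewrite addr0.
    have dt : is_derive (0 : R) 1 (fun s => t + s) 1.
      by apply: is_derive_eq; rewrite add0r mulr1.
    by have := @is_derive1_comp R f (fun s => t + s) 0 _ _ dft dt; rewrite mulr1.
have [c] : exists2 c, c \in `]0, th[%R & f th - f 0 = f1 c * (th - 0).
  apply: MVT => //.
  by apply: derivable_within_continuous => u _; have [] := df u.
rewrite in_itv/= => /andP[c0 cth'].
rewrite !fE yth y0 subr0 distrC => ->.
rewrite normrM (gtr0_norm th0).
have h : `|f1 c| <= 2 * (K.+1 * n)%:R * (3 ^+ K * (2 ^+ K * A)).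
  by apply: f1b; rewrite !ltW.
rewrite (le_trans (ler_wpM2r (ltW th0) h))//.
rewrite [leLHS](_ : _ = 2 * K.+1%:R * (3 ^+ K * 2 ^+ K) * A * (n%:R * th)); last first.
  by rewrite natrM; ring.
rewrite -exprMn (_ : 3 * 2 = 6); last by ring.
rewrite [leRHS]mulrAC ler_wpM2l// !mulr_ge0// exprn_ge0//.
Qed.

End LocalPolynomialBounds.

(** * Integration against a weight *)

Section BorelMeasurability.
Context {R : realType} {d : nat}.
Implicit Types (x y : euclidean R d) (P : mpoly.mpoly d R).
Let borel := (d.-tuple (measurableTypeR R)).
Local Notation Bd := (@unit_ball R d).

(** Measurability is checked for the Borel structure of tuples and then passed to the larger
    Lebesgue one. *)
Lemma borel_measurable (A : set (euclidean R d)) :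
  measurable (A : set borel) -> measurable A.
Proof. exact: caratheodory_measurable_mu_ext. Qed.

Lemma borel_measurable_fun (f : euclidean R d -> R) :
  measurable_fun [set: borel] f -> measurable_fun [set: euclidean R d] f.
Proof. by move=> mf _ Y mY; apply: borel_measurable; exact: mf. Qed.

Lemma lebesgue_borel (A : set borel) :
  measurable A -> @lebesgue R d A = lebesgue_tuple R d A.
Proof. by move=> mA; rewrite /lebesgue/= /completed_measure_extension measurable_mu_extE. Qed.

Lemma borel_coord i : measurable_fun [set: borel] (fun x => tnth x i : R).
Proof. exact: (@measurable_tnth _ _ _ i). Qed.

Lemma borel_dot x : measurable_fun [set: borel] (dot x).
Proof.
apply: measurable_sum => i; apply: measurable_funM => //.
exact: borel_coord.
Qed.

Lemma borel_dot_self : measurable_fun [set: borel] (fun x => @dot R d x x).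
Proof.
by apply: measurable_sum => i; apply: measurable_funM; exact: borel_coord.
Qed.

Lemma measurable_sqrt (f : borel -> R) :
  measurable_fun setT f -> measurable_fun [set: borel] (fun z => Num.sqrt (f z)).
Proof.
move=> mf; have ms : measurable_fun [set: R] (@Num.sqrt R).
  by apply: continuous_measurable_fun; exact: sqrt_continuous.
exact: measurableT_comp ms mf.
Qed.

Lemma borel_height : measurable_fun [set: borel] (@height R d).
Proof.
apply: measurable_sqrt; apply: measurable_funB => //.
rewrite (_ : (fun x => _) = fun x => @dot R d x x); first exact: borel_dot_self.
by apply/funext => x; rewrite enorm_sqr.
Qed.

Lemma borel_hdot x : measurable_fun [set: borel] (hdot x).
Proof.
rewrite (_ : hdot x = fun y => dot x y + height x * height y); last first.
  by apply/funext => y; rewrite hdotE.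
apply: measurable_funD; first exact: borel_dot.
by apply: measurable_funM => //; exact: borel_height.
Qed.

Lemma borel_sublevel (f g : borel -> R) : measurable_fun setT f ->
  measurable_fun setT g -> measurable [set x | f x <= g x].
Proof.
by move=> mf mg; rewrite -[X in measurable X]setTI; exact: measurable_fun_le.
Qed.

Lemma borel_unit_ball : measurable (Bd : set borel).
Proof.
rewrite (_ : Bd = [set x : borel | @dot R d x x <= 1]).
  by apply: borel_sublevel => //; exact: borel_dot_self.
by apply/seteqP; split=> x /unit_ballE.
Qed.

(** For r in [0, pi] the cap is a superlevel set of [hdot x]; for other r it is empty or the whole
    ball. *)
Lemma borel_ball_cap x r : unit_ball x -> measurable (ball_cap x r : set borel).
Proof.
move=> bx; have [r0|r0] := ltP r 0.
  rewrite (_ : ball_cap _ _ = set0)//; apply/seteqP; split=> y //= -[b_y].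
  by rewrite leNgt (lt_le_trans r0)// ball_dist_ge0.
have [rpi|pir] := leP r pi.
  rewrite (_ : ball_cap _ _ = Bd `&` [set y | cos r <= hdot x y]).
    apply: measurableI; first exact: borel_unit_ball.
    by apply: borel_sublevel => //; exact: borel_hdot.
  apply/seteqP; split=> y /= -[b_y] h; split=> //.
    by rewrite -ball_dist_le// r0.
  by rewrite ball_dist_le// r0.
rewrite (_ : ball_cap _ _ = Bd); first exact: borel_unit_ball.
apply/seteqP; split=> y /= => [[]//|b_y]; split=> //.
by rewrite (le_trans (ball_dist_lepi bx b_y))// ltW.
Qed.

Lemma borel_peval P : measurable_fun [set: borel] (peval P).
Proof.
rewrite (_ : peval P = fun x => \sum_(m <- mpoly.msupp P)
   mpoly.mcoeff m P * \prod_(i < d) tnth x i ^+ mpoly.fun_of_multinom m i).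
  apply: measurable_sum => m; apply: measurable_funM => //.
  by apply: measurable_prod => i _; apply: measurable_funX; exact: borel_coord.
by apply/funext => x; rewrite /peval mpoly.mevalE.
Qed.

Lemma borel_grad_length P : measurable_fun [set: borel] (grad_length P).
Proof.
apply: measurable_sqrt; apply: measurable_sum => i; apply: measurable_funX.
exact: borel_peval.
Qed.

Lemma measurable_unit_ball : measurable (Bd : set (euclidean R d)).
Proof. exact: borel_measurable borel_unit_ball. Qed.

Lemma measurable_ball_cap x r :
  unit_ball x -> measurable (ball_cap x r : set (euclidean R d)).
Proof. by move=> bx; exact: borel_measurable (borel_ball_cap r bx). Qed.

End BorelMeasurability.

(** * Finite weighted integrals, overlaps and coverings *)

Section WeightedIntegral.
Context {disp} {T : measurableType disp} {R : realType}.
Variables (mu : {measure set T -> \bar R}) (Bd : set T) (w : T -> R).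
Hypotheses (mBd : measurable Bd) (w_ge0 : forall x, Bd x -> 0 <= w x).
Hypothesis w_int : mu.-integrable Bd (EFin \o w).
Implicit Types (A B : set T) (g : T -> R).

Let mw : measurable_fun Bd w.
Proof. by move/integrableP : w_int => [/measurable_EFinP]. Qed.

(** Integrands whose integral against w is finite, so that [fine] in [wint] discards nothing. *)
Definition wbounded g :=
  [/\ measurable_fun setT g, forall x, Bd x -> 0 <= g x &
      exists M, forall x, Bd x -> g x <= M].

Definition wint g A : R := fine (\int[mu]_(x in A) (g x * w x)%:E).

Definition wmass A : R := fine (\int[mu]_(x in A) (w x)%:E).

Lemma measurable_wgw g : measurable_fun setT g ->
  measurable_fun Bd (fun x => (g x * w x)%:E).
Proof.
move=> mg; apply/measurable_EFinP; apply: measurable_funM => //.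
exact: measurable_funTS.
Qed.

Lemma wintE g A : wbounded g -> measurable A -> A `<=` Bd ->
  (\int[mu]_(x in A) (g x * w x)%:E = (wint g A)%:E)%E.
Proof.
move=> [mg g0 [M gM]] mA Ab; rewrite fineK// ge0_fin_numE; last first.
  by apply: integral_ge0 => x /Ab bx; rewrite lee_fin mulr_ge0 ?g0 ?w_ge0.
apply: (@le_lt_trans _ _ (\int[mu]_(x in Bd) (M%:E * (w x)%:E))%E).
  apply: (@le_trans _ _ (\int[mu]_(x in Bd) (g x * w x)%:E)%E).
    apply: ge0_subset_integral => //; first exact: measurable_wgw.
    by move=> x bx; rewrite lee_fin mulr_ge0 ?g0 ?w_ge0.
  apply: ge0_le_integral => //.
  - by move=> x bx; rewrite lee_fin mulr_ge0 ?g0 ?w_ge0.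
  - exact: measurable_wgw.
  - by apply: measurable_funeM; exact/measurable_EFinP.
  - by move=> x bx; rewrite -EFinM lee_fin ler_wpM2r ?w_ge0 ?gM.
have -> : (\int[mu]_(x in Bd) (M%:E * (w x)%:E) =
    M%:E * \int[mu]_(x in Bd) (w x)%:E)%E.
  exact: integralZl.
by rewrite ltey_eq fin_numM// integrable_fin_num.
Qed.

Lemma wbounded1 : wbounded (cst 1).
Proof. by split=> //; exists 1. Qed.

Lemma wmass_wint A : wmass A = wint (cst 1) A.
Proof.
by congr fine; apply: eq_integral => x _; rewrite mul1r.
Qed.

Lemma wmeasureE A : measurable A -> A `<=` Bd -> (\int[mu]_(x in A) (w x)%:E = (wmass A)%:E)%E.
Proof.
move=> mA Ab; rewrite wmass_wint -wintE//; last exact: wbounded1.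
by apply: eq_integral => x _; rewrite mul1r.
Qed.

Lemma wint_ge0 g A : wbounded g -> A `<=` Bd -> 0 <= wint g A.
Proof.
move=> [mg g0 _] Ab; rewrite fine_ge0// integral_ge0// => x /Ab bx.
by rewrite lee_fin mulr_ge0 ?g0 ?w_ge0.
Qed.

Lemma wint_le g h A : wbounded g -> wbounded h -> measurable A -> A `<=` Bd ->
  (forall x, A x -> g x <= h x) -> wint g A <= wint h A.
Proof.
move=> bg bh mA Ab gh; rewrite -lee_fin -!wintE//.
have mA' (f : T -> R) : measurable_fun setT f -> measurable_fun A (fun x => (f x * w x)%:E).
  by move=> mf; apply: (measurable_funS mBd Ab); exact: measurable_wgw.
case: bg => mg g0 _; case: bh => mh h0 _.
apply: ge0_le_integral => //.
- by move=> x /Ab bx; rewrite lee_fin mulr_ge0 ?g0 ?w_ge0.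
- exact: mA'.
- exact: mA'.
- by move=> x Ax; rewrite lee_fin ler_wpM2r ?gh ?w_ge0//; exact: Ab.
Qed.

Lemma wbounded_cst c : 0 <= c -> wbounded (cst c).
Proof. by move=> c0; split=> //; exists c. Qed.

Lemma wint_cst c A : 0 <= c -> measurable A -> A `<=` Bd ->
  wint (cst c) A = c * wmass A.
Proof.
move=> c0 mA Ab; apply: EFin_inj; rewrite -wintE//; last exact: wbounded_cst.
rewrite EFinM -wmeasureE// -ge0_integralZl_EFin//.
- by move=> x /Ab; exact: w_ge0.
- by apply/measurable_EFinP; apply: (measurable_funS mBd Ab).
Qed.

Lemma wint_sub g A B : wbounded g -> measurable A -> measurable B ->
  A `<=` B -> B `<=` Bd -> wint g A <= wint g B.
Proof.
move=> bg mA mB AB Bb; rewrite -lee_fin -!wintE//; last exact: subset_trans Bb.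
case: bg => mg g0 _; apply: ge0_subset_integral => //.
  by apply: (measurable_funS mBd Bb); exact: measurable_wgw.
by move=> x /Bb bx; rewrite lee_fin mulr_ge0 ?g0 ?w_ge0.
Qed.

Lemma wint_indic g A : wbounded g -> measurable A -> A `<=` Bd ->
  ((wint g A)%:E = \int[mu]_(x in Bd) (\1_A x * (g x * w x))%:E)%E.
Proof.
move=> bg mA Ab; rewrite -wintE// -{1}(setIidr Ab) integral_mkcondr.
apply: eq_integral => x _; rewrite /patch indicE.
by case: ifP => _; rewrite ?mul1r ?mul0r.
Qed.

Lemma measurable_indic_wgw g A : measurable_fun setT g -> measurable A ->
  measurable_fun Bd (fun x => (\1_A x * (g x * w x))%:E).
Proof.
move=> mg mA; apply/measurable_EFinP/measurable_funM => //.
by apply/measurable_EFinP; exact: measurable_wgw.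
Qed.

(** The factor in front of g w counts the sets containing x; an upper bound for it gives
    [wint_overlap], the lower bound 1 gives [wint_cover]. *)
Lemma wint_sum_indic g (m : nat) (D : 'I_m -> set (T)) : wbounded g ->
  (forall k, measurable (D k)) -> (forall k, D k `<=` Bd) ->
  ((\sum_k wint g (D k))%:E =
   \int[mu]_(x in Bd) ((\sum_k \1_(D k) x) * (g x * w x))%:E)%E.
Proof.
move=> bg mD Db; have [mg g0 _] := bg.
rewrite -sumEFin (eq_bigr _ (fun k _ => wint_indic bg (mD k) (Db k))).
rewrite -ge0_integral_sum//.
- by apply: eq_integral => x _; rewrite mulr_suml sumEFin.
- by move=> k; exact: measurable_indic_wgw.
- by move=> k x bx; rewrite lee_fin !mulr_ge0 ?g0 ?w_ge0.
Qed.

Let measurable_sum_indic g m (D : 'I_m -> set (T)) :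
  measurable_fun setT g -> (forall k, measurable (D k)) ->
  measurable_fun Bd (fun x => ((\sum_k \1_(D k) x) * (g x * w x))%:E).
Proof.
move=> mg mD; apply/measurable_EFinP/measurable_funM => //.
  apply: measurable_funTS; apply: measurable_sum => k; exact: measurable_indic.
by apply/measurable_EFinP; exact: measurable_wgw.
Qed.

Lemma wint_overlap g m (D : 'I_m -> set (T)) (N : R) U :
  wbounded g -> (forall k, measurable (D k)) -> measurable U -> U `<=` Bd ->
  (forall k, D k `<=` U) -> 0 <= N ->
  (forall x, U x -> \sum_k (\1_(D k) x : R) <= N) ->
  \sum_k wint g (D k) <= N * wint g U.
Proof.
move=> bg mD mU Ub DU N0 DN; have [mg g0 _] := bg.
have Db k : D k `<=` Bd by exact: subset_trans (DU k) Ub.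
rewrite -lee_fin wint_sum_indic// EFinM wint_indic// -ge0_integralZl_EFin//.
- apply: ge0_le_integral => //.
  + by move=> x bx; rewrite lee_fin !mulr_ge0 ?g0 ?w_ge0// sumr_ge0.
  + exact: measurable_sum_indic.
  + by apply: measurable_funeM; exact: measurable_indic_wgw.
  + move=> x bx; rewrite -EFinM lee_fin [leRHS]mulrA ler_wpM2r ?mulr_ge0 ?g0 ?w_ge0//.
    have [Ux|Ux] := pselect (U x).
      by rewrite [\1_U x]indicE mem_set// mulr1 DN.
    rewrite big1 ?mulr_ge0// => k _; rewrite indicE memNset// => /(DU k).
    exact.
- by move=> x bx; rewrite lee_fin !mulr_ge0 ?g0 ?w_ge0.
- exact: measurable_indic_wgw.
Qed.

Lemma wint_cover g m (D : 'I_m -> set (T)) U :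
  wbounded g -> (forall k, measurable (D k)) -> (forall k, D k `<=` Bd) ->
  measurable U -> U `<=` Bd ->
  (forall x, U x -> exists k, D k x) ->
  wint g U <= \sum_k wint g (D k).
Proof.
move=> bg mD Db mU Ub cov; have [mg g0 _] := bg.
rewrite -lee_fin wint_sum_indic// wint_indic//; apply: ge0_le_integral => //.
- by move=> x bx; rewrite lee_fin !mulr_ge0 ?g0 ?w_ge0.
- exact: measurable_indic_wgw.
- exact: measurable_sum_indic.
- move=> x bx; rewrite lee_fin ler_wpM2r ?mulr_ge0 ?g0 ?w_ge0//.
  have [Ux|Ux] := pselect (U x); last first.
    by rewrite [\1_U x]indicE memNset// sumr_ge0.
  have [k Dk] := cov x Ux.
  rewrite (bigD1 k)//= ![\1_(_) x]indicE !mem_set// lerDl sumr_ge0//.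
Qed.

Lemma wmass_le A B : measurable A -> measurable B -> A `<=` B -> B `<=` Bd ->
  wmass A <= wmass B.
Proof. by move=> mA mB AB Bb; rewrite !wmass_wint wint_sub//; exact: wbounded1. Qed.

Lemma wmass_ge0 A : A `<=` Bd -> 0 <= wmass A.
Proof. by move=> Ab; rewrite wmass_wint wint_ge0//; exact: wbounded1. Qed.

Lemma wint_overlap_cond g m (J : pred 'I_m) (D : 'I_m -> set T) (N : R) U :
  wbounded g -> (forall k, measurable (D k)) -> measurable U -> U `<=` Bd ->
  (forall k, J k -> D k `<=` U) -> 0 <= N ->
  (forall x, U x -> \sum_(k | J k) (\1_(D k) x : R) <= N) ->
  \sum_(k | J k) wint g (D k) <= N * wint g U.
Proof.
move=> bg mD mU Ub DU N0 DN; pose E k := if J k then D k else set0.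
have mE k : measurable (E k) by rewrite /E; case: ifP.
have EU k : E k `<=` U.
  by rewrite /E; case: (boolP (J k)) => [Jk|_] //; exact: DU.
have EN x : U x -> \sum_k (\1_(E k) x : R) <= N.
  move=> Ux; rewrite (le_trans _ (DN x Ux))// [leRHS]big_mkcond; apply: ler_sum => k _.
  by rewrite /E; case: ifP => // _; rewrite indicE in_set0.
rewrite (le_trans _ (wint_overlap bg mE mU Ub EU N0 EN))// big_mkcond.
apply: ler_sum => k _; rewrite /E; case: ifP => // _.
exact: wint_ge0.
Qed.

Lemma wmass_gt0 : ~ {ae mu, forall x, Bd x -> w x = 0} -> 0 < wmass Bd.
Proof.
move=> wn0; rewrite lt_neqAle wmass_ge0// andbT eq_sym; apply/negP => /eqP w0.
apply: wn0; have : (\int[mu]_(x in Bd) `|(w x)%:E| = 0)%E.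
  rewrite (eq_integral (fun x => (w x)%:E)) => [|x]; last first.
    by rewrite inE => bx; rewrite gee0_abs// lee_fin w_ge0.
  by have := wmeasureE mBd (@subset_refl _ _); rewrite w0.
have mew : measurable_fun Bd (EFin \o w) by exact/measurable_EFinP.
move=> /(ae_eq_integral_abs _ mBd mew); apply: filterS => x /= h bx.
by have [] := h bx.
Qed.

End WeightedIntegral.

Section BallIntegral.
Context {R : realType} {d : nat}.
Variable w : euclidean R d -> R.
Hypothesis wei : is_weight w.
Local Notation Bd := (@unit_ball R d).
Local Notation cap := (@ball_cap R d).
Implicit Types (x y : euclidean R d) (A : set (euclidean R d)) (g : euclidean R d -> R).

Definition ball_int g A : R := wint (@lebesgue R d) w g A.

Definition ball_mass A : R := wmass (@lebesgue R d) w A.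

Let w_ge0 x : Bd x -> 0 <= w x. Proof. by case: wei => + _ _; apply. Qed.

Let w_int : (@lebesgue R d).-integrable Bd (EFin \o w). Proof. by case: wei. Qed.

Let mB : measurable (Bd : set (euclidean R d)) := measurable_unit_ball.

Lemma cap_sub x r : cap x r `<=` Bd. Proof. by move=> y []. Qed.

Lemma ball_intE g A : wbounded Bd g -> measurable A -> A `<=` Bd ->
  (\int[@lebesgue R d]_(x in A) (g x * w x)%:E = (ball_int g A)%:E)%E.
Proof. exact: (wintE mB w_ge0 w_int). Qed.

Lemma ball_massE A : measurable A -> A `<=` Bd -> wmeasure w A = (ball_mass A)%:E.
Proof. exact: (wmeasureE mB w_ge0 w_int). Qed.

Lemma ball_mass_ge0 A : A `<=` Bd -> 0 <= ball_mass A.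
Proof. exact: (wmass_ge0 _ w_ge0). Qed.

Lemma cap_mass_ge0 x r : 0 <= ball_mass (cap x r).
Proof. exact: ball_mass_ge0 (@cap_sub x r). Qed.

Lemma ball_int_ge0 g A : wbounded Bd g -> A `<=` Bd -> 0 <= ball_int g A.
Proof. exact: (wint_ge0 _ w_ge0). Qed.

Lemma ball_mass_le A B : measurable A -> measurable B -> A `<=` B -> B `<=` Bd ->
  ball_mass A <= ball_mass B.
Proof. exact: (wmass_le mB w_ge0 w_int). Qed.

Lemma ball_mass_gt0 : 0 < ball_mass Bd.
Proof. by apply: (wmass_gt0 mB w_ge0 w_int); case: wei. Qed.

Lemma ball_mass_int A : ball_mass A = ball_int (cst 1) A.
Proof. exact: wmass_wint. Qed.

Lemma ball_int_cst c A : 0 <= c -> measurable A -> A `<=` Bd ->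
  ball_int (cst c) A = c * ball_mass A.
Proof. exact: (wint_cst mB w_ge0 w_int). Qed.

Lemma ball_int_mono g h A : wbounded Bd g -> wbounded Bd h -> measurable A ->
  A `<=` Bd -> (forall x, A x -> g x <= h x) -> ball_int g A <= ball_int h A.
Proof. exact: (wint_le mB w_ge0 w_int). Qed.

Lemma ball_int_sub g A B : wbounded Bd g -> measurable A -> measurable B ->
  A `<=` B -> B `<=` Bd -> ball_int g A <= ball_int g B.
Proof. exact: (wint_sub mB w_ge0 w_int). Qed.

Lemma ball_int_cover g m (D : 'I_m -> set (euclidean R d)) : wbounded Bd g ->
  (forall k, measurable (D k)) -> (forall k, D k `<=` Bd) ->
  (forall x, Bd x -> exists k, D k x) ->
  ball_int g Bd <= \sum_k ball_int g (D k).
Proof.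
move=> bg mD Db; exact: (wint_cover mB w_ge0 w_int bg mD Db mB (@subset_refl _ _)).
Qed.

Lemma ball_int_overlap g m (J : pred 'I_m) (D : 'I_m -> set (euclidean R d)) (N : R) U :
  wbounded Bd g -> (forall k, measurable (D k)) -> measurable U -> U `<=` Bd ->
  (forall k, J k -> D k `<=` U) -> 0 <= N ->
  (forall x, U x -> \sum_(k | J k) (\1_(D k) x : R) <= N) ->
  \sum_(k | J k) ball_int g (D k) <= N * ball_int g U.
Proof. exact: (wint_overlap_cond mB w_ge0 w_int). Qed.

End BallIntegral.

(** * Doubling weights: the upper bound *)

Lemma sum_geometric_half {R : realFieldType} (m : nat) :
  \sum_(k < m) (2^-1 : R) ^+ k <= 2.
Proof.
suff -> : \sum_(k < m) (2^-1 : R) ^+ k = 2 - 2 * 2^-1 ^+ m.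
  by rewrite gerBl mulr_ge0// exprn_ge0.
elim: m => [|m IH]; first by rewrite big_ord0 expr0 mulr1 subrr.
by rewrite big_ord_recr/= IH exprS; field.
Qed.

Lemma exp2_unbounded {R : archiRealFieldType} (x : R) : exists l : nat, x <= 2 ^+ l.
Proof.
exists (Num.truncn x).+1; rewrite (le_trans (ltW (truncnS_gt x)))//.
by rewrite -natrX ler_nat ltnW// ltn_expl.
Qed.

(** The term of the least l with t <= 2^l suffices: unless l = 0, t > 2^(l - 1), and the prefactor
    2^K pays for the shift by one. *)
Lemma decay_le_dyadic {R : realFieldType} (K m : nat) (t : R) :
  0 <= t -> t <= 2 ^+ m ->
  (1 + t) ^- K <= \sum_(l < m.+1) 2 ^+ K * (2 ^- K) ^+ l * (t <= 2 ^+ l)%R%:R.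
Proof.
move=> t0 tm.
have ex : exists l, t <= 2 ^+ l by exists m.
pose l := ex_minn ex.
have [tl lmin] : t <= 2 ^+ l /\ forall k, t <= 2 ^+ k -> (l <= k)%N.
  by rewrite /l; case: ex_minnP => l' ? ?; split.
have lm : (l < m.+1)%N by rewrite ltnS lmin.
rewrite (bigD1 (Ordinal lm))//= tl mulr1 -[leLHS]addr0 lerD//; last first.
  by apply: sumr_ge0 => k _; rewrite !mulr_ge0// exprn_ge0// invr_ge0 exprn_ge0.
have t1 : 0 < 1 + t by rewrite ltr_pwDl.
case: (l) lmin => [_|k kmin].
  rewrite expr0 mulr1 (@le_trans _ _ 1)//.
    by rewrite invf_le1 ?exprn_gt0// exprn_ege1// lerDl.
  by rewrite exprn_ege1// ler1n.
have kt : 2 ^+ k < t.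
  by rewrite ltNge; apply/negP => /kmin; rewrite ltnn.
rewrite exprS mulrA divff ?mul1r ?expf_neq0// exprVn.
rewrite lef_pV2 ?posrE ?exprn_gt0// -exprM mulnC exprM lerXn2r// ?nnegrE ?exprn_ge0//.
  exact: ltW.
by rewrite (le_trans (ltW kt))// lerDr.
Qed.

(** * Caps and separated nets under a doubling weight *)

Section Doubling.
Context {R : realType} {d : nat}.
Variable w : euclidean R d -> R.
Hypothesis wd : doubling_weight w.
Local Notation Bd := (@unit_ball R d).
Local Notation mass := (ball_mass w).
Local Notation cap := (@ball_cap R d).
Implicit Types (x y z : euclidean R d) (r s : R).

Let wei : is_weight w. Proof. by case: wd. Qed.

Lemma cap_sub_cap x y r s : Bd x -> Bd y -> ball_dist y x + r <= s ->
  cap x r `<=` cap y s.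
Proof.
move=> bx b_y rs z [bz xz]; split=> //.
by rewrite (le_trans (ball_dist_triangle b_y bx bz))// (le_trans _ rs)// lerD2l.
Qed.

Lemma cap_mono x r s : r <= s -> cap x r `<=` cap x s.
Proof. by move=> rs z [bz xz]; split=> //; exact: le_trans rs. Qed.

(** The radius 4 stands for any number above pi, the largest distance. *)
Lemma cap_large x r : Bd x -> 4 <= r -> cap x r = Bd.
Proof.
move=> bx r4; apply/seteqP; split=> y; first by case.
move=> b_y; split=> //; rewrite (le_trans (ball_dist_lepi bx b_y))//.
by have := @pihalf_lt2 R; lra.
Qed.

Lemma doubling_constant : exists2 L : R, 1 <= L & forall x r, Bd x -> 0 < r ->
  mass (cap x (2 * r)) <= L * mass (cap x r).
Proof.
have [_ [L L0 dL]] := wd; exists (1 + L) => [|x r bx r0]; first by rewrite lerDl ltW.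
have mc s : measurable (cap x s) by exact: measurable_ball_cap.
have := dL x r bx r0.
rewrite (ball_massE wei (mc _) (@cap_sub _ _ x _)) (ball_massE wei (mc _) (@cap_sub _ _ x _)).
rewrite -EFinM lee_fin => /le_trans; apply; rewrite mulrDl mul1r lerDr.
exact: cap_mass_ge0.
Qed.

Section FixedConstant.
Variable L : R.
Hypotheses (L1 : 1 <= L) (dL : forall x r, Bd x -> 0 < r ->
  mass (cap x (2 * r)) <= L * mass (cap x r)).

Let L0 : 0 < L. Proof. exact: lt_le_trans L1. Qed.

Lemma cap_mass_le x y r s : Bd x -> Bd y -> ball_dist y x + r <= s ->
  mass (cap x r) <= mass (cap y s).
Proof.
move=> bx b_y rs.
exact: (ball_mass_le wei (measurable_ball_cap r bx) (measurable_ball_cap s b_y)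
  (cap_sub_cap bx b_y rs) (@cap_sub _ _ y s)).
Qed.

Lemma doubling_iter l x r : Bd x -> 0 < r ->
  mass (cap x (2 ^+ l * r)) <= L ^+ l * mass (cap x r).
Proof.
move=> bx r0; elim: l => [|l IH]; first by rewrite !expr0 !mul1r.
rewrite !exprS -!mulrA (le_trans (dL bx _))//; first by rewrite mulr_gt0// exprn_gt0.
by rewrite ler_wpM2l// ltW.
Qed.

Lemma mass_ball_le l x r : Bd x -> 0 < r -> 4 <= 2 ^+ l * r ->
  mass Bd <= L ^+ l * mass (cap x r).
Proof. by move=> bx r0 lr; rewrite -(cap_large bx lr); exact: doubling_iter. Qed.

Lemma mass_cap_gt0 x r : Bd x -> 0 < r -> 0 < mass (cap x r).
Proof.
move=> bx r0; have [l] := exp2_unbounded (4 / r); rewrite ler_pdivrMr// => /(mass_ball_le bx r0).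
by move=> /(lt_le_trans (ball_mass_gt0 wei)); rewrite pmulr_rgt0// exprn_gt0.
Qed.

Definition separated m r (X : 'I_m -> euclidean R d) :=
  (forall k, Bd (X k)) /\ (forall k l, k != l -> r < ball_dist (X k) (X l)).

Lemma separated_disjoint m r (X : 'I_m -> euclidean R d) (J : pred 'I_m) y :
  separated r X -> \sum_(k | J k) (\1_(cap (X k) (r / 2)) y : R) <= 1.
Proof.
move=> [bX sX].
have [[k0 [Jk0 yk0]]|no] := pselect (exists k, J k /\ cap (X k) (r / 2) y); last first.
  rewrite big1// => k Jk; rewrite indicE memNset// => yk.
  by apply: no; exists k.
rewrite (bigD1 k0)//= big1 ?addr0; first by rewrite indicE lern1 leq_b1.
move=> k /andP[Jk kk0]; rewrite indicE memNset// => -[b_y yk].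
have := sX _ _ kk0; rewrite ltNge => /negP; apply.
rewrite (le_trans (ball_dist_triangle (bX k) b_y (bX k0)))//.
by case: yk0 => _ yk0; rewrite [leRHS]splitr lerD// ball_distC.
Qed.

Lemma separated_mass m r (X : 'I_m -> euclidean R d) (J : pred 'I_m) U :
  separated r X -> measurable U -> U `<=` Bd ->
  (forall k, J k -> cap (X k) (r / 2) `<=` U) ->
  \sum_(k | J k) mass (cap (X k) (r / 2)) <= mass U.
Proof.
move=> sX mU Ub JU; have [bX _] := sX.
have mD k : measurable (cap (X k) (r / 2)) by exact: measurable_ball_cap.
rewrite ball_mass_int (eq_bigr _ (fun k _ => ball_mass_int w _)) -[leRHS]mul1r.
apply: (ball_int_overlap wei (wbounded1 Bd) mD mU Ub JU ler01) => y _.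
exact: separated_disjoint.
Qed.

(** Otherwise every separated family could be extended by an uncovered point. But its disjoint half
    caps each hold at least L^-l of the total mass, so it has at most L^l members: doubling takes
    the place of a compactness argument. *)
Lemma net_exists r : 0 < r -> exists m (X : 'I_m -> euclidean R d),
  separated r X /\ forall y, Bd y -> exists k, cap (X k) r y.
Proof.
move=> r0; apply: contrapT => nonet.
have r20 : 0 < r / 2 by rewrite divr_gt0.
have ext m : exists X : 'I_m -> euclidean R d, separated r X.
  elim: m => [|m [X sX]].
    have x0 : euclidean R d := [tuple 0 | i < d].
    by exists (fun=> x0); split=> -[].
  have [y [b_y yX]] : exists y, Bd y /\ forall k, ~ cap (X k) r y.
    apply: contrapT => noy; apply: nonet; exists m, X; split=> // y b_y.
    apply: contrapT => nok; apply: noy; exists y; split=> // k ck.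
    by apply: nok; exists k.
  have yd k : r < ball_dist (X k) y by rewrite ltNge; apply/negP => h; apply: (yX k).
  have [bX dX] := sX.
  exists (fun k => if unlift ord0 k is Some i then X i else y); split.
    by move=> k; case: unliftP => [i|] _.
  move=> k l; case: unliftP => [i|] ->; case: unliftP => [j|] ->.
  - by rewrite (inj_eq (@lift_inj _ _)) => /dX.
  - by rewrite yd.
  - by rewrite ball_distC yd.
  - by rewrite eqxx.
have [l] := exp2_unbounded (4 / (r / 2)); rewrite ler_pdivrMr// => lr.
have [N LN] : exists N : nat, L ^+ l < N%:R.
  by exists (Num.truncn (L ^+ l)).+1; exact: truncnS_gt.
have [X sX] := ext N; have [bX _] := sX.
have : \sum_(k < N) mass (cap (X k) (r / 2)) <= mass Bd.
  exact: (separated_mass (J := xpredT) sX measurable_unit_ball (@subset_refl _ _)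
    (fun k _ => @cap_sub _ _ (X k) _)).
have mb := ball_mass_gt0 wei; apply/negP; rewrite -ltNge.
have Ll0 : 0 < L ^+ l by rewrite exprn_gt0.
rewrite (@lt_le_trans _ _ (N%:R * (mass Bd / L ^+ l)))//.
  by rewrite mulrCA ltr_pMr// ltr_pdivlMr// mul1r.
rewrite mulr_natl -[X in _ *+ X]card_ord -sumr_const; apply: ler_sum => k _.
by rewrite ler_pdivrMr// mulrC mass_ball_le.
Qed.

Section Net.
Variables (r : R) (m : nat) (X : 'I_m -> euclidean R d).
Hypotheses (r0 : 0 < r) (sX : separated r X).
Hypothesis covX : forall y, Bd y -> exists k, cap (X k) r y.

Let bX k : Bd (X k). Proof. by case: sX. Qed.

(** Half caps with centre within 2 r of y are disjoint subsets of [U], and [U] lies in the cap of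
    radius 5 r <= 2^4 (r / 2) about each such centre. *)
Lemma net_overlap y : Bd y -> \sum_k (\1_(cap (X k) (2 * r)) y : R) <= L ^+ 4.
Proof.
move=> b_y; pose U := cap y (3 * r).
have U0 : 0 < mass U by apply: mass_cap_gt0 => //; rewrite mulr_gt0.
pose J k := `[< cap (X k) (2 * r) y >].
have JU k : J k -> cap (X k) (r / 2) `<=` U.
  move=> /asboolP[_ yk]; apply: cap_sub_cap => //.
  by rewrite ball_distC; move: r0 yk; lra.
have h := separated_mass sX (measurable_ball_cap (3 * r) b_y) (@cap_sub _ _ y _) JU.
rewrite -(ler_pM2r U0) (le_trans _ (ler_wpM2l (exprn_ge0 4 (ltW L0)) h))// mulr_suml.
rewrite mulr_sumr [leRHS]big_mkcond; apply: ler_sum => k _.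
rewrite indicE; case: (boolP (J k)) => [Jk|/asboolP nJ]; last first.
  by rewrite memNset// mul0r.
rewrite mem_set ?mul1r; last exact/asboolP.
rewrite (le_trans _ (@doubling_iter 4 _ _ (bX k) _))//; last by rewrite divr_gt0.
apply: cap_mass_le => //.
by move/asboolP : Jk => [_]; move: r0; rewrite (_ : 2 ^+ 4 = 16); [lra|ring].
Qed.

(** Centres within 2^l r of x have disjoint half caps inside the cap of radius 2^(l + 1) r about x,
    so their caps weigh at most L^(l + 2) times the cap of x. The l-th dyadic coefficient is 2^K
    2^(- K l), and 2 L <= 2^K makes the series geometric with ratio at most 1 / 2. *)
Lemma net_kernel_sum K x : 2 * L <= 2 ^+ K -> Bd x ->
  \sum_k mass (cap (X k) r) * (1 + ball_dist (X k) x / r) ^- K <=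
  2 * 2 ^+ K * L ^+ 2 * mass (cap x r).
Proof.
move=> LK bx.
have [M Mr] := exp2_unbounded (4 / r).
have tb k : 0 <= ball_dist (X k) x / r <= 2 ^+ M.
  rewrite divr_ge0 ?ball_dist_ge0 ?(ltW r0)//= (le_trans _ Mr)// ler_pM2r ?invr_gt0//.
  by rewrite (le_trans (ball_dist_lepi (bX k) bx))//; have := @pihalf_lt2 R; lra.
pose q : R := 2 ^- K.
have K0 : 0 < 2 ^+ K :> R by rewrite exprn_gt0.
apply: (@le_trans _ _ (\sum_k mass (cap (X k) r) *
    \sum_(l < M.+1) 2 ^+ K * q ^+ l * (ball_dist (X k) x / r <= 2 ^+ l)%R%:R)).
  apply: ler_sum => k _; rewrite ler_wpM2l//; first exact: cap_mass_ge0.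
  by case/andP: (tb k) => ? ?; exact: decay_le_dyadic.
under eq_bigr do rewrite mulr_sumr.
rewrite exchange_big/=.
have layer (l : nat) : \sum_k mass (cap (X k) r) * (ball_dist (X k) x / r <= 2 ^+ l)%R%:R <=
    L ^+ l.+2 * mass (cap x r).
  pose J k := ball_dist (X k) x / r <= 2 ^+ l.
  have JU k : J k -> cap (X k) (r / 2) `<=` cap x (2 ^+ l.+1 * r).
    rewrite /J ler_pdivrMr// => Jk; apply: cap_sub_cap => //.
    have : r <= 2 ^+ l * r by rewrite ler_pMl// exprn_ege1// ler1n.
    by rewrite exprS ball_distC; move: r0 Jk; lra.
  have := separated_mass sX (measurable_ball_cap _ bx) (@cap_sub _ _ x _) JU.
  move=> /le_trans /(_ (doubling_iter l.+1 bx r0)) h.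
  rewrite exprS -mulrA (le_trans _ (ler_wpM2l (ltW L0) h))// mulr_sumr [leRHS]big_mkcond.
  apply: ler_sum => k _; rewrite -/(J k); case: (J k); last by rewrite mulr0.
  rewrite mulr1 (le_trans _ (dL (bX k) _)) ?divr_gt0//.
  by rewrite mulrC divfK.
apply: (@le_trans _ _ (\sum_(l < M.+1) 2 ^+ K * L ^+ 2 * mass (cap x r) * 2^-1 ^+ l)).
  apply: ler_sum => l _.
  rewrite (eq_bigr (fun k => 2 ^+ K * q ^+ l *
      (mass (cap (X k) r) * (ball_dist (X k) x / r <= 2 ^+ l)%R%:R)));
    last by move=> k _; rewrite mulrCA.
  rewrite -mulr_sumr (le_trans (ler_wpM2l _ (layer l)))//.
    by rewrite mulr_ge0// ?exprn_ge0// invr_ge0 ltW.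
  have Lq : L * q <= 2^-1 by rewrite ler_pdivrMr// mulrC ler_pdivlMr// mulrC.
  rewrite [leLHS](_ : _ = 2 ^+ K * L ^+ 2 * mass (cap x r) * (L * q) ^+ l).
    rewrite ler_wpM2l//.
      by rewrite !mulr_ge0 ?exprn_ge0 ?(ltW L0)// cap_mass_ge0.
    by rewrite lerXn2r// nnegrE// mulr_ge0 ?(ltW L0)// invr_ge0 ltW.
  by rewrite exprMn 2![L ^+ _.+1]exprS; ring.
rewrite -mulr_sumr mulrC -!mulrA ler_wpM2r ?sum_geometric_half//.
by rewrite !mulr_ge0 ?exprn_ge0 ?(ltW L0)// cap_mass_ge0.
Qed.

End Net.

End FixedConstant.

End Doubling.

Section BoundedPolynomials.
Context {R : realType} {d : nat}.
Local Notation Bd := (@unit_ball R d).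
Implicit Types (x y : euclidean R d) (P : mpoly.mpoly d R).

Lemma coord_le1 x i : Bd x -> `|tnth x i| <= 1.
Proof.
move=> /unit_ballE bx; rewrite -(expr_le1 (n := 2))// real_normK ?num_real//.
rewrite (le_trans _ bx)// /dot (bigD1 i)//= -expr2 lerDl.
by apply: sumr_ge0 => j _; rewrite -expr2 sqr_ge0.
Qed.

Lemma peval_bounded P : exists M, forall x, Bd x -> `|peval P x| <= M.
Proof.
exists (\sum_(m <- mpoly.msupp P) `|mpoly.mcoeff m P|) => x bx.
rewrite /peval mpoly.mevalE (le_trans (ler_norm_sum _ _ _))//.
apply: ler_sum => m _; rewrite normrM ler_piMr// normr_prod.
apply: prodr_ile1 => i _.
by rewrite normr_ge0 normrX exprn_ile1// coord_le1.
Qed.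

Lemma grad_length_bounded P : exists M, forall x, Bd x -> grad_length P x <= M.
Proof.
have /choice[M PM] i := peval_bounded (mpoly.mderiv i P).
exists (Num.sqrt (\sum_(i < d) M i ^+ 2)) => x bx.
rewrite ler_wsqrtr//; apply: ler_sum => i _.
rewrite -[leLHS]real_normK ?num_real// lerXn2r// ?nnegrE ?PM//.
exact: le_trans (PM i x bx).
Qed.

Lemma grad_length_ge0 P x : 0 <= grad_length P x. Proof. exact: sqrtr_ge0. Qed.

Lemma wbounded_norm_powR (f : euclidean R d -> R) (p : R) : 0 <= p ->
  measurable_fun [set: euclidean R d] f -> (exists M, forall x, Bd x -> `|f x| <= M) ->
  wbounded Bd (fun x => `|f x| `^ p).
Proof.
move=> p0 mf [M fM]; split.
- apply: (measurableT_comp (f := @powR R ^~ p)); first exact: measurable_powR.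
  by apply: (measurableT_comp (f := @Num.norm _ R)) => //; exact: normr_measurable.
- by move=> x _; exact: powR_ge0.
- exists (`|M| `^ p) => x bx; apply: ge0_ler_powR; rewrite ?nnegrE//.
  by rewrite (le_trans (fM x bx))// ler_norm.
Qed.

Lemma wbounded_peval P p : 0 <= p -> wbounded Bd (fun x => `|peval P x| `^ p).
Proof.
move=> p0; have mP := borel_measurable_fun (borel_peval P).
exact: (wbounded_norm_powR p0 mP (peval_bounded P)).
Qed.

Lemma wbounded_grad P p : 0 <= p -> wbounded Bd (fun x => `|grad_length P x| `^ p).
Proof.
move=> p0; have mG := borel_measurable_fun (borel_grad_length P).
have bG : exists M, forall x, Bd x -> `|grad_length P x| <= M.
  have [M PM] := grad_length_bounded P; exists M => x bx.
  by rewrite ger0_norm ?grad_length_ge0 ?PM.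
exact: (wbounded_norm_powR p0 mG bG).
Qed.

Lemma wnormE (w : euclidean R d -> R) (f : euclidean R d -> R) p : is_weight w ->
  wbounded Bd (fun x => `|f x| `^ p) ->
  wnorm p w f = (ball_int w (fun x => `|f x| `^ p) Bd `^ p^-1)%:E.
Proof.
move=> wei bf; rewrite /wnorm -poweR_EFin; congr poweR.
exact: (ball_intE wei bf measurable_unit_ball (@subset_refl _ _)).
Qed.

End BoundedPolynomials.

Lemma powRD_le {R : realType} (p a b : R) : 0 <= p -> 0 <= a -> 0 <= b ->
  (a + b) `^ p <= 2 `^ p * (a `^ p + b `^ p).
Proof.
move=> p0; wlog ab : a b / a <= b.
  move=> hw; have [ab|/ltW ba] := leP a b; first exact: hw.
  by move=> a0 b0; rewrite addrC [X in _ * X]addrC hw.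
move=> a0 b0; rewrite (@le_trans _ _ ((2 * b) `^ p))//.
  by apply: ge0_ler_powR; rewrite ?nnegrE ?addr_ge0 ?mulr_ge0//; lra.
by rewrite powRM// ler_wpM2l ?powR_ge0// lerDr powR_ge0.
Qed.

Lemma le_powR_ge1 {R : realType} (p a : R) : 1 <= p -> 0 <= a <= 1 -> a `^ p <= a.
Proof.
move=> p1 /andP[]; rewrite le_eqVlt => /orP[/eqP <- _|a0 a1].
  by rewrite powR0// gt_eqF// (lt_le_trans _ p1).
by rewrite ge1r_powR// a0.
Qed.

(** * The absorption argument *)

Section UpperBound.
Context {R : realType} {d : nat}.
Variables (w : euclidean R d -> R) (p : R).
Hypotheses (wd : doubling_weight w) (p1 : 1 <= p).
Local Notation Bd := (@unit_ball R d).
Local Notation mass := (ball_mass w).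
Local Notation cap := (@ball_cap R d).
Implicit Types (x y z : euclidean R d).

Let wei : is_weight w. Proof. by case: wd. Qed.
Let p0 : 0 <= p. Proof. exact: le_trans p1. Qed.

Section Constants.
Variables (L : R) (K l : nat).
Hypotheses (L1 : 1 <= L) (dL : forall x r, Bd x -> 0 < r ->
  mass (cap x (2 * r)) <= L * mass (cap x r)) (LK : 2 * L <= 2 ^+ K).

(** [C1] is the constant of [net_kernel_sum]; [co] and [cg] are those of [local_oscillation] and
    [local_markov] for the growth bound 2 3^K A_k. The condition [lC] below is what lets half of the
    sum be absorbed. *)
Let C1 : R := 2 * 2 ^+ K * L ^+ 2.
Let co : R := 2 * K.+1%:R * 6 ^+ K * (2 * 3 ^+ K).
Let cg : R := d%:R * (24 * K.+1%:R ^+ 2 * 12 ^+ K) * (2 * 3 ^+ K).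
Let delta : R := 2 ^- l.

Hypotheses (lo : co * delta <= 1) (lC : C1 * 2 `^ p * (co * delta) <= 2^-1).

Let L0 : 0 < L. Proof. exact: lt_le_trans L1. Qed.
Let delta0 : 0 < delta. Proof. by rewrite invr_gt0 exprn_gt0. Qed.
Let delta1 : delta <= 1. Proof. by rewrite invf_le1 ?exprn_gt0// exprn_ege1// ler1n. Qed.
Let co0 : 0 <= co. Proof. by rewrite !mulr_ge0// ?exprn_ge0. Qed.
Let C10 : 0 <= C1. Proof. by rewrite !mulr_ge0// ?exprn_ge0// ?ltW//. Qed.
Let cg0 : 0 <= cg. Proof. by rewrite !mulr_ge0// ?exprn_ge0. Qed.

Lemma grad_int_le n P : (0 < n)%N -> Pi_poly n P ->
  ball_int w (fun x => `|grad_length P x| `^ p) Bd <=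
  (cg * n%:R ^+ 2) `^ p * (2 * C1 * 2 `^ p * L ^+ l.+1 * L ^+ 4) *
  ball_int w (fun x => `|peval P x| `^ p) Bd.
Proof.
move=> n0 Pn; set I := ball_int w (fun x => `|peval P x| `^ p) Bd.
have bP := wbounded_peval P p0; have bG := wbounded_grad P p0.
have nR0 : 0 < n%:R :> R by rewrite ltr0n.
pose r : R := n%:R^-1; have r0 : 0 < r by rewrite invr_gt0.
have [m [X [sX covX]]] := net_exists wd L1 dL r0.
have bX k : Bd (X k) by case: sX.
have mc x s : Bd x -> measurable (cap x s) by exact: measurable_ball_cap.
(* A point where |P| is at least half its supremum on the cap, whether or not the supremum is
   attained. *)
have /choice[z zP] j : exists z, cap (X j) r z /\
    forall y, cap (X j) r y -> `|peval P y| <= 2 * `|peval P z|.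
  have [M PM] := peval_bounded P.
  pose E : set R := [set `|peval P y| | y in cap (X j) r].
  have XjE : cap (X j) r (X j) by split=> //; rewrite ball_dist_self// ltW.
  have supE : has_sup E.
    split; first by exists (`|peval P (X j)|), (X j).
    by exists M => _ [y [b_y _] <-]; exact: PM.
  have [s0|s0] := leP (sup E) 0.
    exists (X j); split=> // y cy; rewrite (@le_trans _ _ 0)// ?mulr_ge0//.
    by rewrite (le_trans _ s0)//; apply: ub_le_sup; [exact: supE.2|exists y].
  have s20 : 0 < sup E / 2 by rewrite divr_gt0.
  have [_ [z cz <-] zE] := sup_adherent s20 supE.
  exists z; split=> // y cy; rewrite (@le_trans _ _ (sup E))//.
    by apply: ub_le_sup; [exact: supE.2|exists y].
  by move: zE; lra.
have bz j : Bd (z j) by case: (zP j) => -[].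
pose mj j := `|peval P (z j)|.
have mj0 j : 0 <= mj j by exact: normr_ge0.
pose om k j := (1 + ball_dist (X k) (X j) / r) ^- K.
have den0 k j : 1 <= 1 + ball_dist (X k) (X j) / r.
  by rewrite lerDl divr_ge0 ?ball_dist_ge0// ltW.
have om01 k j : 0 <= om k j <= 1.
  have h : 1 <= (1 + ball_dist (X k) (X j) / r) ^+ K by rewrite exprn_ege1.
  by rewrite invr_ge0 (le_trans ler01 h)/= invf_le1// (lt_le_trans ltr01 h).
pose A k : R := \big[Num.max/0]_j (mj j * om k j).
have A0 k : 0 <= A k by exact: bigmax_ge_id.
have AM k j : mj j * om k j <= A k by exact: le_bigmax.
(* A maximum is at most the sum, and dropping the exponent p >= 1 from a damping factor in [0, 1]
   can only increase it. *)
have Ap k : A k `^ p <= \sum_j (mj j `^ p * om k j).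
  have S0' : 0 <= \sum_j (mj j `^ p * om k j).
    by apply: sumr_ge0 => j _; rewrite mulr_ge0 ?powR_ge0//; case/andP: (om01 k j).
  rewrite /A; elim/big_ind : _ => [|a b ha hb|j _].
  - by rewrite powR0// gt_eqF// (lt_le_trans _ p1).
  - by rewrite maxEle; case: ifP.
  - have /andP[q0 q1] := om01 k j; rewrite powRM//.
    rewrite (@le_trans _ _ (mj j `^ p * om k j))//.
      by rewrite ler_wpM2l ?powR_ge0// le_powR_ge1// q0.
    rewrite (bigD1 j)//= lerDl sumr_ge0// => i _.
    by rewrite mulr_ge0 ?powR_ge0//; case/andP: (om01 k i).
(* The growth hypothesis of the local inequalities at every x of the k-th cap: if y is in the j-th
   cap, the centres are at most 2 r + d(x, y) apart, and 1 + n (2 r + d) <= 3 (1 + n d), whence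
   3^K. *)
have loc k x y : cap (X k) r x -> Bd y ->
    `|peval P y| <= 2 * 3 ^+ K * A k * (1 + n%:R * ball_dist x y) ^+ K.
  move=> [bx kx] b_y; have [j cj] := covX y b_y.
  rewrite (le_trans ((zP j).2 y cj))// -!mulrA ler_pM2l//.
  have /andP[q0 _] := om01 k j.
  have h : mj j <= A k * (1 + ball_dist (X k) (X j) / r) ^+ K.
    have den : 0 < (1 + ball_dist (X k) (X j) / r) ^+ K.
      by rewrite exprn_gt0// (lt_le_trans ltr01 (den0 k j)).
    by rewrite -ler_pdivrMr//; exact: AM.
  rewrite (le_trans h)// mulrCA ler_wpM2l// -exprMn lerXn2r// ?nnegrE.
  - exact: le_trans (den0 k j).
  - by rewrite mulr_ge0// addr_ge0// mulr_ge0// ball_dist_ge0.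
  - rewrite /r invrK.
    have nk : n%:R * ball_dist (X k) x <= 1 by rewrite mulrC -ler_pdivlMr// mul1r.
    have nj : n%:R * ball_dist (X j) y <= 1 by case: cj => _ cj; rewrite mulrC -ler_pdivlMr// mul1r.
    have t1 := ball_dist_triangle (bX k) bx (bX j).
    have t2 := ball_dist_triangle bx b_y (bX j).
    rewrite [ball_dist y (X j)]ball_distC in t2.
    have t3 : ball_dist (X k) (X j) <= ball_dist (X k) x + (ball_dist x y + ball_dist (X j) y) by lra.
    have := ler_wpM2l (ltW nR0) t3.
    have : 0 <= n%:R * ball_dist x y by rewrite mulr_ge0// ball_dist_ge0.
    by lra.
have kA k : 0 <= 2 * 3 ^+ K * A k by rewrite !mulr_ge0// exprn_ge0.
have grad k x : cap (X k) r x -> grad_length P x <= cg * n%:R ^+ 2 * A k.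
  move=> ck; have [bx _] := ck.
  rewrite (le_trans (local_markov n0 Pn bx (kA k) (fun y => loc k x y ck)))//.
  by rewrite /cg le_eqVlt; apply/orP; left; apply/eqP; ring.
have osc k x y : cap (X k) r x -> Bd y -> n%:R * ball_dist x y <= delta ->
    `|peval P x - peval P y| <= co * delta * A k.
  move=> ck b_y xy; have [bx _] := ck.
  rewrite (le_trans (local_oscillation n0 Pn bx (kA k) (fun y => loc k x y ck) b_y delta1 xy))//.
  by rewrite /co le_eqVlt; apply/orP; left; apply/eqP; ring.
pose nu k := mass (cap (X k) r).
have nu0 k : 0 <= nu k by exact: cap_mass_ge0.
pose S := \sum_k nu k * A k `^ p.
have S0 : 0 <= S by apply: sumr_ge0 => k _; rewrite mulr_ge0 ?powR_ge0.
pose G j := cap (z j) (delta * r).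
have dr0 : 0 < delta * r by rewrite mulr_gt0.
have dr1 : delta * r <= r by rewrite ler_piMl// ltW.
have GX j : G j `<=` cap (X j) (2 * r).
  by apply: cap_sub_cap => //; case: (zP j) => -[_ zj] _; move: dr1 zj; lra.
pose J j := ball_int w (fun x => `|peval P x| `^ p) (G j).
have J0 j : 0 <= J j by exact: (ball_int_ge0 wei bP (@cap_sub _ _ (z j) _)).
(* On [G j], |P| is at least m_j - co delta A_j; integrating p-th powers over [G j] bounds m_j^p.
   This small cap is comparable in mass with the j-th one because 2^(l + 1) delta r = 2 r. *)
have cell j : nu j * mj j `^ p <= (2 `^ p) * (L ^+ l.+1 * J j + (co * delta) * (nu j * A j `^ p)).
  have mG : 0 < mass (G j) by exact: (mass_cap_gt0 wd L1 dL).
  have nuG : nu j <= L ^+ l.+1 * mass (G j).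
    rewrite (le_trans _ (doubling_iter L1 dL l.+1 (bz j) dr0))//.
    apply: (cap_mass_le wd) => //.
    rewrite exprS /delta mulrA -[_ * 2 ^- l]mulrA divff ?mulr1 ?expf_neq0//.
    by case: (zP j) => -[_ zj] _; rewrite ball_distC; move: r0 zj; lra.
  (* A lower bound for |P|^p on [G j]; if it is negative, the estimate is trivial. *)
  pose a := mj j `^ p / 2 `^ p - (co * delta * A j) `^ p.
  have p2 : 0 < 2 `^ p :> R by rewrite powR_gt0.
  have caA : 0 <= co * delta * A j by rewrite !mulr_ge0// ltW.
  have aJ : a * mass (G j) <= J j.
    have [a0|/ltW a0] := leP 0 a; last first.
      by rewrite (le_trans _ (J0 j))// mulr_le0_ge0// ltW.
    rewrite -(ball_int_cst wei a0 (mc _ _ (bz j)) (@cap_sub _ _ (z j) _)).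
    apply: (ball_int_mono wei (wbounded_cst Bd a0) bP (mc _ _ (bz j)) (@cap_sub _ _ (z j) _)).
    move=> y [b_y zy]; rewrite /a lerBlDr ler_pdivrMr// mulrC.
    rewrite (le_trans _ (powRD_le p0 _ _))//.
    apply: ge0_ler_powR; rewrite ?nnegrE ?addr_ge0//.
    have := osc j (z j) y (zP j).1 b_y.
    rewrite mulrC -ler_pdivlMr// => /(_ zy).
    have := ler_normD (peval P (z j) - peval P y) (peval P y); rewrite subrK.
    by rewrite -/(mj j); lra.
  have cA : (co * delta * A j) `^ p <= co * delta * A j `^ p.
    rewrite powRM ?mulr_ge0// ?(ltW delta0)// ler_wpM2r ?powR_ge0// le_powR_ge1// lo mulr_ge0//.
    exact: ltW.
  have LG : L ^+ l.+1 * (a * mass (G j)) <= L ^+ l.+1 * J j.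
    by rewrite ler_wpM2l// exprn_ge0// ltW.
  have e1 : mj j `^ p = 2 `^ p * (a + (co * delta * A j) `^ p).
    by rewrite /a subrK mulrC divfK// gt_eqF.
  rewrite e1 mulrCA ler_wpM2l ?powR_ge0// mulrDr lerD//.
    have [a0|/ltW a0] := leP 0 a.
      by rewrite (le_trans _ LG)// mulrCA mulrC ler_wpM2l.
    by rewrite (@le_trans _ _ 0)// ?mulr_ge0_le0// mulr_ge0// exprn_ge0// ltW.
  by rewrite [leRHS]mulrCA ler_wpM2l.
have SumJ : \sum_j J j <= L ^+ 4 * I.
  apply: (ball_int_overlap wei bP _ measurable_unit_ball (@subset_refl _ _)).
  - by move=> j; exact: mc.
  - by move=> j _; exact: cap_sub.
  - by rewrite exprn_ge0// ltW.
  - move=> x bx; rewrite (le_trans _ (net_overlap wd L1 dL r0 sX bx))//.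
    apply: ler_sum => j _; rewrite !indicE ler_nat.
    by case: (boolP (x \in G j)) => // /set_mem /GX /mem_set ->.
have S1 : S <= C1 * \sum_j nu j * mj j `^ p.
  apply: (@le_trans _ _ (\sum_k nu k * \sum_j mj j `^ p * om k j)).
    by apply: ler_sum => k _; rewrite ler_wpM2l.
  under eq_bigr do rewrite mulr_sumr.
  rewrite exchange_big mulr_sumr; apply: ler_sum => j _ /=.
  rewrite (eq_bigr (fun k => mj j `^ p * (nu k * om k j))) => [|k _]; last by rewrite mulrCA.
  rewrite -mulr_sumr mulrA [leRHS]mulrC ler_wpM2l ?powR_ge0//.
  exact: (net_kernel_sum wd L1 dL r0 sX LK (bX j)).
have S2 : \sum_j nu j * mj j `^ p <= 2 `^ p * (L ^+ l.+1 * (L ^+ 4 * I) + co * delta * S).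
  apply: (@le_trans _ _ (\sum_j (2 `^ p) * (L ^+ l.+1 * J j + (co * delta) * (nu j * A j `^ p)))).
    exact: ler_sum.
  rewrite -mulr_sumr ler_wpM2l ?powR_ge0// big_split/= -!mulr_sumr lerD2r ler_wpM2l//.
  by rewrite exprn_ge0// ltW.
(* [S] is a finite real number, so half of it can be moved to the left. *)
have S3 : S <= 2 * C1 * 2 `^ p * L ^+ l.+1 * L ^+ 4 * I.
  have h : S <= C1 * 2 `^ p * L ^+ l.+1 * L ^+ 4 * I + 2^-1 * S.
    rewrite (le_trans S1)// (le_trans (ler_wpM2l C10 S2))//.
    have := ler_wpM2r S0 lC; lra.
  lra.
have : ball_int w (fun x => `|grad_length P x| `^ p) Bd <= (cg * n%:R ^+ 2) `^ p * S.
  have mX k : measurable (cap (X k) r) by exact: mc.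
  rewrite (le_trans (ball_int_cover wei bG mX (fun k => @cap_sub _ _ (X k) r) covX))//.
  rewrite mulr_sumr; apply: ler_sum => k _.
  rewrite mulrCA -powRM ?mulr_ge0// ?exprn_ge0// mulrC.
  rewrite -(ball_int_cst wei (powR_ge0 _ _) (mX k) (@cap_sub _ _ (X k) r)).
  apply: (ball_int_mono wei bG (wbounded_cst Bd (powR_ge0 _ _)) (mX k) (@cap_sub _ _ (X k) r)).
  move=> x ck /=; apply: ge0_ler_powR; rewrite ?nnegrE ?mulr_ge0// ?exprn_ge0//.
  by rewrite ger0_norm ?grad_length_ge0// grad.
move/le_trans; apply; rewrite -mulrA ler_wpM2l ?powR_ge0//.
Qed.

End Constants.

End UpperBound.

(** If b = 0, then a = 0 too, and the extended quotient is 0. *)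
Lemma EFin_div_le {R : realType} (a b c : R) :
  0 <= a -> 0 <= b -> 0 <= c -> a <= c * b -> (a%:E / b%:E <= c%:E)%E.
Proof.
move=> a0 + c0; rewrite le_eqVlt => /orP[/eqP <-|b0] ab.
  suff -> : a = 0 by rewrite mul0e lee_fin.
  by apply/eqP; rewrite eq_le a0 andbT; move: ab; rewrite mulr0.
by rewrite inver gt_eqF// lee_pdivrMr// -EFinM lee_fin.
Qed.

Lemma le_powR_root {R : realType} (p c a b : R) : 0 < p -> 0 <= c -> 0 <= a ->
  0 <= b -> a <= c `^ p * b -> a `^ p^-1 <= c * b `^ p^-1.
Proof.
move=> p0 c0 a0 b0 ab.
rewrite -[c in c * _](powRr1 c0) -(divff (lt0r_neq0 p0)) powRrM -powRM ?powR_ge0//.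
by apply: ge0_ler_powR; rewrite ?nnegrE ?mulr_ge0 ?powR_ge0 ?invr_ge0 ?(ltW p0).
Qed.

Lemma powR_root_le {R : realType} (p c a b : R) : 0 < p -> 0 <= c -> 0 <= a ->
  0 <= b -> c `^ p * b <= a -> c * b `^ p^-1 <= a `^ p^-1.
Proof.
move=> p0 c0 a0 b0 ab.
rewrite -[c in c * _](powRr1 c0) -(divff (lt0r_neq0 p0)) powRrM -powRM ?powR_ge0//.
by apply: ge0_ler_powR; rewrite ?nnegrE ?mulr_ge0 ?powR_ge0 ?invr_ge0 ?(ltW p0).
Qed.

Section UpperBoundMwor.
Context {R : realType} {d : nat}.
Local Notation Bd := (@unit_ball R d).

Lemma Mwor_le (w : euclidean R d -> R) (p c : R) n : is_weight w -> 1 <= p -> 0 <= c ->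
  (forall P, Pi_poly n P ->
     ball_int w (fun x => `|grad_length P x| `^ p) Bd <=
     c `^ p * ball_int w (fun x => `|peval P x| `^ p) Bd) ->
  (Mwor p w n <= c%:E)%E.
Proof.
move=> wei p1 c0 h; have p0 : 0 < p by rewrite (lt_le_trans ltr01).
apply: ge_ereal_sup => _ [P [_ Pn] <-].
have bP := wbounded_peval P (ltW p0); have bG := wbounded_grad P (ltW p0).
rewrite (wnormE wei bP) (wnormE wei bG).
have IP := ball_int_ge0 wei bP (@subset_refl _ Bd).
have IG := ball_int_ge0 wei bG (@subset_refl _ Bd).
exact: (EFin_div_le (powR_ge0 _ _) (powR_ge0 _ _) c0 (le_powR_root p0 c0 IG IP (h P Pn))).
Qed.

Lemma doubling_Mwor_le (w : euclidean R d -> R) (p : R) : doubling_weight w -> 1 <= p ->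
  exists2 c : R, 0 < c &
    forall n : nat, (0 < n)%N -> (Mwor p w n <= (c * n%:R ^+ 2)%:E)%E.
Proof.
move=> wd p1; have wei : is_weight w by case: wd.
have p0 : 0 < p by rewrite (lt_le_trans ltr01).
have [L L1 dL] := doubling_constant wd.
have L0 : 0 < L by exact: lt_le_trans L1.
have [K LK] := exp2_unbounded (2 * L).
pose C1 : R := 2 * 2 ^+ K * L ^+ 2.
pose co : R := 2 * K.+1%:R * 6 ^+ K * (2 * 3 ^+ K).
pose cg : R := d%:R * (24 * K.+1%:R ^+ 2 * 12 ^+ K) * (2 * 3 ^+ K).
have co0 : 0 <= co by rewrite !mulr_ge0// ?exprn_ge0.
have C10 : 0 <= C1 by rewrite !mulr_ge0// ?exprn_ge0// ltW.
have cg0 : 0 <= cg by rewrite !mulr_ge0// ?exprn_ge0.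
have C1p0 : 0 <= C1 * 2 `^ p by rewrite mulr_ge0 ?powR_ge0.
(* One l serves both conditions: with delta = 2^-l, co delta is at most 1 and its product with C1
   2^p at most 1 / 2. *)
have [l hl] := exp2_unbounded (co * (1 + 2 * (C1 * 2 `^ p))).
have l0 : 0 < 2 ^+ l :> R by rewrite exprn_gt0.
have cC0 : 0 <= co * (C1 * 2 `^ p) by rewrite mulr_ge0.
have lo : co * 2 ^- l <= 1.
  by rewrite ler_pdivrMr// mul1r; lra.
have lC : C1 * 2 `^ p * (co * 2 ^- l) <= 2^-1.
  by rewrite mulrA ler_pdivrMr//; lra.
pose C2 := 2 * C1 * 2 `^ p * L ^+ l.+1 * L ^+ 4.
have C20 : 0 < C2 by rewrite !mulr_gt0 ?exprn_gt0 ?powR_gt0.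
(* [cg] is 0 in dimension 0; adding 1 keeps the constant positive. *)
exists ((cg + 1) * C2 `^ p^-1); first by rewrite mulr_gt0 ?powR_gt0 ?ltr_wpDl.
move=> n n0; apply: Mwor_le => // [|P Pn].
  by rewrite !mulr_ge0 ?powR_ge0 ?addr_ge0 ?exprn_ge0.
have IP := ball_int_ge0 wei (wbounded_peval P (ltW p0)) (@subset_refl _ Bd).
rewrite (le_trans (grad_int_le wd p1 L1 dL LK lo lC n0 Pn))//.
rewrite ler_wpM2r// -/C2 [X in _ <= X `^ p]mulrAC [leRHS]powRM ?mulr_ge0 ?addr_ge0 ?exprn_ge0 ?powR_ge0//.
rewrite -powRrM mulVf ?gt_eqF// powRr1 ?(ltW C20)// ler_wpM2r ?(ltW C20)//.
apply: ge0_ler_powR; rewrite ?nnegrE ?mulr_ge0 ?exprn_ge0 ?addr_ge0 ?(ltW p0)//.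
by rewrite ler_wpM2r ?exprn_ge0// lerDl.
Qed.

End UpperBoundMwor.

(** * Doubling weights: the lower bound *)

Section DegreeBound.
Context {R : realType} {d : nat}.
Implicit Types (P Q : mpoly.mpoly d R) (m n : nat).

Lemma Pi_polyC n (c : R) : Pi_poly n (mpoly.mpolyC d c).
Proof.
move=> m; rewrite mpoly.msuppC; case: eqP => //= _.
by rewrite inE => /eqP ->; rewrite mpoly.mdeg0.
Qed.

Lemma Pi_poly_mvar (i : 'I_d) : Pi_poly 1 (mvar i : mpoly.mpoly d R).
Proof.
by move=> m; rewrite mpoly.msuppX inE => /eqP ->; rewrite mpoly.mdeg1.
Qed.

Lemma Pi_poly_widen m n P : (m <= n)%N -> Pi_poly m P -> Pi_poly n P.
Proof. by move=> mn Pm k /Pm km; exact: leq_trans mn. Qed.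

Lemma Pi_polyD n P Q : Pi_poly n P -> Pi_poly n Q -> Pi_poly n (P + Q).
Proof.
move=> Pn Qn m /mpoly.msuppD_le; rewrite mem_cat => /orP[]; [exact: Pn|exact: Qn].
Qed.

Lemma Pi_polyM m n P Q : Pi_poly m P -> Pi_poly n Q -> Pi_poly (m + n) (P * Q).
Proof.
move=> Pm Qn k /mpoly.msuppM_le /allpairsP[[k1 k2] [/= /Pm h1 /Qn h2 ->]].
by rewrite mpoly.mdegD leq_add.
Qed.

Lemma Pi_polyN n P : Pi_poly n P -> Pi_poly n (- P).
Proof. by move=> Pn m; rewrite (perm_mem (mpoly.msuppN P)); exact: Pn. Qed.

Lemma Pi_polyX n k P : Pi_poly n P -> Pi_poly (k * n) (P ^+ k).
Proof.
move=> Pn; elim: k => [|k IH].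
  by rewrite expr0 -(mpoly.mpolyC1 d); exact: Pi_polyC.
by rewrite exprS mulSn; exact: Pi_polyM.
Qed.

Lemma Pi_poly_sum n (I : Type) (r : seq I) (F : I -> mpoly.mpoly d R) :
  (forall i, Pi_poly n (F i)) -> Pi_poly n (\sum_(i <- r) F i).
Proof.
move=> Fn; elim/big_ind: _ => //; last by move=> ? ?; exact: Pi_polyD.
by rewrite -(mpoly.mpolyC0 d); exact: Pi_polyC.
Qed.

End DegreeBound.

(** * Chebyshev polynomials and the Dirichlet kernel in one coordinate *)

Section ChebyshevPolynomials.
Context {R : realType} {d : nat}.
Variable i0 : 'I_d.
Implicit Types (x : euclidean R d) (m n k : nat).
Local Notation X := (mvar i0 : mpoly.mpoly d R).
Local Notation cst c := (mpoly.mpolyC d (c : R)).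
Local Notation "'D1' P" := (mpoly.mderiv i0 P) (at level 10).

(** Carrying two consecutive polynomials makes the three-term recursion structural. *)
Fixpoint chebyshev_pair k : mpoly.mpoly d R * mpoly.mpoly d R :=
  if k is k'.+1 then
    let: (P, Q) := chebyshev_pair k' in (Q, cst 2 * X * Q - P)
  else (1, X).

Definition chebyshev k := (chebyshev_pair k).1.

Lemma chebyshev0 : chebyshev 0 = 1. Proof. by []. Qed.

Lemma chebyshev1 : chebyshev 1 = X. Proof. by []. Qed.

Lemma chebyshevSS k :
  chebyshev k.+2 = cst 2 * X * chebyshev k.+1 - chebyshev k.
Proof. by rewrite /chebyshev /=; case: (chebyshev_pair k). Qed.

Lemma chebyshev_ind2 (T : nat -> Prop) : T 0%N -> T 1%N ->
  (forall k, T k -> T k.+1 -> T k.+2) -> forall k, T k.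
Proof.
move=> T0 T1 TS k; suff [] : T k /\ T k.+1 by [].
by elim: k => [//|k [IH1 IH2]]; split=> //; exact: TS.
Qed.

Lemma Pi_poly_chebyshev k : Pi_poly k (chebyshev k).
Proof.
elim/chebyshev_ind2: k => [||k IH1 IH2].
- by rewrite chebyshev0 -(mpoly.mpolyC1 d); exact: Pi_polyC.
- exact: Pi_poly_mvar.
- rewrite chebyshevSS; apply: Pi_polyD.
    rewrite -add1n; apply: Pi_polyM => //; rewrite -[1%N]/(0 + 1)%N.
    by apply: Pi_polyM; [exact: Pi_polyC|exact: Pi_poly_mvar].
  by apply: Pi_polyN; apply: (Pi_poly_widen _ IH1); rewrite -addn2 leq_addr.
Qed.

Lemma peval_cst (c : R) x : peval (cst c) x = c.
Proof. exact: mpoly.mevalC. Qed.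

Lemma peval1 x : peval 1 x = 1.
Proof. by rewrite -(mpoly.mpolyC1 d) peval_cst. Qed.

Lemma pevalX x : peval X x = tnth x i0.
Proof. exact: mpoly.mevalXU. Qed.

Lemma pevalD P Q x : peval (P + Q) x = peval P x + peval Q x.
Proof. exact: mpoly.mevalD. Qed.

Lemma pevalN P x : peval (- P) x = - peval P x.
Proof. exact: mpoly.mevalN. Qed.

Lemma pevalM P Q x : peval (P * Q) x = peval P x * peval Q x.
Proof. exact: mpoly.mevalM. Qed.

Lemma pevalXn P k x : peval (P ^+ k) x = peval P x ^+ k.
Proof. by elim: k => [|k IH]; rewrite ?peval1// !exprS pevalM IH. Qed.

Lemma peval_sum (I : Type) (r : seq I) (F : I -> mpoly.mpoly d R) x :
  peval (\sum_(i <- r) F i) x = \sum_(i <- r) peval (F i) x.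
Proof.
elim: r => [|i r IH]; last by rewrite !big_cons pevalD IH.
by rewrite !big_nil; exact: mpoly.meval0.
Qed.

Lemma peval_chebyshev k x (t : R) : tnth x i0 = cos t ->
  peval (chebyshev k) x = cos (k%:R * t).
Proof.
move=> xt; elim/chebyshev_ind2: k => [||k IH1 IH2].
- by rewrite peval1 mul0r cos0.
- by rewrite pevalX mul1r.
- rewrite chebyshevSS pevalD pevalN !pevalM peval_cst pevalX IH1 IH2 xt.
  rewrite (_ : k.+2%:R * t = k.+1%:R * t + t); last by rewrite -[k.+2%:R]natr1; ring.
  rewrite (_ : k%:R * t = k.+1%:R * t - t); last by rewrite -natr1; ring.
  by rewrite cosB cosD; ring.
Qed.

Lemma D1_chebyshevSS k x : peval (D1 (chebyshev k.+2)) x =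
  2 * peval (chebyshev k.+1) x + 2 * tnth x i0 * peval (D1 (chebyshev k.+1)) x -
  peval (D1 (chebyshev k)) x.
Proof.
rewrite chebyshevSS mpoly.mderivB !mpoly.mderivM mpoly.mderivC mderiv_mvar eqxx.
rewrite pevalD pevalN !(pevalD, pevalM) peval_cst pevalX peval1.
by rewrite (_ : peval 0 x = 0); [ring|exact: mpoly.meval0].
Qed.

(** The derivative of T_k (cos t) = cos (k t), obtained from the recursion and kept as a product
    because sin t vanishes at t = 0. *)
Lemma D1_chebyshev_sin k x (t : R) : tnth x i0 = cos t ->
  peval (D1 (chebyshev k)) x * sin t = k%:R * sin (k%:R * t).
Proof.
move=> xt; elim/chebyshev_ind2: k => [||k IH1 IH2].
- rewrite chebyshev0 -(mpoly.mpolyC1 d) mpoly.mderivC (_ : peval 0 x = 0) ?mul0r//.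
  exact: mpoly.meval0.
- by rewrite chebyshev1 mderiv_mvar eqxx peval1 !mul1r.
- rewrite D1_chebyshevSS (peval_chebyshev _ xt) mulrBl mulrDl IH1.
  rewrite [2 * tnth x i0 * _ * _](_ : _ =
      2 * tnth x i0 * (k.+1%:R * sin (k.+1%:R * t))); last by rewrite -IH2; ring.
  rewrite xt.
  rewrite (_ : k.+2%:R * t = k.+1%:R * t + t); last by rewrite -[k.+2%:R]natr1; ring.
  rewrite (_ : sin (k%:R * t) = sin (k.+1%:R * t - t)); last by congr sin; rewrite -natr1; ring.
  by rewrite sinB sinD -[k.+2%:R]natr1 -[k.+1%:R]natr1; ring.
Qed.

Lemma D1_chebyshev_pole k x : tnth x i0 = 1 ->
  peval (D1 (chebyshev k)) x = k%:R ^+ 2.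
Proof.
move=> x1; have xt : tnth x i0 = cos 0 by rewrite cos0.
elim/chebyshev_ind2: k => [||k IH1 IH2].
- rewrite chebyshev0 -(mpoly.mpolyC1 d) mpoly.mderivC expr0n.
  exact: mpoly.meval0.
- by rewrite chebyshev1 mderiv_mvar eqxx peval1 expr1n.
- rewrite D1_chebyshevSS (peval_chebyshev _ xt) mulr0 cos0 IH1 IH2 x1.
  by rewrite -[k.+2%:R]natr1 -[k.+1%:R]natr1; ring.
Qed.

(** For k t <= 1, sin (k t) >= k t / 2 and sin t <= t bound k sin (k t) / sin t below; at t = 0 the
    exact value k^2 is used. *)
Lemma D1_chebyshev_ge k x (t : R) : tnth x i0 = cos t -> 0 <= t ->
  k%:R * t <= 1 -> k%:R ^+ 2 / 2 <= peval (D1 (chebyshev k)) x.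
Proof.
move=> xt; rewrite le_eqVlt => /orP[/eqP t0 _|t0 kt].
  rewrite D1_chebyshev_pole; last by rewrite xt -t0 cos0.
  by have := sqr_ge0 (k%:R : R); lra.
have pi2 := @pi_ge2 R.
case: k kt => [_|k kt].
  rewrite chebyshev0 -(mpoly.mpolyC1 d) mpoly.mderivC (_ : peval 0 x = 0).
    by rewrite expr0n mul0r.
  exact: mpoly.meval0.
have t1 : t <= 1.
  by rewrite (le_trans _ kt)// ler_peMl ?(ltW t0)// ler1n.
have s0 : 0 < sin t by apply: sin_gt0_pi; rewrite t0/=; lra.
rewrite -(ler_pM2r s0) (D1_chebyshev_sin _ xt).
have st : sin t <= t by apply: sin_le_id; rewrite (ltW t0)/=; lra.
have skt : k.+1%:R * t / 2 <= sin (k.+1%:R * t).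
  by apply: sin_ge_half; rewrite mulr_ge0 ?(ltW t0)//=; lra.
rewrite (@le_trans _ _ (k.+1%:R ^+ 2 / 2 * t))//.
  by rewrite ler_wpM2l// divr_ge0// sqr_ge0.
rewrite [leLHS](_ : _ = k.+1%:R * (k.+1%:R * t / 2)); last by field.
by rewrite ler_wpM2l.
Qed.

Definition dirichlet_poly m : mpoly.mpoly d R :=
  cst (2 * m%:R + 1)^-1 * (1 + cst 2 * \sum_(k < m) chebyshev k.+1).

Lemma Pi_poly_dirichlet m : Pi_poly m (dirichlet_poly m).
Proof.
rewrite /dirichlet_poly -[X in Pi_poly X]add0n; apply: Pi_polyM; first exact: Pi_polyC.
apply: Pi_polyD; first by rewrite -(mpoly.mpolyC1 d); exact: Pi_polyC.
rewrite -[X in Pi_poly X]add0n; apply: Pi_polyM; first exact: Pi_polyC.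
apply: Pi_poly_sum => k; exact: (Pi_poly_widen (ltn_ord k) (@Pi_poly_chebyshev k.+1)).
Qed.

Lemma peval_dirichlet m x (t : R) : tnth x i0 = cos t ->
  peval (dirichlet_poly m) x = dirichlet m t.
Proof.
move=> xt; rewrite /dirichlet_poly /dirichlet pevalM pevalD peval1 pevalM !peval_cst.
rewrite peval_sum mulrC; congr ((1 + 2 * _) / _); apply: eq_bigr => k _.
exact: peval_chebyshev.
Qed.

Lemma sum_sqr_ge m : m%:R ^+ 3 / 3 <= \sum_(k < m) k.+1%:R ^+ 2 :> R.
Proof.
elim: m => [|m IH]; first by rewrite big_ord0 expr0n mul0r.
rewrite big_ord_recr/= -natr1.
have := ler0n R m; move: IH; set S := \sum_(_ < _) _; lra.
Qed.

Lemma dirichlet_ge_half m (t : R) : 0 <= t -> m%:R * t <= 1 -> 2^-1 <= dirichlet m t.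
Proof.
move=> t0 mt; have pi2 := @pi_ge2 R.
rewrite /dirichlet ler_pdivlMr; last by rewrite ltr_wpDl// mulr_ge0.
have : m%:R * 2^-1 <= \sum_(k < m) cos (k.+1%:R * t) :> R.
  rewrite mulr_natl -[X in _ *+ X]card_ord -sumr_const; apply: ler_sum => k _.
  have kt : 0 <= k.+1%:R * t <= 1.
    rewrite mulr_ge0//= (le_trans _ mt)// ler_wpM2r// ler_nat.
    exact: ltn_ord.
  have /andP[kt0 kt1] := kt.
  have : 1 - cos (k.+1%:R * t) <= (k.+1%:R * t) ^+ 2 / 2.
    by apply: one_sub_cos_le; rewrite kt0/=; lra.
  have : (k.+1%:R * t) ^+ 2 <= 1 by rewrite expr_le1.
  by lra.
by have := ler0n R m; lra.
Qed.

(** The Chebyshev bounds sum to at least m^3 / 6, and 2 / (2 m + 1) >= 2 / (3 m). *)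
Lemma D1_dirichlet_ge m x (t : R) : tnth x i0 = cos t -> 0 <= t -> (0 < m)%N ->
  m%:R * t <= 1 -> m%:R ^+ 2 / 9 <= peval (D1 (dirichlet_poly m)) x.
Proof.
move=> xt t0 m0 mt.
have m1 : 1 <= m%:R :> R by rewrite ler1n.
have -> : peval (D1 (dirichlet_poly m)) x =
    (2 * m%:R + 1)^-1 * (2 * \sum_(k < m) peval (D1 (chebyshev k.+1)) x).
  rewrite /dirichlet_poly mpoly.mderiv_mulC mpoly.mderivD mpoly.mderiv_mulC.
  rewrite -[X in mpoly.mderiv _ X + _](mpoly.mpolyC1 d) mpoly.mderivC add0r.
  rewrite !pevalM !peval_cst raddf_sum peval_sum.
  by [].
have : \sum_(k < m) k.+1%:R ^+ 2 / 2 <= \sum_(k < m) peval (D1 (chebyshev k.+1)) x.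
  apply: ler_sum => k _; apply: (D1_chebyshev_ge xt t0).
  apply: (le_trans _ mt); apply: ler_wpM2r => //.
  by rewrite ler_nat; exact: ltn_ord.
rewrite -mulr_suml => h; have h3 := sum_sqr_ge m.
rewrite [leRHS]mulrC ler_pdivlMr; last by rewrite ltr_wpDl// mulr_ge0.
have mm : m%:R ^+ 2 <= m%:R ^+ 3 :> R by rewrite [leRHS]exprS ler_peMl// sqr_ge0.
move: h h3; set S1 := \sum_(_ < _) _; set S2 := \sum_(_ < _) _ => h h3.
rewrite (_ : _ * (2 * m%:R + 1) = 2 / 9 * m%:R ^+ 3 + m%:R ^+ 2 / 9); last by field.
by lra.
Qed.

Lemma D1_exp P k x : peval (D1 (P ^+ k.+1)) x =
  k.+1%:R * peval P x ^+ k * peval (D1 P) x.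
Proof.
elim: k => [|k IH]; first by rewrite expr1 expr0 !mul1r.
rewrite exprS mpoly.mderivM pevalD !pevalM IH pevalXn -[k.+2%:R]natr1 exprS; ring.
Qed.

Lemma D1_le_grad P x : `|peval (D1 P) x| <= grad_length P x.
Proof.
rewrite -sqrtr_sqr ler_wsqrtr// (bigD1 i0)//= lerDl.
by apply: sumr_ge0 => i _; exact: sqr_ge0.
Qed.

End ChebyshevPolynomials.

(** For b = 0 the extended quotient is +oo, since a > 0. *)
Lemma EFin_div_ge {R : realType} (a b c : R) :
  0 < a -> 0 <= b -> c * b <= a -> (c%:E <= a%:E / b%:E)%E.
Proof.
move=> a0; rewrite le_eqVlt => /orP[/eqP <-|b0] ab.
  by rewrite inver eqxx gt0_muley ?lte_fin// leey.
by rewrite inver gt_eqF// lee_pdivlMr// -EFinM lee_fin.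
Qed.

(** * A polynomial concentrated at a boundary point *)

Section LowerBound.
Context {R : realType} {d : nat}.
Variables (w : euclidean R d -> R) (p : R).
Hypotheses (wd : doubling_weight w) (p1 : 1 <= p).
Variable i0 : 'I_d.
Local Notation Bd := (@unit_ball R d).
Local Notation mass := (ball_mass w).
Local Notation cap := (@ball_cap R d).
Implicit Types (x y : euclidean R d).

Let wei : is_weight w. Proof. by case: wd. Qed.
Let p0 : 0 < p. Proof. exact: lt_le_trans p1. Qed.
Let one_powRp : 1 `^ p = 1 :> R. Proof. by rewrite powR1. Qed.

Lemma Mwor_ge (c : R) n P : 0 <= c -> P != 0 -> Pi_poly n P ->
  0 < ball_int w (fun x => `|grad_length P x| `^ p) Bd ->
  c `^ p * ball_int w (fun x => `|peval P x| `^ p) Bd <=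
    ball_int w (fun x => `|grad_length P x| `^ p) Bd ->
  (c%:E <= Mwor p w n)%E.
Proof.
move=> c0 P0 Pn IG0 h.
have bP := wbounded_peval P (ltW p0); have bG := wbounded_grad P (ltW p0).
have IP := ball_int_ge0 wei bP (@subset_refl _ Bd).
apply: (le_trans (y := (wnorm p w (grad_length P) / wnorm p w (peval P))%E)); last first.
  by apply: ereal_sup_ubound; exists P.
rewrite (wnormE wei bP) (wnormE wei bG).
exact: (EFin_div_ge (powR_gt0 _ IG0) (powR_ge0 _ _)
  (powR_root_le p0 c0 (ltW IG0) IP h)).
Qed.

Definition pole : euclidean R d := [tuple (i == i0)%:R | i < d].

Lemma dot_pole x : dot pole x = tnth x i0.
Proof.
rewrite /dot (bigD1 i0)//= tnth_mktuple eqxx mul1r big1 ?addr0// => i ii0.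
by rewrite tnth_mktuple (negbTE ii0) mul0r.
Qed.

Lemma unit_ball_pole : Bd pole.
Proof. by apply/unit_ballE; rewrite dot_pole tnth_mktuple eqxx. Qed.

Lemma cos_dist_pole x : Bd x -> tnth x i0 = cos (ball_dist pole x).
Proof.
move=> bx; rewrite cos_ball_dist//; last exact: unit_ball_pole.
have -> : hdot pole x = dot pole x + height pole * height x by exact: hdotE.
have : height pole ^+ 2 = 0.
  by rewrite height_sqr ?dot_pole ?tnth_mktuple ?eqxx ?subrr//; exact: unit_ball_pole.
by move/eqP; rewrite sqrf_eq0 => /eqP ->; rewrite mul0r addr0 dot_pole.
Qed.

(** On the cap of radius 1 / m about the pole the gradient of P is at least g m^2, while the decay
    of the kernel bounds the integral of |P|^p over the ball by a multiple of the mass of that cap.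
    Here m is about n / K, so that P has degree at most n. *)
Lemma doubling_Mwor_ge : exists2 c : R, 0 < c &
  forall n : nat, (0 < n)%N -> ((c * n%:R ^+ 2)%:E <= Mwor p w n)%E.
Proof.
have [L L1 dL] := doubling_constant wd.
have L0 : 0 < L by exact: lt_le_trans L1.
have [N LN] := exp2_unbounded (2 * L).
pose K := N.+1.
have LK : 2 * L <= 2 ^+ K by rewrite (le_trans LN)// exprS ler_peMl ?exprn_ge0// ler1n.
pose C : R := 6 ^+ K * (2 * 2 ^+ K * L ^+ 2).
have C1 : 1 <= C.
  have e k : 1 <= 2 ^+ k :> R by rewrite exprn_ege1// ler1n.
  by rewrite !mulr_ege1 ?exprn_ege1// ?ler1n.
have C0 : 0 < C by exact: lt_le_trans C1.
(* The derivative of D^K is K D^N D', with D >= 1 / 2 and D' >= m^2 / 9 on the cap. *)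
pose g : R := K%:R * 2^-1 ^+ N / 9.
have g0 : 0 < g by rewrite !mulr_gt0// ?exprn_gt0// invr_gt0.
have K0 : 0 < K%:R :> R by rewrite ltr0n.
have K21 : 1 <= 4 * K%:R ^+ 2 :> R.
  by rewrite mulr_ege1 ?exprn_ege1// ler1n.
(* The 4 K^2 comes from n <= 2 K m; the minimum with 1 serves the degrees n < K. *)
pose c : R := Num.min 1 (g / C) / (4 * K%:R ^+ 2).
have c0 : 0 < c.
  by rewrite divr_gt0 ?(lt_le_trans ltr01 K21)// lt_min ltr01 divr_gt0.
have bpole := unit_ball_pole.
exists c => // n n0.
have nR0 : 0 < n%:R :> R by rewrite ltr0n.
have cn0 : 0 <= c * n%:R ^+ 2 by rewrite mulr_ge0 ?exprn_ge0// ltW.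
(* For n < K the quotient n / K is 0. A coordinate function serves instead: its gradient is at least
   1, its values at most 1, and c n^2 <= 1. *)
have [nK|Kn] := ltnP n K.
  have bX := wbounded_peval (mvar i0 : mpoly.mpoly d R) (ltW p0).
  have bG := wbounded_grad (mvar i0 : mpoly.mpoly d R) (ltW p0).
  have gE x : 1 <= `|grad_length (mvar i0) x| `^ p.
    rewrite -[leLHS]one_powRp; apply: ge0_ler_powR; rewrite ?nnegrE ?(ltW p0)//.
    rewrite (le_trans _ (ler_norm _))// (le_trans _ (D1_le_grad i0 _ _))//.
    by rewrite mderiv_mvar eqxx peval1 normr1.
  have mB : measurable (Bd : set (euclidean R d)) by exact: measurable_unit_ball.
  have I1 : mass Bd <= ball_int w (fun x => `|grad_length (mvar i0) x| `^ p) Bd.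
    rewrite ball_mass_int; apply: (ball_int_mono wei (wbounded1 Bd) bG mB (@subset_refl _ _)).
    by move=> x _ /=; exact: gE.
  apply: (@Mwor_ge _ _ (mvar i0)).
  - exact: cn0.
  - apply/eqP => X0; have := pevalX i0 pole; rewrite X0 tnth_mktuple eqxx.
    rewrite (_ : peval 0 pole = 0); last exact: mpoly.meval0.
    by move/eqP; rewrite eq_sym oner_eq0.
  - exact: Pi_poly_widen (@Pi_poly_mvar _ _ i0).
  - exact: lt_le_trans (ball_mass_gt0 wei) I1.
  - rewrite (le_trans _ I1)//.
    rewrite (le_trans _ (_ : 1 * ball_int w (fun x => `|peval (mvar i0) x| `^ p) Bd <= _))//.
      apply: (ler_wpM2r (ball_int_ge0 wei bX (@subset_refl _ _))).
      rewrite -[leRHS]one_powRp; apply: ge0_ler_powR; rewrite ?nnegrE ?(ltW p0) ?cn0//.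
      rewrite /c [leLHS]mulrAC ler_pdivrMr ?(lt_le_trans ltr01 K21)// mul1r.
      rewrite (@le_trans _ _ (1 * n%:R ^+ 2))//.
        by rewrite ler_wpM2r ?exprn_ge0// ge_min lexx.
      rewrite mul1r (@le_trans _ _ (K%:R ^+ 2))//.
        by rewrite lerXn2r ?nnegrE// ler_nat ltnW.
      by rewrite ler_peMl ?exprn_ge0// ler1n.
    rewrite mul1r ball_mass_int; apply: (ball_int_mono wei bX (wbounded1 Bd) mB (@subset_refl _ _)).
    move=> x bx /=; rewrite -[leRHS]one_powRp; apply: ge0_ler_powR; rewrite ?nnegrE ?(ltW p0)//.
    by rewrite pevalX coord_le1.
pose m := (n %/ K)%N.
have m0 : (0 < m)%N by rewrite divn_gt0.
have mR0 : 0 < m%:R :> R by rewrite ltr0n.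
pose r : R := m%:R^-1; have r0 : 0 < r by rewrite invr_gt0.
pose P := dirichlet_poly i0 m ^+ K : mpoly.mpoly d R.
have PE x : Bd x -> peval P x = dirichlet m (ball_dist pole x) ^+ K.
  by move=> bx; rewrite /P pevalXn (peval_dirichlet _ (cos_dist_pole bx)).
have bP := wbounded_peval P (ltW p0); have bG := wbounded_grad P (ltW p0).
have mcap : measurable (cap pole r) by exact: measurable_ball_cap.
have scap : cap pole r `<=` Bd by exact: cap_sub.
have capm : 0 < mass (cap pole r) by exact: (mass_cap_gt0 wd L1 dL).
have lowG : (g * m%:R ^+ 2) `^ p * mass (cap pole r) <=
    ball_int w (fun x => `|grad_length P x| `^ p) Bd.
  have gcst : 0 <= (g * m%:R ^+ 2) `^ p by exact: powR_ge0.
  rewrite -(ball_int_cst wei gcst mcap scap).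
  apply: (@le_trans _ _ (ball_int w (fun x => `|grad_length P x| `^ p) (cap pole r))).
    apply: (ball_int_mono wei (wbounded_cst Bd gcst) bG mcap scap) => x [bx xr] /=.
    have t0 : 0 <= ball_dist pole x by exact: ball_dist_ge0.
    have mt : m%:R * ball_dist pole x <= 1 by rewrite mulrC -ler_pdivlMr// mul1r.
    apply: ge0_ler_powR; rewrite ?nnegrE ?(ltW p0) ?mulr_ge0 ?exprn_ge0 ?(ltW g0)//.
    rewrite (le_trans _ (ler_norm _))// (le_trans _ (D1_le_grad i0 _ _))//.
    rewrite (le_trans _ (ler_norm _))// /P D1_exp (peval_dirichlet _ (cos_dist_pole bx)).
    rewrite (_ : g * _ = K%:R * 2^-1 ^+ N * (m%:R ^+ 2 / 9)); last by rewrite /g; ring.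
    apply: ler_pM.
    - by rewrite mulr_ge0// ?exprn_ge0.
    - by rewrite divr_ge0// ?exprn_ge0.
    - rewrite ler_wpM2l// lerXn2r// ?nnegrE//; last exact: dirichlet_ge_half.
      by rewrite (le_trans _ (dirichlet_ge_half t0 mt)).
    - exact: (D1_dirichlet_ge (cos_dist_pole bx) t0 m0 mt).
  exact: (ball_int_sub wei bG mcap measurable_unit_ball scap (@subset_refl _ _)).
(* On the cap of X_j the decay 3^K (1 + m dist)^-K of the kernel is replaced by its value at the
   centre at the cost of 2^K, whence the 6; |P| <= 1 allows p to be dropped. *)
have upP : ball_int w (fun x => `|peval P x| `^ p) Bd <= C * mass (cap pole r).
  have [k [X [sX covX]]] := net_exists wd L1 dL r0.
  have bX j : Bd (X j) by case: sX.
  have mX j : measurable (cap (X j) r) by exact: measurable_ball_cap.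
  rewrite (le_trans (ball_int_cover wei bP mX (fun j => @cap_sub _ _ (X j) r) covX))//.
  rewrite /C -mulrA (le_trans _ (ler_wpM2l _ (net_kernel_sum wd L1 dL r0 sX LK bpole)))//.
  rewrite mulr_sumr; apply: ler_sum => j _.
  have den0 : 0 < 1 + ball_dist (X j) pole / r.
    by rewrite ltr_wpDr// divr_ge0 ?ball_dist_ge0// ltW.
  have cst0 : 0 <= 6 ^+ K * (1 + ball_dist (X j) pole / r) ^- K.
    by rewrite mulr_ge0 ?invr_ge0 ?exprn_ge0// ltW.
  rewrite mulrCA [leRHS]mulrC -(ball_int_cst wei cst0 (mX j) (@cap_sub _ _ (X j) r)).
  apply: (ball_int_mono wei bP (wbounded_cst Bd cst0) (mX j) (@cap_sub _ _ (X j) r)).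
  move=> x [bx jx] /=.
  have t0 : 0 <= ball_dist pole x by exact: ball_dist_ge0.
  rewrite (le_trans (le_powR_ge1 p1 _))//.
    by rewrite normr_ge0 PE// normrX exprn_ile1// dirichlet_le1.
  rewrite PE// ler_pdivlMr ?exprn_gt0//.
  have tpi : `|ball_dist pole x| <= pi by rewrite ger0_norm// ball_dist_lepi.
  rewrite (_ : 6 = 3 * 2); last by ring.
  rewrite [leRHS]exprMn.
  have h := dirichlet_exp_decay m K tpi.
  rewrite (le_trans _ (ler_wpM2r (exprn_ge0 K (ler0n R 2)) h))//.
  rewrite -mulrA ler_wpM2l// -exprMn lerXn2r ?nnegrE ?(ltW den0) ?mulr_ge0 ?addr_ge0 ?mulr_ge0//.
  rewrite /r invrK ger0_norm//.
  have nj : m%:R * ball_dist (X j) x <= 1 by rewrite mulrC -ler_pdivlMr// mul1r.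
  have t1 := ball_dist_triangle (bX j) bx bpole.
  rewrite [ball_dist x pole]ball_distC in t1.
  have := ler_wpM2l (ltW mR0) t1.
  have : 0 <= m%:R * ball_dist pole x by rewrite mulr_ge0.
  lra.
have gm0 : 0 < g * m%:R ^+ 2 by rewrite mulr_gt0// exprn_gt0.
apply: (@Mwor_ge _ _ P).
- exact: cn0.
- apply/eqP => P0; have := PE pole bpole; rewrite P0 ball_dist_self// dirichlet0 expr1n.
  rewrite (_ : peval 0 pole = 0); last exact: mpoly.meval0.
  by move/eqP; rewrite eq_sym oner_eq0.
- apply: (@Pi_poly_widen _ _ (K * m)); first by rewrite mulnC leq_divM.
  exact: Pi_polyX (@Pi_poly_dirichlet _ _ _ _).
- by rewrite (lt_le_trans _ lowG)// mulr_gt0// powR_gt0.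
- rewrite (le_trans _ lowG)// (le_trans (ler_wpM2l (powR_ge0 _ _) upP))//.
  rewrite mulrA ler_wpM2r ?(ltW capm)//.
  have nm : n%:R <= 2 * K%:R * m%:R :> R.
    rewrite -!natrM ler_nat -mulnA mul2n -addnn mulnC.
    rewrite {1}(divn_eq n K) leq_add2l (leq_trans (ltnW (ltn_pmod _ _)))//.
    by rewrite leq_pmull.
  (* All of C is divided out instead of its p-th root: as C >= 1 and p >= 1, C^(-p) C <= 1. *)
  have cm : c * n%:R ^+ 2 <= g * m%:R ^+ 2 / C.
    rewrite /c [leLHS]mulrAC ler_pdivrMr ?(lt_le_trans ltr01 K21)//.
    rewrite (@le_trans _ _ (g / C * (2 * K%:R * m%:R) ^+ 2))//.
      apply: ler_pM; rewrite ?exprn_ge0 ?le_min ?ler01 ?divr_ge0 ?(ltW g0) ?(ltW C0)//.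
        by rewrite ge_min lexx orbT.
      by rewrite lerXn2r ?nnegrE ?mulr_ge0.
    by rewrite le_eqVlt; apply/orP; left; apply/eqP; ring.
  rewrite (@le_trans _ _ ((g * m%:R ^+ 2 / C) `^ p * C))//.
    rewrite ler_wpM2r ?(ltW C0)//; apply: ge0_ler_powR; rewrite ?nnegrE ?(ltW p0) ?cn0//.
    exact: le_trans cm.
  rewrite powRM ?invr_ge0 ?(ltW C0) ?(ltW gm0)// -mulrA ler_piMr ?powR_ge0//.
  rewrite -ler_pdivlMr// mul1r le_powR_ge1// invr_ge0 (ltW C0)/= invf_le1//.
Qed.

End LowerBound.

(** * Jacobi weights are doubling *)

Section LebesgueDilation.
Context {R : realType}.
Local Notation mR := (measurableTypeR R).
Variable l : R.
Hypothesis l0 : 0 < l.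
Local Open Scope ereal_scope.

Lemma measurable_affine (v : R) :
  measurable_fun [set: mR] (fun x : mR => (l * x + v)%R : mR).
Proof.
exact: measurable_funD.
Qed.

Lemma lebesgue_affine (v : R) (A : set mR) : measurable A ->
  lebesgue_measure A = l%:E * lebesgue_measure ((fun x : mR => (l * x + v)%R : mR) @^-1` A).
Proof.
move=> mA.
pose m' := mscale (NngNum (ltW l0)) (measure_function_pushforward__canonical__measure_function_Measure
  lebesgue_measure (measurable_affine v)).
have := @lebesgue_measure_unique _ m'.
rewrite /m' /mscale/= /pushforward/=; apply => // _ [[a b]] _ <-.
rewrite /pushforward/=.
rewrite [X in _ = _ * lebesgue_measure X](_ : _ = `]((a - v) / l)%R, ((b - v) / l)%R]%classic); last first.
  apply/seteqP; split=> x /=; rewrite !in_itv/= ltr_pdivrMr// ler_pdivlMr// ltrBlDr lerBrDr.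
    by rewrite mulrC.
  by rewrite mulrC.
rewrite !lebesgue_measure_itv/= !lte_fin ltr_pM2r ?invr_gt0// ltrD2r.
case: ifP => _; last by rewrite mule0.
rewrite -!EFinD -EFinM; congr EFin; field.
exact: lt0r_neq0.
Qed.

(** The translation is indexed by naturals, so that in the induction on the dimension the tail of a
    tuple is translated by [v \o succn]. *)
Definition affine_tuple n (v : nat -> R) (t : n.-tuple mR) : n.-tuple mR :=
  [tuple (l * tnth t i + v i)%R | i < n].

Lemma affine_tuple_cons n (v : nat -> R) (z : mR * n.-tuple mR) :
  affine_tuple v (tuple_cons z) =
  tuple_cons ((l * z.1 + v 0%N)%R, affine_tuple (v \o succn) z.2).
Proof.
apply: eq_from_tnth => i; rewrite tnth_mktuple.
have [j ->|->] := unliftP ord0 i; last by rewrite !tnth0.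
by rewrite !tnthS tnth_mktuple.
Qed.

Lemma measurable_affine_tuple n (v : nat -> R) :
  measurable_fun [set: n.-tuple mR] (affine_tuple v).
Proof.
apply/measurable_fun_tnthP => i.
rewrite (_ : _ \o _ = (fun x : mR => (l * x + v i)%R : mR) \o (@tnth n mR ^~ i)).
  exact: measurableT_comp (measurable_affine _) (measurable_tnth _).
by apply/funext => t /=; rewrite tnth_mktuple.
Qed.

(** By uniqueness of the product measure it suffices to compare on rectangles, where the
    one-dimensional case and induction apply. *)
Lemma lebesgue_tuple_affine n (v : nat -> R) (A : set (n.-tuple mR)) : measurable A ->
  lebesgue_tuple R n A = (l ^+ n)%:E * lebesgue_tuple R n (affine_tuple v @^-1` A).
Proof.
elim: n v A => [|n IH] v A mA.
  rewrite expr0 mul1e /= !diracE; congr (_%:R%:E); congr nat_of_bool.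
  by apply/idP/idP => /set_mem At; apply/mem_set; move: At; rewrite /= (tuple0 (affine_tuple _ _)).
pose g (z : mR * n.-tuple mR) : mR * n.-tuple mR :=
  ((l * z.1 + v 0%N)%R : mR, affine_tuple (v \o succn) z.2).
have mg : measurable_fun [set: mR * n.-tuple mR] g.
  apply/measurable_fun_pairP; split.
    exact: (measurableT_comp (measurable_affine _) measurable_fst).
  exact: (measurableT_comp (measurable_affine_tuple _) measurable_snd).
pose m' := mscale (NngNum (exprn_ge0 n.+1 (ltW l0)))
  (measure_function_pushforward__canonical__measure_function_Measure
    (lebesgue_measure \x lebesgue_tuple R n) mg).
have mcA : measurable (@tuple_cons R n @^-1` A).
  by rewrite -[X in measurable X]setTI; exact: measurable_tuple_cons.
have -> : lebesgue_tuple R n.+1 A =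
    (lebesgue_measure \x lebesgue_tuple R n) (@tuple_cons R n @^-1` A) by [].
rewrite (@product_measure_unique _ _ _ _ _ lebesgue_measure (lebesgue_tuple R n) m')//.
  rewrite /m' /mscale/= /pushforward/= /lebesgue_tuple_cons /pushforward.
  congr (_ * product_measure1 _ _ _).
  by apply/seteqP; split=> z /=; rewrite affine_tuple_cons.
move=> B C mB mC; rewrite /m' /mscale/= /pushforward/=.
have mB' : measurable ((fun x : mR => (l * x + v 0%N)%R : mR) @^-1` B).
  by rewrite -[X in measurable X]setTI; exact: measurable_affine.
have mC' : measurable (affine_tuple (v \o succn) @^-1` C).
  by rewrite -[X in measurable X]setTI; exact: measurable_affine_tuple.
transitivity ((l ^+ n.+1)%:E * (lebesgue_measure \x lebesgue_tuple R n)
    (((fun x : mR => (l * x + v 0%N)%R : mR) @^-1` B) `*`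
     (affine_tuple (v \o succn) @^-1` C))); first by [].
rewrite product_measure1E// (lebesgue_affine (v 0%N) mB) (IH (v \o succn) C mC).
by rewrite muleACA -EFinM -exprS.
Qed.

End LebesgueDilation.

(** * Contraction of caps; volume of the ball *)

Section Volume.
Context {R : realType} {d : nat}.
Local Notation Bd := (@unit_ball R d).
Local Notation cap := (@ball_cap R d).
Local Notation mR := (measurableTypeR R).
Local Notation borel := (d.-tuple mR).
Implicit Types (x y z : euclidean R d) (r s : R).

(* Near the boundary [ball_dist] behaves like the square root of the Euclidean
   distance, hence the small ratio. *)
Lemma segpt_contraction x y : Bd x -> Bd y ->
  ball_dist x (segpt x y 64^-1) <= ball_dist x y / 2.
Proof.
move=> bx b_y; set z := segpt x y 64^-1.
have bz : Bd z by apply: unit_ball_segpt => //; lra.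
have dxy := ball_dist_ge0 bx b_y.
rewrite -(@ler_pXn2r _ 2) ?nnegrE ?ball_dist_ge0 ?divr_ge0//.
rewrite (le_trans (ball_dist_le_chord bx bz))//.
have := chord_le_ball_dist bx b_y; rewrite !chord2E sum_sqr_sub_segpt.
set e := \sum_i (tnth x i - tnth y i) ^+ 2.
have e0 : 0 <= e by apply: sumr_ge0 => i _; exact: sqr_ge0.
have := dot_segpt x y 64^-1; rewrite -/z -/e => dz.
have ha := height_sqr bx; have hb := height_sqr b_y; have hc := height_sqr bz.
have a0 := height_ge0 x; have b0 := height_ge0 y; have c0 := height_ge0 z.
move: ha hb hc a0 b0 c0; set a := height x; set b := height y; set c := height z.
move=> ha hb hc a0 b0 c0 h.
(* For the heights: c^2 interpolates a^2 and b^2, plus the concavity term s (1 - s) e at s = 1 /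
   64. *)
have hc2 : c ^+ 2 = a ^+ 2 + (b ^+ 2 - a ^+ 2) / 64 + 63 / 64 ^+ 2 * e.
  by rewrite hc dz ha hb; field.
suff : (a - c) ^+ 2 <= 2 / 64 * ((a - b) ^+ 2 + e).
  have -> : (64^-1 : R) ^+ 2 = 4096^-1 by field.
  have -> : (ball_dist x y / 2) ^+ 2 = ball_dist x y ^+ 2 / 4 by field.
  have := sqr_ge0 (a - b).
  by move: h; set q := (a - b) ^+ 2; set q' := (a - c) ^+ 2; lra.
(* The square root of the ratio 1 / 64 is the 1 / 8 in a - u / 8 <= c <= a + (u + v) / 8; both
   bounds are checked after squaring. *)
pose u := `|a - b|; pose v := Num.sqrt e.
have u0 : 0 <= u by exact: normr_ge0.
have v0 : 0 <= v by exact: sqrtr_ge0.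
have uu : (a - b) ^+ 2 = u ^+ 2 by rewrite real_normK ?num_real.
have vv : e = v ^+ 2 by rewrite sqr_sqrtr.
have ub : b <= a + u by have := ler_norm (b - a); rewrite distrC -/u; lra.
have ub' : a - u <= b by have := ler_norm (a - b); rewrite -/u; lra.
have up : c <= a + (u + v) / 8.
  rewrite -(@ler_pXn2r _ 2) ?nnegrE ?addr_ge0 ?divr_ge0 ?addr_ge0// hc2 vv.
  have : b ^+ 2 <= (a + u) ^+ 2 by rewrite ler_pXn2r ?nnegrE ?addr_ge0.
  have : 0 <= a * u by rewrite mulr_ge0.
  have : 0 <= a * v by rewrite mulr_ge0.
  have : 0 <= u * v by rewrite mulr_ge0.
  have : 0 <= v ^+ 2 by rewrite sqr_ge0.
  have : 0 <= u ^+ 2 by rewrite sqr_ge0.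
  by move=> *; lra.
have low : a - u / 8 <= c.
  have [au|au] := leP (a - u / 8) 0; first exact: le_trans c0.
  rewrite -(@ler_pXn2r _ 2) ?nnegrE ?(ltW au)// hc2.
  have uau : 0 <= (a - u / 8) * u by rewrite mulr_ge0// ltW.
  have : 0 <= v ^+ 2 by rewrite sqr_ge0.
  have [bu|bu] := leP 0 (a - u).
    have : (a - u) ^+ 2 <= b ^+ 2 by rewrite ler_pXn2r ?nnegrE.
    have : 0 <= u ^+ 2 by rewrite sqr_ge0.
    by rewrite vv; move=> *; lra.
  have : 0 <= b ^+ 2 by rewrite sqr_ge0.
  have : 0 <= a ^+ 2 by rewrite sqr_ge0.
  have : a ^+ 2 <= a * u by rewrite expr2 ler_wpM2l// ltW; lra.
  by rewrite vv; move=> *; lra.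
have : `|a - c| <= (u + v) / 8.
  by rewrite ler_norml; apply/andP; split; lra.
rewrite -(@ler_pXn2r _ 2) ?nnegrE ?divr_ge0 ?addr_ge0// real_normK ?num_real//.
rewrite uu vv => k; rewrite (le_trans k)//.
by have := sqr_ge0 (u - v); lra.
Qed.

(** Volume is treated as the mass of a constant weight, so that the lemmas on weights apply to
    it. *)
Definition one (_ : euclidean R d) : R := 1.

Definition vol (A : set (euclidean R d)) : R := ball_mass one A.

Lemma lebesgue_ball_lty : (@lebesgue R d Bd < +oo)%E.
Proof.
pose A (i : nat) : set mR := `[(-1)%R, 1%R]%classic.
have mA i : measurable (A i) by exact: measurable_itv.
have BA : (Bd : set borel) `<=` [set t | forall i : 'I_d, A i (tnth t i)].
  move=> t bt i /=; rewrite /A/= in_itv/= -ler_norml; exact: coord_le1.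
have mbox : measurable [set t : borel | forall i : 'I_d, A i (tnth t i)].
  rewrite (_ : [set _ | _] = \bigcap_(i in [set: 'I_d])
    ([set: borel] `&` (fun t => tnth t i) @^-1` A i)).
    by apply: fin_bigcap_measurable => // i _; exact: measurable_tnth.
  by apply/seteqP; split=> t /= h i; [split=> //; exact: h|case: (h i)].
rewrite (lebesgue_borel borel_unit_ball).
apply: (@le_lt_trans _ _ (lebesgue_tuple R d [set t | forall i : 'I_d, A i (tnth t i)])).
  by apply: le_measure; rewrite ?inE//; exact: borel_unit_ball.
rewrite (@lebesgue_tuple_box R d A mA).
rewrite (eq_bigr (fun=> 2%:E)) => [|i _]; last first.
  rewrite /A lebesgue_measure_itv/= lte_fin (_ : (-1 < 1 :> R) = true); last by lra.
  by rewrite -EFinB opprK.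
by rewrite prodEFin ltry.
Qed.

Lemma lebesgue_ball_gt0 : (0 < d)%N -> (0 < @lebesgue R d Bd)%E.
Proof.
move=> d0; have dR : 0 < d%:R :> R by rewrite ltr0n.
pose A (i : nat) : set mR := `[0%R, (d%:R^-1)%R]%classic.
have mA i : measurable (A i) by exact: measurable_itv.
have BA : [set t | forall i : 'I_d, A i (tnth t i)] `<=` (Bd : set borel).
  move=> t /= At; apply/unit_ballE; rewrite /dot.
  apply: (@le_trans _ _ (\sum_(i < d) d%:R^-1)).
    apply: ler_sum => i _; have := At i; rewrite /A/= in_itv/= => /andP[t0 t1].
    rewrite (le_trans (ler_wpM2l t0 t1))// ler_piMl ?invr_ge0// (le_trans t1)//.
    by rewrite invf_le1// ler1n.
  by rewrite sumr_const card_ord -[leLHS]mulr_natl divff// gt_eqF.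
have mbox : measurable [set t : borel | forall i : 'I_d, A i (tnth t i)].
  rewrite (_ : [set _ | _] = \bigcap_(i in [set: 'I_d])
    ([set: borel] `&` (fun t => tnth t i) @^-1` A i)).
    by apply: fin_bigcap_measurable => // i _; exact: measurable_tnth.
  by apply/seteqP; split=> t /= h i; [split=> //; exact: h|case: (h i)].
rewrite (lebesgue_borel borel_unit_ball).
apply: (@lt_le_trans _ _ (lebesgue_tuple R d [set t | forall i : 'I_d, A i (tnth t i)])); last first.
  by apply: le_measure; rewrite ?inE//; exact: borel_unit_ball.
rewrite (@lebesgue_tuple_box R d A mA).
rewrite (eq_bigr (fun=> (d%:R^-1)%:E)) => [|i _]; last first.
  by rewrite /A lebesgue_measure_itv/= lte_fin invr_gt0 dR sube0.
by rewrite prodEFin lte_fin prodr_gt0// => i _; rewrite invr_gt0.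
Qed.

Hypothesis d0 : (0 < d)%N.

Lemma one_weight : is_weight one.
Proof.
have mB : measurable (Bd : set (euclidean R d)) by exact: measurable_unit_ball.
have int1 : (\int[@lebesgue R d]_(x in Bd) `|(one x)%:E| = @lebesgue R d Bd)%E.
  rewrite (eq_integral (cst 1%E)) => [|x _]; last by rewrite /= normr1.
  by rewrite (integral_cst _ mB) mul1e.
have m1 : measurable_fun Bd (EFin \o one) by apply/measurable_EFinP; exact: measurable_cst.
split=> // [|h].
  by apply/integrableP; split=> //; rewrite int1 lebesgue_ball_lty.
have : (\int[@lebesgue R d]_(x in Bd) `|(one x)%:E| = 0)%E.
  apply/(ae_eq_integral_abs _ mB m1); apply: filterS h => x h bx.
  by rewrite /= (h bx).
by rewrite int1 => v0; have := lebesgue_ball_gt0 d0; rewrite v0 ltxx.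
Qed.

Lemma volE (A : set (euclidean R d)) : measurable A -> A `<=` Bd ->
  @lebesgue R d A = (vol A)%:E.
Proof.
move=> mA AB; rewrite -(ball_massE one_weight mA AB) /wmeasure.
by rewrite (eq_integral (cst 1%E))// integral_cst// mul1e.
Qed.

End Volume.

(** * Volume of caps and of shells at the boundary *)

Section VolumeOfCaps.
Context {R : realType} {d : nat}.
Hypothesis d0 : (0 < d)%N.
Local Notation Bd := (@unit_ball R d).
Local Notation cap := (@ball_cap R d).
Local Notation mR := (measurableTypeR R).
Local Notation borel := (d.-tuple mR).
Local Notation vol := (@vol R d).
Implicit Types (x y z : euclidean R d) (r s : R).

Let one_w : is_weight (@one R d). Proof. exact: one_weight. Qed.

Lemma vol_ge0 (A : set (euclidean R d)) : A `<=` Bd -> 0 <= vol A.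
Proof. exact: ball_mass_ge0. Qed.

Lemma vol_le (A B : set (euclidean R d)) : measurable A -> measurable B ->
  A `<=` B -> B `<=` Bd -> vol A <= vol B.
Proof. exact: ball_mass_le. Qed.

Lemma vol_affine_le (l : R) (v : nat -> R) (A B : set borel) : 0 < l ->
  measurable A -> measurable B -> (A : set (euclidean R d)) `<=` Bd ->
  (B : set (euclidean R d)) `<=` Bd ->
  (forall t, A t -> B (affine_tuple l v t)) -> l ^+ d * vol A <= vol B.
Proof.
move=> l0 mA mB Ab Bb AB; rewrite -lee_fin EFinM.
have mA' : measurable (A : set (euclidean R d)) by exact: borel_measurable.
have mB' : measurable (B : set (euclidean R d)) by exact: borel_measurable.
rewrite -(volE d0 mA' Ab) -(volE d0 mB' Bb) (lebesgue_borel mA) (lebesgue_borel mB).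
rewrite (lebesgue_tuple_affine l0 v mB) lee_wpmul2l ?lee_fin ?exprn_ge0 ?(ltW l0)//.
apply: le_measure; rewrite ?inE//.
by rewrite -[X in measurable X]setTI; exact: measurable_affine_tuple.
Qed.

(** The homothety of ratio 1 / 64 centred at x carries the cap of radius 2 r into that of radius
    r. *)
Lemma vol_doubling x r : Bd x -> 0 < r -> vol (cap x (2 * r)) <= 64 ^+ d * vol (cap x r).
Proof.
move=> bx r0.
have l0 : 0 < 64^-1 :> R by rewrite invr_gt0.
have h : (64^-1) ^+ d * vol (cap x (2 * r)) <= vol (cap x r).
  pose v i := nth 0 x i - 64^-1 * nth 0 x i.
  apply: (@vol_affine_le 64^-1 v) => //.
  - exact: borel_ball_cap.
  - exact: borel_ball_cap.
  - exact: cap_sub.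
  - exact: cap_sub.
  - move=> y [b_y yr].
    have -> : affine_tuple 64^-1 v y = segpt x y 64^-1.
      by apply: eq_from_tnth => i; rewrite !tnth_mktuple /v (tnth_nth 0 x); ring.
    split; first by apply: unit_ball_segpt => //; lra.
    by rewrite (le_trans (segpt_contraction bx b_y))//; lra.
by rewrite -ler_pdivrMl ?exprn_gt0// -exprVn.
Qed.

Lemma bernoulli_le (t : R) j : 0 <= t <= 1 -> 1 - j%:R * t <= (1 - t) ^+ j.
Proof.
move=> /andP[t0 t1]; elim: j => [|j IH]; first by rewrite mul0r subr0 expr0.
rewrite exprSr -natr1 (le_trans _ (ler_wpM2r _ IH)) ?subr_ge0//.
have : 0 <= j%:R * (t * t) by rewrite !mulr_ge0.
by lra.
Qed.

Definition shell x r s : set (euclidean R d) :=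
  cap x r `&` [set y | height y <= s].

Lemma borel_shell x r s : Bd x -> measurable (shell x r s : set borel).
Proof.
move=> bx; apply: measurableI; first exact: borel_ball_cap.
by apply: borel_sublevel => //; exact: borel_height.
Qed.

Lemma shell_sub x r s : shell x r s `<=` Bd.
Proof. by move=> y [[]]. Qed.

Lemma measurable_shell x r s : Bd x -> measurable (shell x r s).
Proof. by move=> bx; exact: borel_measurable (borel_shell _ _ bx). Qed.

Definition origin : euclidean R d := [tuple 0 | i < d].

Lemma unit_ball_origin : Bd origin.
Proof.
by apply/unit_ballE; rewrite /dot big1// => i _; rewrite tnth_mktuple mulr0.
Qed.

(* The dilates of a thin shell by the powers of 1 - s^2 are disjoint, and about
   (r / s)^2 of them fit in the cap of twice the radius. *)
Lemma shell_dilates x r s (J : nat) : Bd x -> 0 < r -> 0 < s -> s < 1 ->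
  J%:R * s ^+ 2 <= 1 / 2 -> 40 * (J%:R * s ^+ 2) <= r ^+ 2 ->
  J%:R * (2^-1 ^+ d * vol (shell x r s)) <= vol (cap x (2 * r)).
Proof.
move=> bx r0 s0 s1 J2 Jr; set E := shell x r s.
pose q : R := 1 - s ^+ 2.
have s2 : 0 < s ^+ 2 by rewrite exprn_gt0.
have s21 : s ^+ 2 < 1 by rewrite expr_lt1// ltW.
have q0 : 0 < q by rewrite subr_gt0.
have q1 : q < 1 by rewrite /q; lra.
have qj (j : nat) : 0 < q ^+ j by rewrite exprn_gt0.
have qb (j : 'I_J) : 1 - J%:R * s ^+ 2 <= q ^+ j.
  rewrite (le_trans _ (bernoulli_le j _))//; last by rewrite (ltW s2) (ltW s21).
  by rewrite lerD2l lerN2 ler_wpM2r ?(ltW s2)// ler_nat ltnW.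
pose D (j : 'I_J) : set borel := affine_tuple (q ^- j) (fun=> 0) @^-1` E.
have mE : measurable (E : set borel) by exact: borel_shell.
have mD j : measurable (D j).
  by rewrite -[X in measurable X]setTI; exact: measurable_affine_tuple.
have mD' j : measurable (D j : set (euclidean R d)) by exact: borel_measurable.
have scaleE (j : nat) (z : borel) : z = affine_tuple (q ^+ j) (fun=> 0) (affine_tuple (q ^- j) (fun=> 0) z).
  apply: eq_from_tnth => i; rewrite !tnth_mktuple !addr0 mulrA divff ?mul1r// gt_eqF//.
have b2r : cap x (2 * r) `<=` Bd by exact: cap_sub.
have Dcap j : (D j : set (euclidean R d)) `<=` cap x (2 * r).
  (* A point of the dilate lies on the segment from y to the origin at parameter 1 - q^j <= J s^2,
     so [segpt_dist] and 40 J s^2 <= r^2 keep it within r of y. *)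
  move=> z; rewrite /D /=; set y := affine_tuple (q ^- j) _ z => -[[b_y xy] _].
  have zE : z = segpt y origin (1 - q ^+ j).
    rewrite [LHS](scaleE j); apply: eq_from_tnth => i.
    by rewrite -/y !tnth_mktuple; ring.
  have qj01 : 0 <= 1 - q ^+ j <= 1.
    by rewrite subr_ge0 exprn_ile1 ?(ltW q0) ?(ltW q1)//= gerBl (ltW (qj j)).
  have bz : Bd z by rewrite zE; exact: unit_ball_segpt unit_ball_origin _.
  split=> //; rewrite (le_trans (ball_dist_triangle bx b_y bz))//.
  suff : ball_dist y z <= r by move: xy; lra.
  rewrite -(@ler_pXn2r _ 2) ?nnegrE ?ball_dist_ge0 ?(ltW r0)// zE.
  rewrite (le_trans (segpt_dist b_y unit_ball_origin qj01))// (le_trans _ Jr)//.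
  by rewrite ler_pM2l//; have := qb j; lra.
have Db j : (D j : set (euclidean R d)) `<=` Bd by exact: subset_trans (Dcap j) b2r.
have volD j : 2^-1 ^+ d * vol E <= vol (D j).
  have : (q ^+ j) ^+ d * vol E <= vol (D j).
    apply: (vol_affine_le (v := fun=> 0)) => //; first exact: shell_sub.
    move=> t Et; rewrite /D /=.
    suff -> : affine_tuple (q ^- j) (fun=> 0) (affine_tuple (q ^+ j) (fun=> 0) t) = t by [].
    apply: eq_from_tnth => i; rewrite !tnth_mktuple !addr0 mulrA mulVf ?mul1r// gt_eqF//.
  apply: le_trans; rewrite ler_wpM2r ?vol_ge0//; first exact: shell_sub.
  rewrite lerXn2r// ?nnegrE ?(ltW (qj _))//.
  by have := qb j; move: J2; rewrite div1r; lra.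
have disj y : \sum_j (\1_(D j) y : R) <= 1.
  have [[j0 Dj0]|no] := pselect (exists j, D j y); last first.
    by rewrite big1// => j _; rewrite indicE memNset// => Dj; apply: no; exists j.
  (* A point in two dilates would give u = q^(k - j) u', hence |u|^2 <= q^2 < q = 1 - s^2, against
     height u <= s. *)
  have lt_absurd (j k : 'I_J) : (j < k)%N -> D j y -> D k y -> False.
    move=> jk; rewrite /D /=.
    set u := affine_tuple (q ^- j) _ y; set u' := affine_tuple (q ^- k) _ y.
    move=> -[[bu _] hu] [[bu' _] _].
    have uE : dot u u = (q ^+ (k - j)) ^+ 2 * dot u' u'.
      rewrite /dot mulr_sumr; apply: eq_bigr => i _.
      rewrite !tnth_mktuple !addr0.
      rewrite (_ : q ^- j = q ^+ (k - j) * q ^- k); first by ring.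
      have -> : q ^+ k = q ^+ (k - j) * q ^+ j by rewrite -exprD subnK// ltnW.
      by rewrite invfM mulrA divff ?mul1r// gt_eqF.
    have h1 : height u ^+ 2 <= s ^+ 2 by rewrite ler_pXn2r ?nnegrE ?height_ge0 ?(ltW s0).
    rewrite height_sqr// uE in h1.
    have h2 : (q ^+ (k - j)) ^+ 2 * dot u' u' <= q ^+ 2.
      move/unit_ballE : bu' => bu'.
      have w0 : 0 <= (q ^+ (k - j)) ^+ 2 by rewrite exprn_ge0// ltW.
      rewrite (le_trans (ler_wpM2l w0 bu'))// mulr1.
      rewrite ler_pXn2r ?nnegrE ?(ltW (qj _)) ?(ltW q0)//.
      have : (0 < k - j)%N by rewrite subn_gt0.
      case: (k - j)%N => // i _; rewrite exprS ler_piMr ?(ltW q0)//.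
      by rewrite exprn_ile1 ?(ltW q0) ?(ltW q1).
    have : q ^+ 2 < q by rewrite expr2 gtr_pMl.
    by rewrite /q in h1 h2 *; lra.
  rewrite (bigD1 j0)//= big1 ?addr0; first by rewrite indicE lern1 leq_b1.
  move=> j jj0; rewrite indicE memNset// => Dj.
  have := jj0; rewrite -(inj_eq val_inj)/= neq_ltn => /orP[h|h].
    exact: lt_absurd h Dj Dj0.
  exact: lt_absurd h Dj0 Dj.
have -> : J%:R * (2^-1 ^+ d * vol E) = \sum_(j < J) (2^-1 ^+ d * vol E).
  by rewrite sumr_const card_ord mulr_natl.
rewrite (le_trans (ler_sum _ (fun j _ => volD j)))//.
rewrite /vol (eq_bigr _ (fun j _ => ball_mass_int (@one R d) (D j))) ball_mass_int -[leRHS]mul1r.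
apply: (ball_int_overlap one_w (wbounded1 Bd) mD' (measurable_ball_cap (2 * r) bx) b2r) => //.
Qed.

(** Take J about (r / 8)^2 / s^2 dilates; r <= 4 gives J s^2 <= 1 / 4. For s > r / 8 the right-hand
    side already exceeds the volume of the whole cap. The quadratic gain is what makes negative
    powers of the height summable over layers. *)
Lemma vol_shell x r s : Bd x -> 0 < r -> r <= 4 -> 0 < s ->
  vol (shell x r s) <= 128 * 128 ^+ d * (s / r) ^+ 2 * vol (cap x r).
Proof.
move=> bx r0 r4 s0.
have vc : 0 <= vol (cap x r) by apply: vol_ge0; exact: cap_sub.
have mc : measurable (cap x r) by exact: measurable_ball_cap.
have [sr|sr] := leP s (r / 8); last first.
  apply: (@le_trans _ _ (vol (cap x r))).
    by apply: vol_le; [exact: measurable_shell|exact: mc|exact: subIsetl|exact: cap_sub].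
  rewrite ler_peMl// (@le_trans _ _ (128 * 1 * (1 / 8) ^+ 2))//.
    by rewrite mulr1 expr_div_n expr1n; lra.
  rewrite ler_pM ?exprn_ge0//; last first.
    by rewrite lerXn2r ?nnegrE ?divr_ge0 ?(ltW s0) ?(ltW r0)// ler_pdivlMr//; lra.
  by rewrite ler_wpM2l// exprn_ege1// ler1n.
pose t := (r / 8) ^+ 2 / s ^+ 2; pose J := Num.truncn t.
have s20 : 0 < s ^+ 2 by rewrite exprn_gt0.
have t1 : 1 <= t.
  by rewrite ler_pdivlMr// mul1r lerXn2r ?nnegrE ?divr_ge0 ?(ltW s0) ?(ltW r0).
have t0 : 0 <= t by rewrite (le_trans ler01).
have /andP[Jt tJ] := truncn_itv t0.
have J1 : 1 <= J%:R :> R.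
  rewrite ler1n lt0n; apply/negP => /eqP J0; move: tJ; rewrite -/J J0.
  by rewrite ltNge t1.
have Js : J%:R * s ^+ 2 <= (r / 8) ^+ 2 by rewrite -ler_pdivlMr.
have r2 : (r / 8) ^+ 2 = r ^+ 2 / 64 by field.
have r16 : r ^+ 2 <= 16.
  by rewrite (_ : 16 = 4 ^+ 2); [rewrite lerXn2r ?nnegrE ?(ltW r0)|ring].
have s1 : s < 1 by lra.
have rr0 : 0 <= r ^+ 2 by rewrite sqr_ge0.
have := @shell_dilates x r s J bx r0 s0 s1.
have c1 : J%:R * s ^+ 2 <= 1 / 2 by lra.
have c2 : 40 * (J%:R * s ^+ 2) <= r ^+ 2 by lra.
move=> /(_ c1 c2) h1; have h2 := le_trans h1 (vol_doubling bx r0).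
have v0 : 0 <= vol (shell x r s) by apply: vol_ge0; exact: shell_sub.
have tJ2 : t <= 2 * J%:R by move: tJ; rewrite -natr1 -/J; lra.
have h3 : t * (2^-1 ^+ d * vol (shell x r s)) <= 2 * (64 ^+ d * vol (cap x r)).
  rewrite (le_trans (ler_wpM2r _ tJ2)) ?mulr_ge0 ?exprn_ge0 ?invr_ge0//.
  by rewrite -mulrA ler_pM2l.
have e1 : vol (shell x r s) = 2 ^+ d * 64 * (s / r) ^+ 2 * (t * (2^-1 ^+ d * vol (shell x r s))).
  rewrite /t exprVn; field.
  by rewrite !gt_eqF ?exprn_gt0.
rewrite e1 (le_trans (ler_wpM2l _ h3)) ?mulr_ge0 ?exprn_ge0 ?mulr_ge0 ?invr_ge0 ?(ltW s0) ?(ltW r0)//.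
rewrite (_ : 128 = 2 * 64 :> R); last by ring.
by rewrite [(2 * 64) ^+ d]exprMn le_eqVlt; apply/orP; left; apply/eqP; ring.
Qed.

End VolumeOfCaps.

Section IntegralBounds.
Context {disp} {T : measurableType disp} {R : realType}.
Variables (mu : {measure set T -> \bar R}) (A : set T) (f : T -> R).
Hypotheses (mA : measurable A) (mf : measurable_fun A f) (f0 : forall x, A x -> 0 <= f x).

Let mef : measurable_fun A (EFin \o f). Proof. exact/measurable_EFinP. Qed.

Lemma integral_le_cst (M v : R) : (mu A <= v%:E)%E -> 0 <= M ->
  (forall x, A x -> f x <= M) -> (\int[mu]_(x in A) (f x)%:E <= (M * v)%:E)%E.
Proof.
move=> muA M0 fM.
apply: (@le_trans _ _ (\int[mu]_(x in A) (cst M%:E x))%E).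
  apply: ge0_le_integral => //.
by rewrite integral_cst// EFinM lee_wpmul2l// lee_fin.
Qed.

Lemma integral_ge_cst (B : set T) (M v : R) : measurable B -> B `<=` A ->
  (v%:E <= mu B)%E -> 0 <= M ->
  (forall x, B x -> M <= f x) -> ((M * v)%:E <= \int[mu]_(x in A) (f x)%:E)%E.
Proof.
move=> mB BA muB M0 fM.
apply: (@le_trans _ _ (\int[mu]_(x in B) (f x)%:E)%E); last first.
  by apply: ge0_subset_integral.
apply: (@le_trans _ _ (\int[mu]_(x in B) (cst M%:E x))%E).
  by rewrite integral_cst// EFinM lee_wpmul2l// lee_fin.
apply: ge0_le_integral => //.
exact: (measurable_funS mA BA mef).
Qed.

(** One dominating layer at each point suffices: it is a term of the nonnegative series of all
    layers, which is integrated termwise. *)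
Lemma integral_le_layers (c m : nat -> R) (E : nat -> set T) (B : R) :
  (forall k, 0 <= c k) -> (forall k, measurable (E k)) -> (forall k, E k `<=` A) ->
  (forall k, (mu (E k) <= (m k)%:E)%E) ->
  (forall x, A x -> exists k, f x <= c k * \1_(E k) x) ->
  (forall n, \sum_(k < n) c k * m k <= B) ->
  (\int[mu]_(x in A) (f x)%:E <= B%:E)%E.
Proof.
move=> c0 mE EA muE fE sB.
pose g k x : \bar R := (c k * \1_(E k) x)%:E.
have g0 k x : (0 <= g k x)%E by rewrite lee_fin mulr_ge0.
have mg k : measurable_fun A (g k).
  apply/measurable_EFinP; apply: measurable_funM => //.
apply: (@le_trans _ _ (\int[mu]_(x in A) (\sum_(k <oo) g k x))%E).
  apply: ge0_le_integral => //.
    by apply: ge0_emeasurable_sum => // k x _.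
  move=> x Ax; have [k fk] := fE x Ax.
  apply: (@le_trans _ _ (\sum_(0 <= i < k.+1) g i x)%E); last first.
    by apply: nneseries_lim_ge => i _ _.
  rewrite big_nat_recr//= -[leLHS]add0e leeD//.
  by apply: sume_ge0 => i _.
rewrite integral_nneseries//.
apply: lime_le.
  apply: is_cvg_nneseries => k _ _; apply: integral_ge0 => x _; exact: g0.
apply: nearW => n; rewrite big_mkord.
apply: (@le_trans _ _ (\sum_(k < n) (c k * m k)%:E)%E); last by rewrite sumEFin lee_fin.
apply: lee_sum => k _; rewrite /g.
under eq_integral do rewrite EFinM.
rewrite ge0_integralZl_EFin//.
  rewrite integral_indic// EFinM lee_wpmul2l ?lee_fin// (setIidl (@EA k)).
  exact: muE.
by apply/measurable_EFinP.
Qed.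

End IntegralBounds.

Lemma powR_between {R : realType} (e c t h : R) : 0 < c <= 1 -> 0 < t ->
  c * t <= h <= t ->
  Num.min 1 (c `^ e) * t `^ e <= h `^ e <= Num.max 1 (c `^ e) * t `^ e.
Proof.
move=> /andP[c0 c1] t0 /andP[ch ht].
have ct0 : 0 < c * t by rewrite mulr_gt0.
have h0 : 0 < h by exact: lt_le_trans ch.
have mono s : 0 <= s -> (c * t) `^ s <= h `^ s <= t `^ s.
  by move=> s0; rewrite !ge0_ler_powR// ?nnegrE// ltW.
have te : 0 <= t `^ e by exact: powR_ge0.
suff : c `^ e * t `^ e <= h `^ e <= t `^ e \/ t `^ e <= h `^ e <= c `^ e * t `^ e.
  move=> [|] /andP[h1 h2]; apply/andP; split.
  - by rewrite (le_trans _ h1)// ler_wpM2r// ge_min lexx orbT.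
  - by rewrite (le_trans h2)// ler_peMl// le_max lexx.
  - by rewrite (le_trans _ h1)// ler_piMl// ge_min lexx.
  - by rewrite (le_trans h2)// ler_wpM2r// le_max lexx orbT.
have [e0|e0] := leP 0 e.
  by left; have := mono e e0; rewrite powRM ?(ltW c0) ?(ltW t0).
right; have := mono (- e); rewrite oppr_ge0 (ltW e0) => /(_ isT) /andP[h1 h2].
rewrite -powRM ?(ltW c0) ?(ltW t0)//.
rewrite -[e]opprK !(powRN _ (- e)).
by apply/andP; split; rewrite lef_pV2 ?posrE ?powR_gt0.
Qed.

(** * Mass of caps for the Jacobi weight *)

Section JacobiWeight.
Context {R : realType} {d : nat}.
Hypothesis d0 : (0 < d)%N.
Variable mu : R.
Hypothesis mu0 : 0 <= mu.
Local Notation Bd := (@unit_ball R d).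
Local Notation cap := (@ball_cap R d).
Local Notation vol := (@vol R d).
Local Notation w := (@jacobi_weight R d mu).
Local Notation leb := (@lebesgue R d).
(** The exponent of the squared height: negative for mu < 1 / 2, and at least -1 / 2 by mu >= 0. *)
Let e : R := mu - 2^-1.
Let Cs : R := 128 * 128 ^+ d.
Implicit Types (x y : euclidean R d).

Lemma jacobiE y : Bd y -> w y = (height y ^+ 2) `^ e.
Proof. by move=> b_y; rewrite /jacobi_weight height_sqr// enorm_sqr. Qed.

Lemma jacobi_ge0 y : 0 <= w y.
Proof. exact: powR_ge0. Qed.

Lemma measurable_jacobi : measurable_fun [set: euclidean R d] w.
Proof.
apply: (measurableT_comp (f := @powR R ^~ e)); first exact: measurable_powR.
apply: borel_measurable_fun; apply: measurable_funB => //.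
rewrite (_ : (fun x => _) = fun x => @dot R d x x); first exact: borel_dot_self.
by apply/funext => x; rewrite enorm_sqr.
Qed.

(** Chosen so that Cs eta^2 = eta / 2: the shell of height eta r takes at most half of the volume of
    the cap. *)
Let eta : R := (2 * Cs)^-1.

Let Cs1 : 1 <= Cs.
Proof. by rewrite mulr_ege1// ?exprn_ege1// ler1n. Qed.

Let eta0 : 0 < eta.
Proof. by rewrite invr_gt0 mulr_gt0// (lt_le_trans ltr01 Cs1). Qed.

Let eta1 : eta <= 1.
Proof. by rewrite invf_le1 ?mulr_gt0 ?(lt_le_trans ltr01 Cs1)//; move: Cs1; lra. Qed.

Lemma height_cap_le x y r : Bd x -> cap x r y -> height y <= height x + r.
Proof.
move=> bx [b_y xy]; have := height_dist bx b_y.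
by rewrite ler_norml => /andP[h _]; move: xy h; lra.
Qed.

Lemma height_cap_ge x y r : Bd x -> cap x r y -> height x - r <= height y.
Proof.
move=> bx [b_y xy]; have := height_dist bx b_y.
by rewrite ler_norml => /andP[_ h]; move: xy h; lra.
Qed.

Definition core x r : set (euclidean R d) :=
  cap x r `&` [set y | eta / 3 * (height x + r) <= height y].

Lemma measurable_core x r : Bd x -> measurable (core x r).
Proof.
move=> bx; apply: borel_measurable; apply: measurableI; first exact: borel_ball_cap.
by apply: borel_sublevel => //; exact: borel_height.
Qed.

Lemma core_sub x r : core x r `<=` cap x r. Proof. exact: subIsetl. Qed.

(** If height x >= 2 r, heights on the cap are at least height x - r >= (height x + r) / 3, and the
    core is the whole cap. Otherwise height x + r < 3 r, and what is missing lies in the shell of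
    height eta r. *)
Lemma vol_core x r : Bd x -> 0 < r -> r <= 4 ->
  (((2^-1 * vol (cap x r))%:E <= leb (core x r))%E).
Proof.
move=> bx r0 r4; have a0 := height_ge0 x.
have mC := measurable_core r bx.
have mcap : measurable (cap x r) by exact: measurable_ball_cap.
have Cb : core x r `<=` Bd by exact: subset_trans (@core_sub x r) (@cap_sub _ _ x r).
have vc : 0 <= vol (cap x r) by exact: (vol_ge0 d0 (@cap_sub _ _ x r)).
rewrite (volE d0 mC Cb) lee_fin.
have [ar|ar] := leP (2 * r) (height x).
  rewrite (_ : core x r = cap x r); first lra.
  apply/seteqP; split; first exact: core_sub.
  move=> y cy; split=> //=; have := height_cap_ge bx cy.
  have : eta / 3 * (height x + r) <= 3^-1 * (height x + r).
    by rewrite ler_wpM2r ?addr_ge0 ?(ltW r0)//; move: eta1; lra.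
  by lra.
have sx : 0 < eta * r by rewrite mulr_gt0.
have := vol_shell d0 bx r0 r4 sx; rewrite -/Cs mulfK ?gt_eqF//.
have -> : Cs * eta ^+ 2 = eta / 2.
  by rewrite /eta; field; rewrite gt_eqF// (lt_le_trans ltr01 Cs1).
have : vol (cap x r) <= vol (core x r) + vol (shell x r (eta * r)).
  have mS := measurable_shell r (eta * r) bx.
  rewrite -lee_fin EFinD -(volE d0 mcap (@cap_sub _ _ x r)) -(volE d0 mC Cb).
  rewrite -(volE d0 mS (@shell_sub _ _ x r _)).
  apply: (le_trans _ (measureU2 _ mC mS)); apply: le_measure; rewrite ?inE//.
    exact: measurableU.
  move=> y cy; have [h|h] := leP (eta / 3 * (height x + r)) (height y); first by left.
  right; split=> //=; rewrite (le_trans (ltW h))//.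
  have : eta * (height x + r) <= eta * (3 * r) by rewrite ler_pM2l//; lra.
  by lra.
have : eta / 2 * vol (cap x r) <= 2^-1 * vol (cap x r).
  by rewrite ler_wpM2r//; move: eta1; lra.
by lra.
Qed.

Let cl : R := Num.min 1 (((eta / 3) ^+ 2) `^ e).

Let cl0 : 0 < cl.
Proof. by rewrite lt_min ltr01 powR_gt0// exprn_gt0// divr_gt0. Qed.

Lemma jacobi_cap_ge x r : Bd x -> 0 < r -> r <= 4 ->
  ((cl * ((height x + r) ^+ 2) `^ e * (2^-1 * vol (cap x r)))%:E <=
   \int[leb]_(y in cap x r) (w y)%:E)%E.
Proof.
move=> bx r0 r4; have a0 := height_ge0 x.
have T0 : 0 < height x + r by rewrite ltr_wpDl.
apply: (integral_ge_cst (measurable_ball_cap r bx) _ _ (measurable_core r bx) (@core_sub x r)).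
- by apply: measurable_funTS; exact: measurable_jacobi.
- by move=> y _; exact: jacobi_ge0.
- exact: vol_core.
- by rewrite mulr_ge0 ?powR_ge0// ltW.
- move=> y [cy hy]; have b_y : Bd y by case: cy.
  have H1 : 0 < (eta / 3) ^+ 2 <= 1.
    rewrite exprn_gt0 ?divr_gt0//= expr_le1// ?divr_ge0 ?(ltW eta0)//.
    by move: eta1; lra.
  have H2 : 0 < (height x + r) ^+ 2 by rewrite exprn_gt0.
  have H3 : (eta / 3) ^+ 2 * (height x + r) ^+ 2 <= height y ^+ 2 <= (height x + r) ^+ 2.
    rewrite -exprMn !ler_pXn2r ?nnegrE ?height_ge0 ?(ltW T0) ?mulr_ge0 ?(ltW eta0) ?(ltW T0)//.
    by rewrite hy (height_cap_le bx cy).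
  by rewrite jacobiE//; case/andP: (powR_between e H1 H2 H3).
Qed.

Lemma exists_layer (T h : R) : 0 < h -> h <= T ->
  exists k, h <= T / 2 ^+ k /\ T / 2 ^+ k.+1 <= h.
Proof.
move=> h0 hT.
have ex : exists k, T / h <= 2 ^+ k.+1.
  have [k hk] := exp2_unbounded (T / h); exists k.
  by rewrite (le_trans hk)// exprS ler_peMl ?exprn_ge0// ler1n.
pose k := ex_minn ex.
have [Tk kmin] : T / h <= 2 ^+ k.+1 /\ forall j, T / h <= 2 ^+ j.+1 -> (k <= j)%N.
  by rewrite /k; case: ex_minnP => l ? ?; split.
exists k; split; last by rewrite ler_pdivrMr ?exprn_gt0// mulrC -ler_pdivrMr.
case: (k) kmin => [|j] kmin; first by rewrite expr0 divr1.
rewrite ler_pdivlMr ?exprn_gt0// mulrC -ler_pdivlMr// ltW// ltNge.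
by apply/negP => /kmin; rewrite ltnn.
Qed.

Let Cu : R := Num.max 1 (9^-1 `^ e) + 36 * Cs.

Let Cu0 : 0 < Cu.
Proof.
rewrite ltr_pwDl ?lt_max ?ltr01// mulr_ge0//.
exact: le_trans Cs1.
Qed.

Let quarter_exp k : 4^-1 ^+ k = ((2 ^+ k)^-1) ^+ 2 :> R.
Proof. by rewrite -exprVn -exprM mulnC exprM; congr (_ ^+ _); field. Qed.

(** The critical case is e < 0 near the boundary. For heights between T / 2^(k + 1) and T / 2^k the
    weight is at most T^(2 e) 2^(k + 1), as e >= -1 / 2, and the shell has at most 9 Cs 4^-k times
    the volume of the cap, as T <= 3 r; the products form a geometric series. *)
Lemma jacobi_cap_le x r : Bd x -> 0 < r -> r <= 4 ->
  (\int[leb]_(y in cap x r) (w y)%:E <=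
    (Cu * ((height x + r) ^+ 2) `^ e * vol (cap x r))%:E)%E.
Proof.
move=> bx r0 r4; have a0 := height_ge0 x; set T := height x + r.
have T0 : 0 < T by rewrite ltr_wpDl.
have mcap : measurable (cap x r) by exact: measurable_ball_cap.
have vc : 0 <= vol (cap x r) by exact: (vol_ge0 d0 (@cap_sub _ _ x r)).
have mw : measurable_fun (cap x r) w by apply: measurable_funTS; exact: measurable_jacobi.
have w0 y : cap x r y -> 0 <= w y by move=> _; exact: jacobi_ge0.
have TE : 0 <= (T ^+ 2) `^ e by exact: powR_ge0.
have volcap : (leb (cap x r) <= (vol (cap x r))%:E)%E.
  by rewrite (volE d0 mcap (@cap_sub _ _ x r)).
have Cs0 : 0 <= Cs by exact: le_trans Cs1.
have hT y : cap x r y -> height y ^+ 2 <= T ^+ 2.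
  by move=> cy; rewrite ler_pXn2r ?nnegrE ?height_ge0 ?(ltW T0)// (height_cap_le bx cy).
pose M : R := Num.max 1 (9^-1 `^ e).
have M1 : 1 <= M by rewrite le_max lexx.
have M0 : 0 <= M by exact: le_trans M1.
have CuM : M <= Cu by rewrite lerDl mulr_ge0.
have simple : (forall y, cap x r y -> w y <= M * (T ^+ 2) `^ e) ->
  (\int[leb]_(y in cap x r) (w y)%:E <= (Cu * (T ^+ 2) `^ e * vol (cap x r))%:E)%E.
  move=> h; apply: (le_trans (integral_le_cst mcap mw w0 volcap (mulr_ge0 M0 TE) h)).
  by rewrite lee_fin ler_wpM2r// ler_wpM2r.
have [e0|e0] := leP 0 e.
  apply: simple => y cy; have b_y : Bd y by case: cy.
  rewrite jacobiE// (@le_trans _ _ ((T ^+ 2) `^ e))//; last by rewrite ler_peMl.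
  by apply: ge0_ler_powR; rewrite ?nnegrE ?exprn_ge0 ?height_ge0 ?(ltW T0)// hT.
have [ar|ar] := leP (2 * r) (height x).
  apply: simple => y cy; have b_y : Bd y by case: cy.
  have H1 : 0 < (9^-1 : R) <= 1 by apply/andP; split; [rewrite invr_gt0|rewrite invf_le1// ler1n].
  have H2 : 0 < T ^+ 2 by rewrite exprn_gt0.
  have H3 : 9^-1 * T ^+ 2 <= height y ^+ 2 <= T ^+ 2.
    rewrite hT// andbT (_ : 9^-1 * T ^+ 2 = (T / 3) ^+ 2); last by field.
    rewrite ler_pXn2r ?nnegrE ?height_ge0 ?divr_ge0 ?(ltW T0)//.
    by have := height_cap_ge bx cy; rewrite /T; lra.
  by rewrite jacobiE//; case/andP: (powR_between e H1 H2 H3).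
pose c k : R := (T ^+ 2) `^ e * 2 ^+ k.+1.
pose m k : R := Cs * 9 * (4^-1) ^+ k * vol (cap x r).
apply: (@integral_le_layers _ _ _ leb (cap x r) w mcap mw w0 c m (fun k => shell x r (T / 2 ^+ k))).
- by move=> k; rewrite mulr_ge0// exprn_ge0.
- by move=> k; exact: measurable_shell.
- by move=> k; exact: subIsetl.
- move=> k; have sk : 0 < T / 2 ^+ k by rewrite divr_gt0// exprn_gt0.
  change (leb (shell x r (T / 2 ^+ k)) <= (m k)%:E)%E.
  rewrite (volE d0 (measurable_shell r (T / 2 ^+ k) bx) (@shell_sub _ _ x r _)) lee_fin.
  rewrite (le_trans (vol_shell d0 bx r0 r4 sk))// /m ler_wpM2r// -/Cs -[leRHS]mulrA ler_wpM2l//.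
  rewrite (_ : 9 * 4^-1 ^+ k = (3 / 2 ^+ k) ^+ 2).
    rewrite ler_pXn2r ?nnegrE ?divr_ge0 ?exprn_ge0 ?(ltW T0) ?(ltW r0)//.
    rewrite mulrAC ler_pM2r ?invr_gt0 ?exprn_gt0// ler_pdivrMr//.
    by rewrite /T; lra.
  by rewrite quarter_exp; ring.
- move=> y cy; have b_y : Bd y by case: cy.
  (* On the sphere [powR] gives the weight the value 0, since e is nonzero here. *)
  have := height_ge0 y; rewrite le_eqVlt => /orP[/eqP h0|h0].
    exists 0%N; rewrite jacobiE// -h0 expr0n powR0 ?lt_eqF//.
    by rewrite !mulr_ge0.
  have [k [hk kh]] := exists_layer h0 (height_cap_le bx cy).
  exists k; rewrite indicE mem_set ?mulr1; last by split.
  have H1 : 0 < (4^-1 : R) ^+ k.+1 <= 1.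
    by rewrite exprn_gt0 ?invr_gt0//= exprn_ile1 ?invr_ge0// invf_le1// ler1n.
  have H2 : 0 < T ^+ 2 by rewrite exprn_gt0.
  have H3 : 4^-1 ^+ k.+1 * T ^+ 2 <= height y ^+ 2 <= T ^+ 2.
    rewrite hT// andbT (_ : _ * T ^+ 2 = (T / 2 ^+ k.+1) ^+ 2).
      by rewrite ler_pXn2r ?nnegrE ?height_ge0 ?divr_ge0 ?exprn_ge0 ?(ltW T0).
    by rewrite quarter_exp; ring.
  rewrite jacobiE//; case/andP: (powR_between e H1 H2 H3) => _ /le_trans; apply.
  rewrite /c mulrC ler_wpM2l// ge_max.
  rewrite exprn_ege1 ?ler1n//= exprVn -powR_inv1 ?exprn_ge0// -powRrM mulN1r.
  (* Here mu >= 0 enters, as - e <= 1 / 2. *)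
  rewrite (@le_trans _ _ ((4 ^+ k.+1) `^ 2^-1))//.
    rewrite ler_powR ?exprn_ege1 ?ler1n//.
    by move: mu0; rewrite /e; lra.
  rewrite powR12_sqrt ?exprn_ge0// (_ : 4 ^+ k.+1 = (2 ^+ k.+1) ^+ 2).
    by rewrite sqrtr_sqr ger0_norm ?exprn_ge0.
  rewrite -exprM mulnC exprM; congr (_ ^+ _); ring.
- move=> n.
  have -> : \sum_(k < n) c k * m k =
      18 * Cs * (T ^+ 2) `^ e * vol (cap x r) * \sum_(k < n) 2^-1 ^+ k.
    rewrite mulr_sumr; apply: eq_bigr => k _; rewrite /c /m.
    have -> : (4^-1 : R) ^+ k = (2 ^+ k)^-1 * 2^-1 ^+ k.
      by rewrite -exprVn -exprMn; congr (_ ^+ _); field.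
    by rewrite [2 ^+ k.+1]exprS; field; rewrite expf_neq0.
  rewrite (le_trans (ler_wpM2l _ (sum_geometric_half n)))//.
    by rewrite !mulr_ge0.
  have : 36 * Cs * (T ^+ 2) `^ e * vol (cap x r) <= Cu * (T ^+ 2) `^ e * vol (cap x r).
    by rewrite ler_wpM2r// ler_wpM2r// lerDr.
  by lra.
Qed.

(** The cap of radius 4 about the origin is the whole ball, so the two cap estimates make the
    integral finite and positive. *)
Lemma jacobi_is_weight : is_weight w.
Proof.
have b0 : Bd (@origin R d) by exact: unit_ball_origin.
have BdE : cap (@origin R d) 4 = Bd by exact: cap_large.
have mB : measurable (Bd : set (euclidean R d)) by exact: measurable_unit_ball.
have mw : measurable_fun Bd (EFin \o w).
  by apply/measurable_EFinP; apply: measurable_funTS; exact: measurable_jacobi.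
have r0 : 0 < 4 :> R by [].
have absE : (\int[leb]_(y in Bd) `|(w y)%:E| = \int[leb]_(y in cap (@origin R d) 4) (w y)%:E)%E.
  rewrite BdE; apply: eq_integral => y _.
  by rewrite gee0_abs// lee_fin jacobi_ge0.
split=> [y _||h]; first exact: jacobi_ge0.
  apply/integrableP; split=> //.
  by rewrite absE (le_lt_trans (jacobi_cap_le b0 r0 (lexx _)))// ltry.
have : (\int[leb]_(y in Bd) `|(w y)%:E| = 0)%E.
  apply/(ae_eq_integral_abs _ mB mw); apply: filterS h => y h b_y.
  by rewrite /= (h b_y).
rewrite absE => I0; have := jacobi_cap_ge b0 r0 (lexx _).
rewrite I0 lee_fin leNgt => /negP; apply.
have v0 : 0 < vol Bd.
  by have := @lebesgue_ball_gt0 R d d0; rewrite (volE d0 mB (@subset_refl _ _)).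
rewrite !mulr_gt0 ?powR_gt0 ?exprn_gt0 ?ltr_wpDl ?height_ge0//.
by rewrite BdE.
Qed.

Lemma jacobi_doubling : doubling_weight w.
Proof.
split; first exact: jacobi_is_weight.
(* [height x + r] and [height x + 2 r] differ at most by a factor 2, their squares by 4. *)
pose m4 : R := Num.min 1 (4^-1 `^ e).
have m40 : 0 < m4 by rewrite lt_min ltr01 powR_gt0// invr_gt0.
pose L := Cu / m4 * 64 ^+ d * 2 / cl.
have L0 : 0 < L by rewrite !mulr_gt0 ?invr_gt0 ?exprn_gt0.
exists L => // x.
have small r : Bd x -> 0 < r -> r <= 2 ->
    (wmeasure w (cap x (2 * r)) <= L%:E * wmeasure w (cap x r))%E.
  move=> bx r0 r2; have a0 := height_ge0 x.
  have r20 : 0 < 2 * r by rewrite mulr_gt0.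
  have r24 : 2 * r <= 4 by lra.
  have r4 : r <= 4 by lra.
  apply: (le_trans (jacobi_cap_le bx r20 r24)).
  apply: (@le_trans _ _ (L%:E * (cl * ((height x + r) ^+ 2) `^ e * (2^-1 * vol (cap x r)))%:E)%E).
    rewrite -EFinM lee_fin.
    have vd := vol_doubling d0 bx r0.
    have vc : 0 <= vol (cap x (2 * r)) by exact: (vol_ge0 d0 (@cap_sub _ _ x _)).
    have T0 : 0 < height x + r by rewrite ltr_wpDl.
    have h : ((height x + 2 * r) ^+ 2) `^ e <= m4^-1 * ((height x + r) ^+ 2) `^ e.
      rewrite ler_pdivlMl//.
      have H1 : 0 < (4^-1 : R) <= 1 by apply/andP; split; [rewrite invr_gt0|rewrite invf_le1// ler1n].
      have H2 : 0 < (height x + 2 * r) ^+ 2 by rewrite exprn_gt0// ltr_wpDl.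
      have H3 : 4^-1 * (height x + 2 * r) ^+ 2 <= (height x + r) ^+ 2 <= (height x + 2 * r) ^+ 2.
        rewrite (_ : 4^-1 * _ = ((height x + 2 * r) / 2) ^+ 2); last by field.
        rewrite !ler_pXn2r ?nnegrE ?divr_ge0 ?addr_ge0 ?(ltW r0) ?(ltW r20)//.
        by apply/andP; split; lra.
      by case/andP: (powR_between e H1 H2 H3).
    rewrite (_ : L * _ = Cu * (m4^-1 * ((height x + r) ^+ 2) `^ e) * (64 ^+ d * vol (cap x r))).
      apply: ler_pM => //; first by rewrite mulr_ge0 ?powR_ge0// ltW.
      by rewrite ler_wpM2l// ltW.
    by rewrite /L; field; rewrite !gt_eqF.
  by rewrite lee_wpmul2l ?lee_fin ?(ltW L0)//; exact: jacobi_cap_ge.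
(* The estimates reach radius 4. For r > 2 the larger cap is the whole ball, that is the cap of
   radius 4, and the smaller one contains the cap of radius 2. *)
move=> r bx r0; have [r2|r2] := leP r 2; first exact: small.
rewrite (_ : cap x (2 * r) = cap x (2 * 2)); last first.
  rewrite !cap_large//; lra.
rewrite (le_trans (small 2 bx _ (lexx _)))// lee_wpmul2l ?lee_fin ?(ltW L0)//.
apply: ge0_subset_integral.
- exact: measurable_ball_cap.
- exact: measurable_ball_cap.
- by apply/measurable_EFinP; apply: measurable_funTS; exact: measurable_jacobi.
- by move=> y _; rewrite lee_fin jacobi_ge0.
- exact: cap_mono (ltW r2).
Qed.

End JacobiWeight.

Theorem theorem1p1 (R : realType) (d : nat) (p : R) :
  (2 <= d)%N -> 1 <= p ->
  (forall w : euclidean R d -> R, doubling_weight w ->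
     exists2 c : R, 0 < c &
       forall n : nat, (0 < n)%N -> (Mwor p w n <= (c * n%:R ^+ 2)%:E)%E)
  /\
  (forall mu : R, 0 <= mu ->
     exists c1 c2 : R, [/\ 0 < c1, 0 < c2 &
       forall n : nat, (0 < n)%N ->
         ((c1 * n%:R ^+ 2)%:E <= Mwor p (@jacobi_weight R d mu) n)%E /\
         (Mwor p (@jacobi_weight R d mu) n <= (c2 * n%:R ^+ 2)%:E)%E]).
Proof.
move=> d2 p1; have d0 : (0 < d)%N by exact: ltnW.
split=> [w wd|mu mu0]; first exact: doubling_Mwor_le.
have wd := jacobi_doubling d0 mu0.
have [c1 c10 lower] := doubling_Mwor_ge wd p1 (Ordinal d0).
have [c2 c20 upper] := doubling_Mwor_le wd p1.
by exists c1, c2; split=> // n n0; split; [exact: lower|exact: upper].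
Qed.
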